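(* Let $C,D\in\mathbb{R}\setminus\{0\}$, $\Phi\in\mathcal{S}(\mathbb{R})$, $a\in\mathbb{C}$ with $\Re(a)>-2$, and let $h_a(x)=|1-x^2|^{a/2}h_1(x)$, where $h_1$ is compactly supported and smooth in and up to the boundary of $\{x\in\mathrm{supp}(h_a):|x|>1\}$. Assume that around $x=\pm1$, $h_a$ has asymptotic expansions $h_a(\pm(1-x))\sim|x|^{a/2}\sum_{m=0}^\infty c_m^\pm x^m$. Then for any $\tau,\tau_1\in\mathbb{R}_{>0}$ and $M\in\mathbb{Z}_{>0}$, \[\int_{|x|>1}h_a(x)\,\Phi\!\left(\frac{C}{\sqrt{x^2-1}}\right)e(xD)\,dx=\sum_{m=0}^{M}\sum_{\pm}\frac{e(\pm D)(-1)^m\,\mathcal{A}^{\tau,\pm}_{h_a,m}(\Phi)(\pm C^2D)}{(\pm D)^{m+1+\frac a2}}+O\!\left((C^2D)^{-\tau_1}D^{-(M+2+\frac a2)}\right),\] where the implied constant depends only on $h_a,\Phi,M,\tau_1$ and $a$. Moreover, if $\tilde\Phi(u)$ has at most a simple pole at $u=0$, one can take $\tau_1=0$.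
   Context: $e(x):=e^{2\pi i x}$. Asymptotic expansion: $h_a(\pm(1-x))\sim|x|^{a/2}\sum c_m^\pm x^m$ means that for every $M'\in\mathbb{N}$ there is a neighborhood of $0$ on which $h_a(\pm(1-x))=|x|^{a/2}\sum_{m=0}^{M'}c_m^\pm x^m+O(|x|^{a/2}x^{M'+1})$. $\tilde\Phi(u)=\int_0^\infty\Phi(x)x^{u-1}dx$. For $y\in\mathbb{C}$ set $c_m^\pm(y):=\left(\frac{i}{2\pi}\right)^{1+m+y+\frac a2}2^{y}\sum_{j+k=m,\ j,k\ge0}\frac{c_k^\pm}{(-2)^j}\binom{y}{j}$, and for $\Re(\tau)>0$ \[\mathcal{A}^{\tau,\pm}_{h_a,m}(\Phi)(x):=\frac{1}{2\pi i}\int_{(\tau)}\tilde\Phi(u)\,c_m^\pm\!\left(\tfrac u2\right)\Gamma\!\left(m+1+\tfrac{a+u}{2}\right)x^{-u/2}\,du\] (integral over $\Re(u)=\tau$). Complex powers of nonzero real numbers are taken with the principal branch.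
   Formalization: For C<0 the function Φ is additionally assumed to be even, since the left side then sees only Φ on negative arguments while the right side depends on Φ only on positive ones, and the claim fails for general Φ; for C>0 nothing is added. *)

(* Defs.v *)
(* The complex numbers are R[i] for R : realType. complex.Re and complex.Im are
   R-valued and must be qualified: the unqualified Re and Im are the R[i]-valued
   ones of Num.Theory; likewise 'i%C is the constructor 0 +i* 1. *)
From HB Require Import structures.
From mathcomp Require Import all_boot all_order all_algebra.
From mathcomp Require Import all_classical all_reals all_analysis.
From mathcomp Require Import complex.

Set Implicit Arguments.
Unset Strict Implicit.
Unset Printing Implicit Defensive.

Import Order.TTheory GRing.Theory Num.Theory numFieldNormedType.Exports.
Local Open Scope classical_set_scope.
Local Open Scope ring_scope.
Local Open Scope complex_scope.

Section Defs.
Context {R : realType}.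
Implicit Types (z w u a y : R[i]) (x t : R) (f : R -> R[i]).

Definition Cexp z : R[i] :=
  (expR (complex.Re z))%:C * (cos (complex.Im z) +i* sin (complex.Im z)).

Definition e_ x : R[i] := Cexp (2 * pi%:C * 'i%C * x%:C).

(* The principal argument, in ]-pi, pi] for z != 0. *)
Definition Carg z : R :=
  let t := acos (complex.Re z / Normc.normc z) in
  if 0 <= complex.Im z then t else - t.

Definition Clog z : R[i] := ln (Normc.normc z) +i* Carg z.

(* Principal branch; the value is junk for z = 0. *)
Definition cpow z w : R[i] := Cexp (w * Clog z).

Definition cbinom y (j : nat) : R[i] :=
  (\prod_(i < j) (y - i%:R)) / j`!%:R.

Definition Cintegral (D : set R) f : R[i] :=
  Rintegral (@lebesgue_measure R) D (fun x => complex.Re (f x)) +i*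
  Rintegral (@lebesgue_measure R) D (fun x => complex.Im (f x)).

(* Integral over the vertical line Re u = tau, oriented upwards:
   u = tau + i t and du = i dt. *)
Definition vline_integral (tau : R) (F : R[i] -> R[i]) : R[i] :=
  'i%C * Cintegral setT (fun t => F (tau +i* t)).

Definition mellin (Phi : R -> R[i]) u : R[i] :=
  Cintegral `]0, +oo[ (fun x => Phi x * cpow x%:C (u - 1)).

(* Euler's integral, hence the Gamma function only on Re z > 0. *)
Definition CGamma z : R[i] :=
  Cintegral `]0, +oo[ (fun t => (expR (- t))%:C * cpow t%:C (z - 1)).

Definition schwartzR (g : R -> R) : Prop :=
  (forall n x, derivable (derive1n n g) x 1) /\
  (forall k n, exists B : R, forall x, `|x| ^+ k * `|derive1n n g x| <= B).

Definition schwartz (Phi : R -> R[i]) : Prop :=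
  schwartzR (fun x => complex.Re (Phi x)) /\
  schwartzR (fun x => complex.Im (Phi x)).

(* Smooth on |x| > 1, all derivatives having limits at the boundary points
   1 and -1 from within that region. *)
Definition smooth_up_to_bdR (g : R -> R) : Prop :=
  forall n, [/\ forall x, 1 < `|x| -> derivable (derive1n n g) x 1,
                cvg (derive1n n g x @[x --> 1^'+])
              & cvg (derive1n n g x @[x --> (-1)^'-])].

Definition smooth_up_to_bd f : Prop :=
  smooth_up_to_bdR (fun x => complex.Re (f x)) /\
  smooth_up_to_bdR (fun x => complex.Im (f x)).

Definition compactly_supported f : Prop :=
  compact (closure [set x | f x != 0]).

Definition h_ a (h1 : R -> R[i]) x : R[i] :=
  cpow `|1 - x ^+ 2|%:C (a / 2) * h1 x.

(* h (s (1 - x)) ~ |x|^(a/2) sum_m c_m x^m as x -> 0. The neighborhoods are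
   punctured, since |x|^(a/2) has no value at x = 0. *)
Definition has_asymp_expansion a (h : R -> R[i]) (s : R) (c : nat -> R[i]) :
    Prop :=
  forall M' : nat, exists K : R, \forall x \near 0^',
    `|h (s * (1 - x))
      - cpow `|x|%:C (a / 2) * \sum_(m < M'.+1) c m * x%:C ^+ m|
    <= K%:C * `|cpow `|x|%:C (a / 2) * x%:C ^+ M'.+1|.

Definition coef a (c : nat -> R[i]) (m : nat) y : R[i] :=
  cpow ('i%C / (2 * pi%:C)) (1 + m%:R + y + a / 2) * cpow 2 y *
  \sum_(j < m.+1) c (m - j)%N / (- 2) ^+ j * cbinom y j.

Definition calA (tau : R) a (c : nat -> R[i]) (m : nat) (Phi : R -> R[i]) x :
    R[i] :=
  (2 * pi%:C * 'i%C)^-1 *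
  vline_integral tau (fun u =>
    mellin Phi u * coef a c m (u / 2) * CGamma (m%:R + 1 + (a + u) / 2) *
    cpow x%:C (- u / 2)).

(* F, given on Re u > 0, continues meromorphically to a neighborhood of 0 with
   at most a simple pole at 0: u * F u continues holomorphically there. *)
Definition at_most_simple_pole_at0 (F : R[i] -> R[i]) : Prop :=
  exists (r : R) (G : R[i]^o -> R[i]^o), 0 < r /\
    (forall u : R[i]^o, `|u| < r%:C -> derivable G u 1) /\
    (forall u, `|u| < r%:C -> 0 < complex.Re u -> G u = u * F u).

End Defs.

(* Main.v *)
(* Substitute x = s (1 + v), s = 1 or -1, so that each half-line contributes e(sD) times
     int_0^oo v^(a/2) H(v) Phi(|C| / sqrt(2v + v^2)) e(D' v) dv,   D' = sD,
   where H(v) = (2 + v)^(a/2) h_1(s (1 + v)) is smooth up to v = 0 with Taylor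
   coefficients (-1)^k c_k. Expand H at 0 and w |-> Phi(|C| / sqrt w) around w = 2v.
   The terms of total order m are multiples of v^(m + a/2) Phi_j(|C| / sqrt(2v)), where
   the Mellin transform of Phi_j is binom(u/2, j) times that of Phi; Mellin inversion
   and Euler's integral turn their integrals into the j-summands of A_m.
   The remainder is a symbol: its n-th derivative is
   O(|C|^(-2 tau1) v^(Re a / 2 + tau1 + M + 1 - n)) uniformly in C. Cutting the integral
   at v = 1 / |D| and integrating by parts beyond gives the error term.
   Conditional convergence is dealt with by replacing e(D' v) with exp(- z v),
   z = eps + i y, y = - 2 pi D', and letting eps tend to 0. *)
Require Import Defs.
From HB Require Import structures.
From mathcomp Require Import all_boot all_order all_algebra.
From mathcomp Require Import all_classical all_reals all_analysis.
From mathcomp Require Import measurable_realfun complex zify ring lra.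
Set Implicit Arguments.
Unset Strict Implicit.
Unset Printing Implicit Defensive.
Import Order.TTheory GRing.Theory Num.Theory numFieldNormedType.Exports.
Local Open Scope classical_set_scope.
Local Open Scope ring_scope.
Local Open Scope complex_scope.

(** Everything is a statement about real and imaginary parts of functions of one real variable, and
    no contour is shifted: Mellin inversion is proved on each vertical line by itself, so the main
    terms do not depend on [tau], and neither does the constant. The factor |C|^(-2 tau1) has a
    single origin: [Phi] and its images under x d/dx are O(x^kap) on the whole of ]0, +oo[ for every
    kap <= 0, and kap = -2 tau1 at x = |C| / sqrt w gives |C|^(-2 tau1) w^tau1. The obstacle is the
    passage to Re z = 0. The main terms keep no compact support, so every estimate for Re z > 0 has
    to involve |z| alone. The oscillatory bound is therefore used twice: with parameter |C| for the
    remainder, and with parameter t = Im u for Gamma(s) z^(-s), where the decay e^(-pi |t| / 2) of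
    Gamma may be cancelled by the growth of z^(-s) and only a bound for the product, polynomial in
    t, is of use. *)

Local Notation re := (@complex.Re _).
Local Notation im := (@complex.Im _).
Local Notation nm := (@Normc.normc _).

(** * Complex-valued limits, derivatives and integrals *)

Section ComplexAlgebra.
Context {R : realType}.
Implicit Types (z w : R[i]) (x y : R).

Lemma cReD z w : re (z + w) = re z + re w. Proof. by case: z w => ? ? []. Qed.
Lemma cImD z w : im (z + w) = im z + im w. Proof. by case: z w => ? ? []. Qed.
Lemma cReN z : re (- z) = - re z. Proof. by case: z. Qed.
Lemma cImN z : im (- z) = - im z. Proof. by case: z. Qed.
Lemma cReB z w : re (z - w) = re z - re w. Proof. by rewrite cReD cReN. Qed.
Lemma cImB z w : im (z - w) = im z - im w. Proof. by rewrite cImD cImN. Qed.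
Lemma cReM z w : re (z * w) = re z * re w - im z * im w.
Proof. by case: z w => ? ? []. Qed.
Lemma cImM z w : im (z * w) = re z * im w + im z * re w.
Proof. by case: z w => ? ? []. Qed.
Lemma cReMr z x : re (z * x%:C) = re z * x.
Proof. by rewrite cReM /= mulr0 subr0. Qed.
Lemma cImMr z x : im (z * x%:C) = im z * x.
Proof. by rewrite cImM /= mulr0 add0r. Qed.
Lemma cReMl z x : re (x%:C * z) = x * re z.
Proof. by rewrite mulrC cReMr mulrC. Qed.
Lemma cImMl z x : im (x%:C * z) = x * im z.
Proof. by rewrite mulrC cImMr mulrC. Qed.
Lemma eqC z w : re z = re w -> im z = im w -> z = w.
Proof. by case: z w => ? ? [? ?] /= -> ->. Qed.
Lemma cRe_nat n : re (n%:R : R[i]) = n%:R.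
Proof. by elim: n => // n IH; rewrite -natr1 cReD IH natr1. Qed.
Lemma cIm_nat n : im (n%:R : R[i]) = 0.
Proof. by elim: n => // n IH; rewrite -natr1 cImD IH addr0. Qed.
Lemma natrC n : (n%:R : R[i]) = (n%:R : R)%:C.
Proof. by apply: eqC; rewrite ?cRe_nat ?cIm_nat. Qed.
Lemma cRe_half z : re (z / 2) = re z / 2.
Proof. by rewrite natrC -fmorphV cReMr. Qed.
Lemma cIm_half z : im (z / 2) = im z / 2.
Proof. by rewrite natrC -fmorphV cImMr. Qed.

Lemma nmE z : nm z = Num.sqrt (re z ^+ 2 + im z ^+ 2).
Proof. by case: z. Qed.
Lemma nm_ge0 z : 0 <= nm z. Proof. by rewrite nmE sqrtr_ge0. Qed.
Lemma nm0 : nm (0 : R[i]) = 0. Proof. exact: Normc.normc0. Qed.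
Lemma nmM z w : nm (z * w) = nm z * nm w. Proof. exact: Normc.normcM. Qed.
Lemma nmD z w : nm (z + w) <= nm z + nm w. Proof. exact: le_normcD. Qed.
Lemma nmN z : nm (- z) = nm z. Proof. exact: normcN. Qed.
Lemma nmB z w : nm (z - w) <= nm z + nm w.
Proof. by rewrite -(nmN w) nmD. Qed.
Lemma nmBC z w : nm (z - w) = nm (w - z).
Proof. by rewrite -nmN opprB. Qed.
Lemma nmV z : nm z^-1 = (nm z)^-1. Proof. exact: Normc.normcV. Qed.
Lemma nm_eq0 z : (nm z == 0) = (z == 0).
Proof.
apply/eqP/eqP => [|->]; [exact: Normc.eq0_normc|exact: nm0].
Qed.
Lemma nm_gt0 z : (0 < nm z) = (z != 0).
Proof. by rewrite lt_def nm_ge0 andbT nm_eq0. Qed.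
Lemma nmR x : nm x%:C = `|x|.
Proof. by rewrite nmE /= expr0n addr0 sqrtr_sqr. Qed.
Lemma nmX z n : nm (z ^+ n) = nm z ^+ n.
Proof.
elim: n => [|n IH]; last by rewrite !exprS nmM IH.
by rewrite !expr0 Normc.normc1.
Qed.
Lemma nm_nat n : nm (n%:R : R[i]) = n%:R.
Proof. by rewrite natrC nmR ger0_norm. Qed.
Lemma nm_half z : nm (z / 2) = nm z / 2.
Proof. by rewrite nmM nmV nm_nat. Qed.
Lemma normrC z : `|z| = (nm z)%:C.
Proof. by rewrite normc_def nmE. Qed.
Lemma cRe_le_nm z : `|re z| <= nm z.
Proof. by rewrite nmE -sqrtr_sqr ler_sqrt ?addr_ge0 ?sqr_ge0// lerDl sqr_ge0. Qed.
Lemma cIm_le_nm z : `|im z| <= nm z.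
Proof. by rewrite nmE -sqrtr_sqr ler_sqrt ?addr_ge0 ?sqr_ge0// lerDr sqr_ge0. Qed.
Lemma nm_le_ReIm z : nm z <= `|re z| + `|im z|.
Proof.
rewrite nmE -[leRHS]ger0_norm ?addr_ge0// -sqrtr_sqr ler_sqrt ?sqr_ge0//.
by rewrite sqrrD !real_normK ?num_real// lerD2r lerDl mulrn_wge0// mulr_ge0.
Qed.
Lemma nm_le_le z x : `|re z| <= x -> `|im z| <= x -> nm z <= 2 * x.
Proof. by move=> h1 h2; rewrite (le_trans (nm_le_ReIm z))// mulr_natl mulr2n lerD. Qed.

Lemma ReCexp z : re (Cexp z) = expR (re z) * cos (im z).
Proof. by rewrite /Cexp cReMl. Qed.
Lemma ImCexp z : im (Cexp z) = expR (re z) * sin (im z).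
Proof. by rewrite /Cexp cImMl. Qed.
Lemma CexpD z w : Cexp (z + w) = Cexp z * Cexp w.
Proof.
by apply: eqC; [rewrite ReCexp cReM|rewrite ImCexp cImM];
  rewrite !ReCexp !ImCexp cReD cImD expRD ?cosD ?sinD; ring.
Qed.
Lemma Cexp0 : Cexp (0 : R[i]) = 1.
Proof. by apply: eqC; rewrite ?ReCexp ?ImCexp /= expR0 ?cos0 ?sin0 ?mulr1 ?mulr0. Qed.
Lemma nm_Cexp z : nm (Cexp z) = expR (re z).
Proof.
rewrite nmE ReCexp ImCexp !exprMn -mulrDr cos2Dsin2 mulr1 sqrtr_sqr.
by rewrite ger0_norm// expR_ge0.
Qed.
Lemma Cexp_neq0 z : Cexp z != 0.
Proof. by rewrite -nm_gt0 nm_Cexp expR_gt0. Qed.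
Lemma CexpN z : Cexp (- z) = (Cexp z)^-1.
Proof.
by apply: (mulIf (Cexp_neq0 z)); rewrite -CexpD addNr Cexp0 mulVf// Cexp_neq0.
Qed.
Lemma CexpR x : Cexp x%:C = (expR x)%:C.
Proof. by apply: eqC; rewrite ?ReCexp ?ImCexp /= ?cos0 ?sin0 ?mulr1 ?mulr0. Qed.

Lemma acos_arg_itv z : z != 0 -> -1 <= re z / nm z <= 1.
Proof.
rewrite -nm_gt0 => z0; rewrite ler_pdivrMr// ler_pdivlMr// mulN1r mul1r.
by rewrite -ler_norml cRe_le_nm.
Qed.
Lemma CexpLog z : z != 0 -> Cexp (Clog z) = z.
Proof.
move=> z0; have n0 : 0 < nm z by rewrite nm_gt0.
have I := acos_arg_itv z0.
have [I1 _] := acos_def I.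
have hc : cos (Carg z) = re z / nm z.
  by rewrite /Carg; case: ifP => _; rewrite ?cosN acosK.
have hs : sin (Carg z) = im z / nm z.
  (* The sine of an arccosine is a nonnegative root and yields only |im z| / nm z; the case split on
     the sign of im z in [Carg] restores the sign. *)
  have ne : Num.sqrt (1 - (re z / nm z) ^+ 2) = `|im z| / nm z.
    have -> : 1 - (re z / nm z) ^+ 2 = (im z / nm z) ^+ 2.
      have : nm z ^+ 2 = re z ^+ 2 + im z ^+ 2.
        by rewrite nmE sqr_sqrtr// addr_ge0 ?sqr_ge0.
      rewrite !expr_div_n => e; rewrite -[1](@divff _ (nm z ^+ 2)) ?expf_neq0 ?gt_eqF//.
      by rewrite -mulrBl {1}e addrC addKr.
    by rewrite sqrtr_sqr normrM normfV (ger0_norm (nm_ge0 z)).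
  rewrite /Carg; case: ifPn => hi; first by rewrite sin_acos// ne ger0_norm.
  by rewrite sinN sin_acos// ne ltr0_norm ?ltNge// mulNr opprK.
apply: eqC; rewrite ?ReCexp ?ImCexp /= lnK ?posrE// ?hc ?hs mulrC divfK ?gt_eqF//.
Qed.
Lemma ClogR x : 0 < x -> Clog x%:C = (ln x)%:C.
Proof.
move=> x0; apply: eqC; first by rewrite /Clog nmR /= gtr0_norm.
rewrite /Clog /=.
by rewrite /Carg nmR /= lexx gtr0_norm// divff ?gt_eqF// acos1.
Qed.
Lemma ClogRN x : x < 0 -> Clog x%:C = ln (- x) +i* pi.
Proof.
move=> x0; apply: eqC; first by rewrite /Clog nmR /= ltr0_norm.
rewrite /Clog /=.
by rewrite /Carg nmR /= lexx ltr0_norm// invrN mulrN divff ?lt_eqF// acosN1.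
Qed.
(** An argument of size at least pi / 2 would force a nonpositive cosine. The strict bound keeps the
    powers z^theta, 0 <= theta <= 1, in the right half-plane, as the rotation of the Gamma integral
    requires. *)
Lemma Carg_lt z : 0 < re z -> - (pi / 2) < Carg z < pi / 2.
Proof.
move=> r0; have z0 : z != 0 by rewrite -nm_gt0 (lt_le_trans _ (cRe_le_nm z))// gtr0_norm.
have n0 : 0 < nm z by rewrite nm_gt0.
have I := acos_arg_itv z0; have [I1 I2] := acos_def I.
have ht : acos (re z / nm z) < pi / 2.
  rewrite ltNge; apply/negP => h.
  have p0 := @pi_gt0 R.
  have hI (t : R) : 0 <= t <= pi -> t \in `[0, pi] by rewrite in_itv.
  have : cos (acos (re z / nm z)) <= 0.
    rewrite -cos_pihalf; move: h; rewrite le_eqVlt => /orP[/eqP->//|h].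
    by apply: ltW; rewrite ltr_cos// hI//; lra.
  by rewrite acosK// leNgt divr_gt0.
rewrite /Carg; case: ifP => _; last rewrite ltrN2 ht/= ltrNl.
  by rewrite ht andbT (lt_le_trans _ (andP I1).1)// oppr_lt0 divr_gt0// pi_gt0.
by rewrite (lt_le_trans _ (andP I1).1)// oppr_lt0 divr_gt0// pi_gt0.
Qed.

Lemma cpowR x z : 0 < x -> cpow x%:C z = Cexp (z * (ln x)%:C).
Proof. by move=> x0; rewrite /cpow ClogR. Qed.
Lemma cpowDr z w1 w2 : cpow z (w1 + w2) = cpow z w1 * cpow z w2.
Proof. by rewrite /cpow mulrDl CexpD. Qed.
Lemma cpow0 z : cpow z 0 = 1. Proof. by rewrite /cpow mul0r Cexp0. Qed.
Lemma cpowN z w : cpow z (- w) = (cpow z w)^-1.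
Proof. by rewrite /cpow mulNr CexpN. Qed.
Lemma cpow_neq0 z w : cpow z w != 0. Proof. exact: Cexp_neq0. Qed.
Lemma cpow1 z : z != 0 -> cpow z 1 = z.
Proof. by move=> z0; rewrite /cpow mul1r CexpLog. Qed.
Lemma cpow_nat z n : z != 0 -> cpow z n%:R = z ^+ n.
Proof.
move=> z0; elim: n => [|n IH]; first by rewrite cpow0 expr0.
by rewrite -natr1 cpowDr IH cpow1// exprSr.
Qed.
Lemma cpowMR x y z : 0 < x -> 0 < y ->
  cpow (x * y)%:C z = cpow x%:C z * cpow y%:C z.
Proof.
by move=> x0 y0; rewrite !cpowR ?mulr_gt0// lnM ?posrE// rmorphD/= mulrDr CexpD.
Qed.
Lemma nm_cpowR x z : 0 < x -> nm (cpow x%:C z) = x `^ re z.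
Proof. by move=> x0; rewrite cpowR// nm_Cexp cReMr /powR gt_eqF. Qed.
End ComplexAlgebra.

Section ComplexLimits.
Context {R : realType}.

(** Componentwise, so that limits of complex functions reduce to limits over [R]; the filter is
    arbitrary, which covers one-sided limits, infinity and sequences alike. *)
Definition ccvg {T : Type} (F : set_system T) (f : T -> R[i]) (l : R[i]) : Prop :=
  ((re (f x) @[x --> F] --> re l) * (im (f x) @[x --> F] --> im l))%type.

Context {T : Type} {F : set_system T} {FF : Filter F}.
Implicit Types (f g : T -> R[i]) (l k : R[i]).

Lemma ccvg_cst l : ccvg F (fun=> l) l.
Proof. by split; exact: cvg_cst. Qed.
Lemma ccvgD f g l k : ccvg F f l -> ccvg F g k -> ccvg F (fun x => f x + g x) (l + k).
Proof.
move=> [f1 f2] [g1 g2]; split; rewrite ?cReD ?cImD.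
  by under eq_fun do rewrite cReD; exact: cvgD.
by under eq_fun do rewrite cImD; exact: cvgD.
Qed.
Lemma ccvgN f l : ccvg F f l -> ccvg F (fun x => - f x) (- l).
Proof.
move=> [f1 f2]; split; rewrite ?cReN ?cImN.
  by under eq_fun do rewrite cReN; exact: cvgN.
by under eq_fun do rewrite cImN; exact: cvgN.
Qed.
Lemma ccvgB f g l k : ccvg F f l -> ccvg F g k -> ccvg F (fun x => f x - g x) (l - k).
Proof. by move=> fl gk; exact/ccvgD/ccvgN. Qed.
Lemma ccvgM f g l k : ccvg F f l -> ccvg F g k -> ccvg F (fun x => f x * g x) (l * k).
Proof.
move=> [f1 f2] [g1 g2]; split; rewrite ?cReM ?cImM.
  by under eq_fun do rewrite cReM; apply: cvgB; exact: cvgM.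
by under eq_fun do rewrite cImM; apply: cvgD; exact: cvgM.
Qed.
Lemma ccvgMl f l k : ccvg F f l -> ccvg F (fun x => k * f x) (k * l).
Proof. by move=> fl; exact/ccvgM/fl/ccvg_cst. Qed.
Lemma ccvg_sum I (s : seq I) (P : pred I) (G : I -> T -> R[i]) (l : I -> R[i]) :
  (forall i, P i -> ccvg F (G i) (l i)) ->
  ccvg F (fun x => \sum_(i <- s | P i) G i x) (\sum_(i <- s | P i) l i).
Proof.
move=> H; elim: s => [|i s IH].
  by rewrite big_nil; under eq_fun do rewrite big_nil; exact: ccvg_cst.
rewrite big_cons; under eq_fun do rewrite big_cons.
by case: ifPn => // Pi; apply: ccvgD => //; exact: H.
Qed.
Lemma ccvgR (f : T -> R) (l : R) : f x @[x --> F] --> l -> ccvg F (fun x => (f x)%:C) l%:C.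
Proof. by move=> fl; split => //=; exact: cvg_cst. Qed.
Lemma ccvg_Cexp f l : ccvg F f l -> ccvg F (fun x => Cexp (f x)) (Cexp l).
Proof.
move=> [f1 f2]; split; rewrite ?ReCexp ?ImCexp.
  under eq_fun do rewrite ReCexp; apply: cvgM.
    by apply: continuous_cvg f1; exact: continuous_expR.
  by apply: continuous_cvg f2; exact: continuous_cos.
under eq_fun do rewrite ImCexp; apply: cvgM.
  by apply: continuous_cvg f1; exact: continuous_expR.
by apply: continuous_cvg f2; exact: continuous_sin.
Qed.
Lemma ccvg_near f g l : (\forall x \near F, f x = g x) -> ccvg F g l -> ccvg F f l.
Proof.
move=> fg [g1 g2]; split; [apply: cvg_trans g1|apply: cvg_trans g2];
  by apply: near_eq_cvg; near=> x; rewrite /= (near fg x).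
Unshelve. all: end_near. Qed.
Lemma ccvg_nm f l : ccvg F f l -> nm (f x) @[x --> F] --> nm l.
Proof.
move=> [f1 f2]; under eq_fun do rewrite nmE.
rewrite nmE.
have H : re (f x) ^+ 2 + im (f x) ^+ 2 @[x --> F] --> re l ^+ 2 + im l ^+ 2.
  by apply: cvgD; rewrite !expr2; under eq_fun do rewrite expr2; exact: cvgM.
by apply: continuous_cvg H; exact: sqrt_continuous.
Qed.
Lemma ccvg0_le f (g : T -> R) : (\forall x \near F, nm (f x) <= g x) ->
  g x @[x --> F] --> 0 -> ccvg F f 0.
Proof.
move=> fg g0; have g0' : - g x @[x --> F] --> 0 by rewrite -oppr0; exact: cvgN.
split; apply: (squeeze_cvgr _ g0' g0); near=> x; rewrite -ler_norml.
  by rewrite (le_trans (cRe_le_nm _))// (near fg x).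
by rewrite (le_trans (cIm_le_nm _))// (near fg x).
Unshelve. all: end_near. Qed.
End ComplexLimits.

Lemma ccvg_comp {R : realType} {T U : Type} (F : set_system T) (G : set_system U)
  (h : T -> U) (f : U -> R[i]) l : h @ F --> G -> ccvg G f l -> ccvg F (f \o h) l.
Proof. by move=> hG [f1 f2]; split; [exact: (cvg_comp _ _ hG f1)|exact: (cvg_comp _ _ hG f2)]. Qed.

Lemma ccvg_unique {R : realType} {T : Type} (F : set_system T) {FF : ProperFilter F}
  (f : T -> R[i]) l k : ccvg F f l -> ccvg F f k -> l = k.
Proof.
move=> [f1 f2] [g1 g2]; apply: eqC.
  exact: (cvg_unique (@Rhausdorff R) f1 g1).
exact: (cvg_unique (@Rhausdorff R) f2 g2).
Qed.

Section ComplexDerivative.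
Context {R : realType}.
Implicit Types (f g : R -> R[i]) (x y : R) (d e : R[i]).

(** Relational, with the derivative as an argument: a derivative is produced by unification and
    brought to the desired form at the end by [cder_eq]. *)
Definition cder f x d : Prop :=
  is_derive x 1 (fun y => re (f y)) (re d) /\
  is_derive x 1 (fun y => im (f y)) (im d).

Lemma isd_eq (u : R -> R) x (a b : R) : is_derive x 1 u a -> a = b -> is_derive x 1 u b.
Proof. by move=> ? <-. Qed.
Lemma isdM (u v : R -> R) x (a b : R) : is_derive x 1 u a -> is_derive x 1 v b ->
  is_derive x 1 (fun y => u y * v y) (a * v x + u x * b).
Proof.
move=> h1 h2; apply: (is_derive_eq (is_deriveM h1 h2)).
by rewrite addrC; congr (_ + _); rewrite /GRing.scale/= mulrC.
Qed.
Lemma isdZ (k : R) (u : R -> R) x (a : R) : is_derive x 1 u a ->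
  is_derive x 1 (fun y => k * u y) (k * a).
Proof.
by move=> h; apply: isd_eq (isdM (is_derive_cst k x 1) h) _; rewrite mul0r add0r.
Qed.
Lemma isdC (k x : R) : is_derive x 1 (fun=> k) 0.
Proof. exact: is_derive_cst. Qed.
Lemma isdid (x : R) : is_derive x 1 (fun y => y) 1.
Proof. exact: is_derive_id. Qed.
Lemma isdN (u : R -> R) x (a : R) : is_derive x 1 u a ->
  is_derive x 1 (fun y => - u y) (- a).
Proof. exact: is_deriveN. Qed.
Lemma isdV (u : R -> R) x (a : R) : u x != 0 -> is_derive x 1 u a ->
  is_derive x 1 (fun y => (u y)^-1) (- (u x) ^- 2 * a).
Proof. by move=> ux h; exact: is_deriveV. Qed.
Lemma isd_powR (g x : R) : 0 < x -> is_derive x 1 (fun y => y `^ g) (g * x `^ (g - 1)).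
Proof. by move=> x0; exact: is_derive1_powR. Qed.
Lemma isdD (u v : R -> R) x (a b : R) : is_derive x 1 u a -> is_derive x 1 v b ->
  is_derive x 1 (fun y => u y + v y) (a + b).
Proof. exact: is_deriveD. Qed.
Lemma isdB (u v : R -> R) x (a b : R) : is_derive x 1 u a -> is_derive x 1 v b ->
  is_derive x 1 (fun y => u y - v y) (a - b).
Proof. exact: is_deriveB. Qed.
Lemma isdcomp (u v : R -> R) x (a b : R) : is_derive (v x) 1 u a ->
  is_derive x 1 v b -> is_derive x 1 (fun y => u (v y)) (a * b).
Proof. exact: is_derive1_comp. Qed.

Lemma isd_subX (n : nat) (a x : R) :
  is_derive x 1 (fun y => (y - a) ^+ n.+1) (n.+1%:R * (x - a) ^+ n).
Proof.
have H : is_derive x 1 (fun y => y - a) 1.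
  by apply: isd_eq (isdB (is_derive_id _ _) (is_derive_cst _ _ _)) _; rewrite subr0.
elim: n => [|n IH]; first by rewrite mulr1.
under eq_fun do rewrite exprS.
by apply: isd_eq (isdM H IH) _; rewrite -(natr1 n.+1) !exprS; ring.
Qed.

Lemma cder_eq f x d e : cder f x d -> d = e -> cder f x e.
Proof. by move=> ? <-. Qed.
Lemma cder_cst x d : cder (fun=> d) x 0.
Proof. by split; exact: is_derive_cst. Qed.
Lemma cder_ext f g x d : f =1 g -> cder f x d -> cder g x d.
Proof. by move=> /funext ->. Qed.
Lemma cderD f g x d e : cder f x d -> cder g x e -> cder (fun y => f y + g y) x (d + e).
Proof.
move=> [f1 f2] [g1 g2]; split; rewrite ?cReD ?cImD.
  by under eq_fun do rewrite cReD; exact: is_deriveD.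
by under eq_fun do rewrite cImD; exact: is_deriveD.
Qed.
Lemma cderN f x d : cder f x d -> cder (fun y => - f y) x (- d).
Proof.
move=> [f1 f2]; split; rewrite ?cReN ?cImN.
  by under eq_fun do rewrite cReN; exact: is_deriveN.
by under eq_fun do rewrite cImN; exact: is_deriveN.
Qed.
Lemma cderB f g x d e : cder f x d -> cder g x e -> cder (fun y => f y - g y) x (d - e).
Proof. by move=> fd ge; exact/cderD/cderN. Qed.
Lemma cderM f g x d e : cder f x d -> cder g x e ->
  cder (fun y => f y * g y) x (d * g x + f x * e).
Proof.
move=> [f1 f2] [g1 g2]; split.
  under eq_fun do rewrite cReM.
  apply: (isd_eq (isdB (isdM f1 g1) (isdM f2 g2))).
  by rewrite cReD !cReM; ring.
under eq_fun do rewrite cImM.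
apply: (isd_eq (isdD (isdM f1 g2) (isdM f2 g1))).
by rewrite cImD !cImM; ring.
Qed.
Lemma cderZ f x d k : cder f x d -> cder (fun y => k * f y) x (k * d).
Proof. by move=> fd; apply: cder_eq (cderM (cder_cst x k) fd) _; rewrite mul0r add0r. Qed.
Lemma cder_sum I (s : seq I) (P : pred I) (G : I -> R -> R[i]) x (d : I -> R[i]) :
  (forall i, P i -> cder (G i) x (d i)) ->
  cder (fun y => \sum_(i <- s | P i) G i y) x (\sum_(i <- s | P i) d i).
Proof.
move=> H; elim: s => [|i s IH].
  by rewrite big_nil; under eq_fun do rewrite big_nil; exact: cder_cst.
rewrite big_cons; under eq_fun do rewrite big_cons.
by case: ifPn => // Pi; apply: cderD => //; exact: H.
Qed.
Lemma cderR (u : R -> R) x (a : R) : is_derive x 1 u a -> cder (fun y => (u y)%:C) x a%:C.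
Proof. by move=> ua; split => //=; exact: is_derive_cst. Qed.
Lemma cder_comp f (v : R -> R) x d (b : R) : cder f (v x) d -> is_derive x 1 v b ->
  cder (fun y => f (v y)) x (d * b%:C).
Proof.
by move=> [f1 f2] vb; split; rewrite ?cReMr ?cImMr;
  [exact: (isdcomp (u := fun y => re (f y)))|exact: (isdcomp (u := fun y => im (f y)))].
Qed.
Lemma cder_Cexp f x d : cder f x d -> cder (fun y => Cexp (f y)) x (d * Cexp (f x)).
Proof.
move=> [f1 f2]; split.
  under eq_fun do rewrite ReCexp.
  apply: (isd_eq (isdM (isdcomp (is_derive_expR _) f1) (isdcomp (is_derive_cos _) f2))).
  by rewrite cReM ReCexp ImCexp; ring.
under eq_fun do rewrite ImCexp.
apply: (isd_eq (isdM (isdcomp (is_derive_expR _) f1) (isdcomp (is_derive_sin _) f2))).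
by rewrite cImM ReCexp ImCexp; ring.
Qed.
Lemma cder_id x : cder (fun y => y%:C) x 1.
Proof. by apply: cderR; exact: is_derive_id. Qed.
Lemma cder_near f g x d : (\forall y \near x, f y = g y) -> cder f x d -> cder g x d.
Proof.
move=> fg [[f1 e1] [f2 e2]].
have h1 : {near x, (fun y => re (f y)) =1 (fun y => re (g y))}.
  by near=> y; rewrite /= (near fg y).
have h2 : {near x, (fun y => im (f y)) =1 (fun y => im (g y))}.
  by near=> y; rewrite /= (near fg y).
split; split.
- exact: near_eq_derivable f1.
- by rewrite -e1; apply/esym/near_eq_derive.
- exact: near_eq_derivable f2.
- by rewrite -e2; apply/esym/near_eq_derive.
Unshelve. all: end_near. Qed.
Lemma cder_cont f x d : cder f x d -> ccvg (nbhs x) f (f x).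
Proof.
move=> [[f1 _] [f2 _]]; split.
- exact: (differentiable_continuous (proj1 (derivable1_diffP _ _) f1)).
- exact: (differentiable_continuous (proj1 (derivable1_diffP _ _) f2)).
Qed.
Lemma cder_unique f x d e : cder f x d -> cder f x e -> d = e.
Proof.
by move=> [[_ f1] [_ f2]] [[_ g1] [_ g2]]; apply: eqC; rewrite -?f1 -?f2.
Qed.

Lemma cder_cpowR (z : R[i]) x : 0 < x ->
  cder (fun y => cpow y%:C z) x (z * cpow x%:C (z - 1)).
Proof.
move=> x0; apply: (@cder_near (fun y => Cexp (z * (ln y)%:C))).
  by near=> y; rewrite cpowR//; near: y; exact: lt_nbhsr.
apply: cder_eq.
  apply: cder_Cexp; apply: cderZ; apply: cderR; exact: is_derive1_ln.
rewrite -cpowR// cpowDr cpowN cpow1; first by rewrite rmorphV ?unitfE ?gt_eqF//=; ring.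
by apply/eqP => -[/eqP]; rewrite gt_eqF.
Unshelve. all: end_near. Qed.

(** The mean value theorem on [y, b], then y -> a from the right. At [a] only a one-sided limit is
    asked for, which is all that smoothness up to the boundary provides. *)
Lemma real_mvi (u du : R -> R) (a b l B : R) : a < b ->
  (forall y, a < y -> y <= b -> is_derive y 1 u (du y)) ->
  (forall y, a < y -> y < b -> `|du y| <= B) ->
  u y @[y --> a^'+] --> l -> `|u b - l| <= B * (b - a).
Proof.
move=> ab du1 duB ul.
have H y : a < y -> y < b -> `|u b - u y| <= B * (b - a).
  move=> ay yb.
  have D z : z \in `]y, b[ -> is_derive z 1 u (du z).
    by rewrite in_itv/= => /andP[yz zb]; apply: du1; rewrite ?(lt_trans ay)// ltW.
  have cu : {within `[y, b], continuous u}.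
    apply: continuous_in_subspaceT => z; rewrite inE/= in_itv/= => /andP[yz zb].
    have [dz _] := du1 z (lt_le_trans ay yz) zb.
    exact: (differentiable_continuous (proj1 (derivable1_diffP _ _) dz)).
  have [c + ->] := MVT yb D cu; rewrite in_itv/= => /andP[yc cb].
  rewrite normrM ler_pM// ?duB ?(lt_trans ay)//.
  by rewrite gtr0_norm ?subr_gt0// lerD2l lerN2 ltW.
have C : `|u b - u y| @[y --> a^'+] --> `|u b - l|.
  by apply: cvg_norm; apply: cvgB => //; exact: cvg_cst.
apply: (cvgr_to_le C); near=> y; apply: H.
  by near: y; exact: nbhs_right_gt.
by near: y; exact: nbhs_right_lt.
Unshelve. all: end_near. Qed.

(** The mean value theorem fails for complex values; real and imaginary parts are treated
    separately, which costs the factor 2. *)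
Lemma complex_mvi f (df : R -> R[i]) (a b B : R) l : a < b ->
  (forall y, a < y -> y <= b -> cder f y (df y)) ->
  (forall y, a < y -> y < b -> nm (df y) <= B) ->
  ccvg a^'+ f l -> nm (f b - l) <= 2 * (B * (b - a)).
Proof.
move=> ab fd dB [f1 f2]; apply: nm_le_le.
  rewrite cReB; apply: (@real_mvi (fun y => re (f y)) (fun y => re (df y))) => //.
    by move=> y ay yb; have [] := fd y ay yb.
  by move=> y ay yb; rewrite (le_trans (cRe_le_nm _))// dB.
rewrite cImB; apply: (@real_mvi (fun y => im (f y)) (fun y => im (df y))) => //.
  by move=> y ay yb; have [] := fd y ay yb.
by move=> y ay yb; rewrite (le_trans (cIm_le_nm _))// dB.
Qed.

(** Induction on [N]: f_0 minus its Taylor polynomial tends to 0 at [a], and its derivative is the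
    remainder, one order lower, of the shifted sequence. The supremum is carried along rather than
    integrated, hence 2^(N+1), one factor 2 per use of [complex_mvi], and no factorial. *)
Lemma taylor_bound (N : nat) (f : nat -> R -> R[i]) (l : nat -> R[i]) (a b B : R) :
  (forall k y, (k <= N)%N -> a < y -> y <= b -> cder (f k) y (f k.+1 y)) ->
  (forall k, (k <= N)%N -> ccvg a^'+ (f k) (l k)) ->
  (forall y, a < y -> y <= b -> nm (f N.+1 y) <= B) ->
  forall y, a < y -> y <= b ->
  nm (f 0%N y - \sum_(k < N.+1) l k * ((y - a) ^+ k / k`!%:R)%:C)
    <= 2 ^+ N.+1 * B * (y - a) ^+ N.+1.
Proof.
elim: N f l B => [|N IH] f l B fd fl fB y ay yb.
  rewrite big_ord1 expr0 fact0 divr1 mulr1 expr1 expr1 -mulrA.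
  apply: (@complex_mvi _ (f 1%N)) => //; last exact: fl.
  - by move=> t at_ ty; apply: fd => //; exact: le_trans yb.
  - by move=> t at_ ty; apply: fB => //; exact: (le_trans (ltW ty)).
pose P t := \sum_(k < N.+2) l k * ((t - a) ^+ k / k`!%:R)%:C.
pose Q t := \sum_(k < N.+1) l k.+1 * ((t - a) ^+ k / k`!%:R)%:C.
have PQ t : cder P t (Q t).
  rewrite /P; under eq_fun do rewrite big_ord_recl /= expr0.
  rewrite -[Q t]add0r; apply: cderD; first exact: cder_cst.
  apply: cder_sum => i _; apply: cderZ; apply: cderR.
  have E (s : R) : (s - a) ^+ bump 0 i / (bump 0 i)`!%:R
      = (i.+1)`!%:R^-1 * (s - a) ^+ i.+1 by rewrite mulrC.
  under eq_fun do rewrite E.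
  apply: (isd_eq (isdZ _ (isd_subX i a t))).
  by rewrite factS natrM invfM mulrCA !mulrA divff ?pnatr_eq0// mul1r mulrC.
have Pl : ccvg a^'+ P (l 0%N).
  have -> : l 0%N = P a.
    rewrite /P big_ord_recl /= expr0 fact0 divr1 mulr1 big1 ?addr0// => i _.
    by rewrite /bump /= subrr expr0n /= mul0r mulr0.
  by have [p1 p2] := cder_cont (PQ a); split; exact: cvg_at_right_filter.
have -> : f 0%N y - \sum_(k < N.+2) l k * ((y - a) ^+ k / k`!%:R)%:C = (f 0%N y - P y) - 0.
  by rewrite subr0.
have -> : 2 ^+ N.+2 * B * (y - a) ^+ N.+2 =
    2 * (2 ^+ N.+1 * B * (y - a) ^+ N.+1 * (y - a)) by rewrite !exprS; ring.
apply: (@complex_mvi (fun t => f 0%N t - P t) (fun t => f 1%N t - Q t)) => //.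
- move=> t at_ ty; apply: cderB; last exact: PQ.
  by apply: fd => //; exact: le_trans yb.
- move=> t at_ ty.
  apply: (le_trans (IH (fun k => f k.+1) (fun k => l k.+1) B _ _ _ t at_ _)) => //.
  + by move=> k s kN; exact: fd.
  + by move=> k kN; exact: fl.
  + by rewrite (le_trans (ltW ty)).
  + rewrite ler_wpM2l//.
      by rewrite mulr_ge0// (le_trans (nm_ge0 _) (fB y ay yb)).
    by rewrite lerXn2r// ?nnegrE ?subr_ge0 ?ltW// ltrD2r.
- by rewrite -(subrr (l 0%N)); apply: ccvgB => //; exact: fl.
Qed.
End ComplexDerivative.

(** * The fundamental theorem of calculus on exhausted domains *)

Section ImproperFTC.
Context {R : realType}.
Notation mu := (@lebesgue_measure R).

Definition rint (D : set (measurableTypeR R)) (g : R -> R) : Prop := mu.-integrable D (EFin \o g).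

Lemma dominated_Rintegral (D : set (measurableTypeR R)) (fn : nat -> R -> R) (f g : R -> R) :
  measurable D -> (forall n, measurable_fun D (fn n)) ->
  (forall x : R, D x -> fn n x @[n --> \oo] --> f x) ->
  rint D g -> (forall n (x : R), D x -> `|fn n x| <= g x) ->
  rint D f /\ Rintegral mu D (fn n) @[n --> \oo] --> Rintegral mu D f.
Proof.
move=> mD mfn fnf ig fng.
have mf : measurable_fun D f.
  exact: (measurable_fun_cvg (h := fn)).
have bf x : D x -> `|f x| <= g x.
  move=> Dx; apply: (@cvgr_to_le _ \oo _ _ (fun n => `|fn n x|)).
    by apply: cvg_norm; exact: fnf.
  by apply: nearW => n; exact: fng.
have if_ : rint D f.
  apply: (le_integrable mD) ig; first exact/measurable_EFinP.
  by move=> x Dx /=; rewrite lee_fin (le_trans (bf x Dx)) ?ler_norm.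
split => //; apply: fine_cvg; rewrite fineK; last exact: integrable_fin_num.
apply: (@dominated_cvg _ _ _ mu _ _ (fun n x => (fn n x)%:E) _ (EFin \o g)) => //=.
- by move=> n; exact/measurable_EFinP.
- by move=> x Dx; apply: cvg_EFin; [exact: nearW|exact: fnf].
Qed.

Lemma FTC_segment (F f : R -> R) (a b : R) : a < b ->
  (forall x, a <= x <= b -> is_derive x 1 F (f x)) ->
  (forall x, a <= x <= b -> {for x, continuous f}) ->
  (\int[mu]_(x in `[a, b]) (f x)%:E = (F b)%:E - (F a)%:E)%E.
Proof.
move=> ab dF cf.
have cF x : a <= x <= b -> {for x, continuous F}.
  move=> /dF[h _]; exact: (differentiable_continuous (proj1 (derivable1_diffP _ _) h)).
apply: continuous_FTC2 => //.
- by apply: continuous_in_subspaceT => x; rewrite inE/= in_itv/=; exact: cf.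
- split.
  + by move=> x; rewrite in_itv/= => /andP[ax xb]; have [] := dF x; rewrite ?ltW.
  + by apply: cvg_at_right_filter; apply: cF; rewrite lexx ltW.
  + by apply: cvg_at_left_filter; apply: cF; rewrite lexx ltW.
- move=> x; rewrite in_itv/= => /andP[ax xb].
  by have [_ h] := dF x (introT andP (conj (ltW ax) (ltW xb))); rewrite derive1E.
Qed.

Section exhaust.
Variables (D : set (measurableTypeR R)) (F f : R -> R) (a b : nat -> R) (la lb : R).
Hypothesis ab : forall n, a n < b n.
Hypothesis a_dec : forall n, a n.+1 <= a n.
Hypothesis b_inc : forall n, b n <= b n.+1.
Hypothesis DE : D = \bigcup_n `[a n, b n]%classic.
Hypothesis dF : forall x : R, D x -> is_derive x 1 F (f x).
Hypothesis cf : forall x : R, D x -> {for x, continuous f}.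
Hypothesis Fa : F (a n) @[n --> \oo] --> la.
Hypothesis Fb : F (b n) @[n --> \oo] --> lb.

Let sub n x : a n <= x <= b n -> D x.
Proof. by rewrite DE => h; exists n => //=; rewrite in_itv/= h. Qed.

Let mD : measurable D.
Proof. by rewrite DE; apply: bigcup_measurable => n _; exact: measurable_itv. Qed.

Let mono : {homo (fun n => `[a n, b n]%classic) : n m / (n <= m)%N >-> (n <= m)%O}.
Proof.
have h n m : (n <= m)%N -> a m <= a n /\ b n <= b m.
  elim: m => [|m IH]; first by rewrite leqn0 => /eqP ->.
  rewrite leq_eqVlt => /orP[/eqP -> //|]; rewrite ltnS => /IH[h1 h2].
  by split; [exact: le_trans h1|exact: le_trans (b_inc m)].
move=> n m /h[h1 h2]; apply/subsetPset => x /=; rewrite !in_itv/= => /andP[x1 x2].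
by rewrite (le_trans h1)// (le_trans x2).
Qed.

Let mf : measurable_fun D f.
Proof.
rewrite DE; apply/measurable_fun_bigcup => // n.
apply: subspace_continuous_measurable_fun => //.
apply: continuous_in_subspaceT => x; rewrite inE/= in_itv/= => h.
by apply: cf; exact: sub h.
Qed.

Let lim : (\int[mu]_(x in `[a n, b n]) (f x)%:E)%E @[n --> \oo] --> (lb - la)%:E.
Proof.
have E n : (\int[mu]_(x in `[a n, b n]) (f x)%:E = (F (b n) - F (a n))%:E)%E.
  by apply: FTC_segment => // x /sub; [exact: dF|exact: cf].
by under eq_fun do rewrite E; apply: cvg_EFin; [exact: nearW|exact: cvgB].
Qed.

(** For f >= 0 monotone convergence along the exhausting segments yields integrability together with
    the value. The basic majorants, such as [powkern] and 1 / (1 + t^2), are shown integrable in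
    this way. *)
Lemma FTC_exhaust_ge0 : (forall x : R, D x -> 0 <= f x) ->
  rint D f /\ (\int[mu]_(x in D) (f x)%:E = (lb - la)%:E)%E.
Proof.
move=> f0.
have E : (\int[mu]_(x in D) (f x)%:E = (lb - la)%:E)%E.
  suff H : (\int[mu]_(x in `[a n, b n]) (f x)%:E)%E @[n --> \oo] -->
    (\int[mu]_(x in D) (f x)%:E)%E 
    by rewrite -(cvg_lim (@ereal_hausdorff R) H); exact: cvg_lim lim.
  rewrite DE; apply: (@ge0_nondecreasing_set_cvg_integral _ (measurableTypeR R) R
    (fun n => `[a n, b n]%classic) (EFin \o f)) => //.
  - move=> n; apply/measurable_EFinP; apply: (measurable_funS mD _ mf).
    by move=> x; rewrite /= in_itv/=; exact: sub.
  - by move=> n x; rewrite /= in_itv/= lee_fin => h; apply: f0; exact: sub h.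
split => //; apply/integrableP; split; first exact/measurable_EFinP.
under eq_integral => x /[!inE] Dx.
  by rewrite gee0_abs ?lee_fin ?f0//; over.
by rewrite E ltry.
Qed.

(** Without a sign integrability has to be known beforehand; |f| then dominates the restrictions of
    f to the segments. *)
Lemma FTC_exhaust : rint D f -> Rintegral mu D f = lb - la.
Proof.
move=> intf; pose fn n := f \_ `[a n, b n].
have Efn n : Rintegral mu D (fn n) = fine (\int[mu]_(x in `[a n, b n]) (f x)%:E)%E.
  rewrite -[RHS]/(Rintegral mu `[a n, b n] f) /fn -Rintegral_mkcondr; congr (Rintegral mu _ _).
  by apply/setIidPr => x; rewrite /= in_itv/=; exact: sub.
have [_] : rint D f /\ Rintegral mu D (fn n) @[n --> \oo] --> Rintegral mu D f.
  apply: (@dominated_Rintegral D fn f (fun x => `|f x|)) => //.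
  - move=> n; apply: measurable_funTS; apply/(measurable_restrictT _ _).1 => //.
    apply: (measurable_funS mD _ mf).
    by move=> x; rewrite /= in_itv/=; exact: sub.
  - move=> x Dx; apply: cvg_near_cst.
    move: (Dx); rewrite {1}DE => -[N _ hN]; exists N => // n /= Nn.
    by rewrite /fn patchE mem_set//; move/subsetPset : (mono Nn); exact.
  - exact: integrable_norm.
  - by move=> n x Dx /=; rewrite /fn patchE; case: ifP => // _; rewrite normr0.
have -> : (fun n => Rintegral mu D (fn n)) = fun n => fine (\int[mu]_(x in `[a n, b n]) (f x)%:E)%E.
  exact/funext.
move=> H2.
have H1 : fine (\int[mu]_(x in `[a n, b n]) (f x)%:E)%E @[n --> \oo] --> lb - la.
  exact: fine_cvg lim.
by rewrite -(cvg_lim (@Rhausdorff R) H2) -(cvg_lim (@Rhausdorff R) H1).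
Qed.
End exhaust.
End ImproperFTC.

Section ComplexIntegral.
Context {R : realType}.
Notation mu := (@lebesgue_measure R).
Implicit Types (D : set (measurableTypeR R)) (f g : R -> R[i]).

Definition cmeas D f : Prop :=
  measurable_fun D (fun x => re (f x)) /\ measurable_fun D (fun x => im (f x)).
Definition cint D f : Prop :=
  rint D (fun x => re (f x)) /\ rint D (fun x => im (f x)).

Lemma cmeas_cst D (k : R[i]) : cmeas D (fun=> k).
Proof. by split; exact: measurable_cst. Qed.
Lemma cmeasD D f g : cmeas D f -> cmeas D g -> cmeas D (fun x => f x + g x).
Proof.
move=> [f1 f2] [g1 g2]; split.
  by under eq_fun do rewrite cReD; exact: measurable_funD.
by under eq_fun do rewrite cImD; exact: measurable_funD.
Qed.
Lemma cmeasM D f g : cmeas D f -> cmeas D g -> cmeas D (fun x => f x * g x).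
Proof.
move=> [f1 f2] [g1 g2]; split.
  by under eq_fun do rewrite cReM; apply: measurable_funB; exact: measurable_funM.
by under eq_fun do rewrite cImM; apply: measurable_funD; exact: measurable_funM.
Qed.
Lemma cmeasR D (u : R -> R) : measurable_fun D u -> cmeas D (fun x => (u x)%:C).
Proof. by move=> mu_; split => //=; exact: measurable_cst. Qed.
Lemma cmeas_Cexp D f : measurable D -> cmeas D f -> cmeas D (fun x => Cexp (f x)).
Proof.
move=> mD [f1 f2]; split.
  under eq_fun do rewrite ReCexp; apply: measurable_funM.
    exact: measurableT_comp.
  by apply: measurableT_comp f2; apply: continuous_measurable_fun; exact: continuous_cos.
under eq_fun do rewrite ImCexp; apply: measurable_funM.
  exact: measurableT_comp.
by apply: measurableT_comp f2; apply: continuous_measurable_fun; exact: continuous_sin.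
Qed.
Lemma cmeas_sub D E f : measurable D -> E `<=` D -> cmeas D f -> cmeas E f.
Proof. by move=> mD ED [f1 f2]; split; exact: measurable_funS ED _. Qed.
Lemma cmeas_cont (D : set R) f : open D -> (forall x, D x -> ccvg (nbhs x) f (f x)) ->
  cmeas D f.
Proof.
move=> oD cf; split; apply: open_continuous_measurable_fun => // x /set_mem Dx.
  by have [] := cf x Dx.
by have [] := cf x Dx.
Qed.
Lemma cint_meas D f : cint D f -> cmeas D f.
Proof. by move=> [/measurable_int/measurable_EFinP ? /measurable_int/measurable_EFinP]. Qed.
Lemma cmeas_nm D f : measurable D -> cmeas D f -> measurable_fun D (fun x => nm (f x)).
Proof.
move=> mD [f1 f2]; under eq_fun do rewrite nmE.
have ms : measurable_fun [set: R] (@Num.sqrt R).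
  by apply: continuous_measurable_fun; exact: sqrt_continuous.
by apply: measurableT_comp => //; apply: measurable_funD; exact: measurable_funX.
Qed.

Lemma rint_le D (u v : R -> R) : measurable D -> measurable_fun D u ->
  (forall x : R, D x -> `|u x| <= v x) -> rint D v -> rint D u.
Proof.
move=> mD mu_ uv iv; apply: (le_integrable mD) iv; first exact/measurable_EFinP.
by move=> x Dx /=; rewrite lee_fin (le_trans (uv x Dx)) ?ler_norm.
Qed.
Lemma rintZ D (k : R) (u : R -> R) : measurable D -> rint D u -> rint D (fun x => k * u x).
Proof.
move=> mD iu; rewrite /rint /comp; under eq_fun do rewrite EFinM.
exact: integrableZl.
Qed.
Lemma rintD D (u v : R -> R) : measurable D -> rint D u -> rint D v ->
  rint D (fun x => u x + v x).
Proof.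
move=> mD iu; rewrite /rint /comp => iv; under eq_fun do rewrite EFinD.
exact: integrableD.
Qed.
Lemma rintN D (u : R -> R) : measurable D -> rint D u -> rint D (fun x => - u x).
Proof.
move=> mD iu; have := rintZ (-1) mD iu.
by under eq_fun do rewrite mulN1r.
Qed.
Lemma rintB D (u v : R -> R) : measurable D -> rint D u -> rint D v ->
  rint D (fun x => u x - v x).
Proof. by move=> mD iu iv; apply: rintD => //; exact: rintN. Qed.
Lemma rint_sub D E (u : R -> R) : measurable D -> measurable E -> E `<=` D ->
  rint D u -> rint E u.
Proof. by move=> mD mE ED; exact: integrableS. Qed.

Lemma cint_le D f (v : R -> R) : measurable D -> cmeas D f ->
  (forall x : R, D x -> nm (f x) <= v x) -> rint D v -> cint D f.
Proof.
by move=> mD [f1 f2] fv iv; split; apply: rint_le iv => // x Dx;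
  rewrite (le_trans _ (fv x Dx)) ?cRe_le_nm ?cIm_le_nm.
Qed.
Lemma cint_sub D E f : measurable D -> measurable E -> E `<=` D ->
  cint D f -> cint E f.
Proof. by move=> mD mE ED [f1 f2]; split; apply: rint_sub ED _. Qed.
Lemma cint_nm D f : measurable D -> cint D f -> rint D (fun x => nm (f x)).
Proof.
move=> mD fi; have [f1 f2] := fi.
apply: (@rint_le _ _ (fun x => `|re (f x)| + `|im (f x)|)) => //.
- by apply: cmeas_nm => //; exact: cint_meas.
- by move=> x _; rewrite ger0_norm ?nm_ge0// nm_le_ReIm.
- by apply: rintD => //; exact: integrable_norm.
Qed.
Lemma cintD D f g : measurable D -> cint D f -> cint D g -> cint D (fun x => f x + g x).
Proof.
move=> mD [f1 f2] [g1 g2]; split.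
  by under eq_fun do rewrite cReD; exact: rintD.
by under eq_fun do rewrite cImD; exact: rintD.
Qed.
Lemma cintZ D (k : R[i]) f : measurable D -> cint D f -> cint D (fun x => k * f x).
Proof.
move=> mD [f1 f2]; split.
  by under eq_fun do rewrite cReM; apply: rintB => //; exact: rintZ.
by under eq_fun do rewrite cImM; apply: rintD => //; exact: rintZ.
Qed.
Lemma cint_sum D I (s : seq I) (P : pred I) (F : I -> R -> R[i]) : measurable D ->
  (forall i, P i -> cint D (F i)) -> cint D (fun x => \sum_(i <- s | P i) F i x).
Proof.
move=> mD H; elim: s => [|i s IH].
  have -> : (fun x => \sum_(i <- [::] | P i) F i x) = (fun=> 0).
    by apply/funext => x; rewrite big_nil.
  by split; exact: integrable0.
have -> : (fun x => \sum_(j <- i :: s | P j) F j x) =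
    (fun x => if P i then F i x + \sum_(j <- s | P j) F j x else \sum_(j <- s | P j) F j x).
  by apply/funext => x; rewrite big_cons.
by case Pi : (P i) => //; apply: cintD => //; exact: H.
Qed.
Lemma cint_eq D f g : measurable D -> (forall x : R, D x -> f x = g x) ->
  cint D f -> cint D g.
Proof.
by move=> mD fg [f1 f2]; split; [apply: eq_integrable f1|apply: eq_integrable f2];
  rewrite // => x /set_mem Dx /=; rewrite fg.
Qed.

Lemma eq_Cintegral D f g : (forall x : R, D x -> f x = g x) ->
  Cintegral D f = Cintegral D g.
Proof.
by move=> fg; rewrite /Cintegral; congr (_ +i* _); apply: eq_Rintegral => x /set_mem Dx;
  rewrite fg.
Qed.
Lemma CintegralD D f g : measurable D -> cint D f -> cint D g ->
  Cintegral D (fun x => f x + g x) = Cintegral D f + Cintegral D g.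
Proof.
move=> mD [f1 f2] [g1 g2]; apply: eqC; rewrite ?cReD ?cImD /=.
  by under eq_Rintegral do rewrite cReD; exact: RintegralD.
by under eq_Rintegral do rewrite cImD; exact: RintegralD.
Qed.
Lemma CintegralZ D (k : R[i]) f : measurable D -> cint D f ->
  Cintegral D (fun x => k * f x) = k * Cintegral D f.
Proof.
move=> mD [f1 f2]; apply: eqC; rewrite ?cReM ?cImM /=.
  under eq_Rintegral do rewrite cReM.
  by rewrite RintegralB//; [rewrite !RintegralZl|exact: rintZ|exact: rintZ].
under eq_Rintegral do rewrite cImM.
by rewrite RintegralD//; [rewrite !RintegralZl|exact: rintZ|exact: rintZ].
Qed.
Lemma CintegralB D f g : measurable D -> cint D f -> cint D g ->
  Cintegral D (fun x => f x - g x) = Cintegral D f - Cintegral D g.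
Proof.
move=> mD fi gi; rewrite -mulN1r -CintegralZ// -CintegralD//; last exact: cintZ.
by under eq_Cintegral do rewrite -mulN1r.
Qed.
Lemma Cintegral0 D : Cintegral D (fun=> 0) = 0 :> R[i].
Proof. by apply: eqC => /=; rewrite /Rintegral integral0_eq. Qed.
Lemma Cintegral_sum D I (s : seq I) (P : pred I) (F : I -> R -> R[i]) : measurable D ->
  (forall i, P i -> cint D (F i)) ->
  Cintegral D (fun x => \sum_(i <- s | P i) F i x) = \sum_(i <- s | P i) Cintegral D (F i).
Proof.
move=> mD H; elim: s => [|i s IH].
  rewrite big_nil -[RHS](Cintegral0 D); congr Cintegral.
  by apply/funext => x; rewrite big_nil.
rewrite big_cons.
have -> : (fun x => \sum_(j <- i :: s | P j) F j x) =
    (fun x => if P i then F i x + \sum_(j <- s | P j) F j x else \sum_(j <- s | P j) F j x).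
  by apply/funext => x; rewrite big_cons.
case Pi : (P i) => //; rewrite CintegralD ?IH//; first exact: H.
exact: cint_sum.
Qed.
Lemma nm_Cintegral D f (v : R -> R) : measurable D -> cmeas D f ->
  (forall x : R, D x -> nm (f x) <= v x) -> rint D v ->
  nm (Cintegral D f) <= 2 * Rintegral mu D v.
Proof.
move=> mD mf fv iv; have [f1 f2] := cint_le mD mf fv iv.
apply: nm_le_le; rewrite /Cintegral /=.
  rewrite (le_trans (le_normr_Rintegral mD f1))// le_Rintegral//.
    exact: integrable_norm.
  by move=> x Dx; rewrite (le_trans _ (fv x Dx)) ?cRe_le_nm.
rewrite (le_trans (le_normr_Rintegral mD f2))// le_Rintegral//.
  exact: integrable_norm.
by move=> x Dx; rewrite (le_trans _ (fv x Dx)) ?cIm_le_nm.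
Qed.

Lemma dominated_Cintegral_cint D (fn : nat -> R -> R[i]) f (v : R -> R) :
  measurable D -> (forall n, cmeas D (fn n)) ->
  (forall x : R, D x -> ccvg \oo (fun n => fn n x) (f x)) ->
  rint D v -> (forall n (x : R), D x -> nm (fn n x) <= v x) ->
  cint D f /\ ccvg \oo (fun n => Cintegral D (fn n)) (Cintegral D f).
Proof.
move=> mD mfn fnf iv fnv.
have [|||h1 h2] := @dominated_Rintegral _ D (fun n x => re (fn n x)) (fun x => re (f x)) v mD _ _ iv _.
- by move=> n; have [] := mfn n.
- by move=> x Dx; have [] := fnf x Dx.
- by move=> n x Dx; rewrite (le_trans (cRe_le_nm _))// fnv.
have [|||h3 h4] := @dominated_Rintegral _ D (fun n x => im (fn n x)) (fun x => im (f x)) v mD _ _ iv _.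
- by move=> n; have [] := mfn n.
- by move=> x Dx; have [] := fnf x Dx.
- by move=> n x Dx; rewrite (le_trans (cIm_le_nm _))// fnv.
by [].
Qed.

Lemma dominated_Cintegral D (fn : nat -> R -> R[i]) f (v : R -> R) :
  measurable D -> (forall n, cmeas D (fn n)) ->
  (forall x : R, D x -> ccvg \oo (fun n => fn n x) (f x)) ->
  rint D v -> (forall n (x : R), D x -> nm (fn n x) <= v x) ->
  ccvg \oo (fun n => Cintegral D (fn n)) (Cintegral D f).
Proof. by move=> mD mfn fnf iv fnv; have [] := dominated_Cintegral_cint mD mfn fnf iv fnv. Qed.

(** Dominated convergence speaks of sequences, so continuity at [t] is tested along sequences
    tending to [t]. *)
Lemma continuous_Cintegral D (F : R -> R -> R[i]) (v : R -> R) :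
  measurable D -> (forall t, cmeas D (F t)) ->
  (forall t x : R, D x -> ccvg (nbhs t) (F ^~ x) (F t x)) ->
  rint D v -> (forall t x : R, D x -> nm (F t x) <= v x) ->
  forall t, ccvg (nbhs t) (fun t => Cintegral D (F t)) (Cintegral D (F t)).
Proof.
move=> mD mF cF iv Fv t.
have H (w : nat -> R) : w @ \oo --> t ->
  ccvg \oo (fun n => Cintegral D (F (w n))) (Cintegral D (F t)).
  move=> wt; apply: dominated_Cintegral iv _ => // [x Dx|n x Dx].
    exact: (ccvg_comp wt (cF t x Dx)).
  exact: Fv.
split; apply/(@cvg_nbhsP _ R^o) => w wt; by have [] := H w wt.
Qed.

Lemma cder_Cintegral D (F dF : R -> R -> R[i]) (G : R -> R) (u v t : R) :
  measurable D -> u < t < v ->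
  (forall s, u < s < v -> cint D (F s)) ->
  (forall s x : R, u < s < v -> D x -> cder (F ^~ x) s (dF s x)) ->
  rint D G -> (forall s x : R, u < s < v -> D x -> nm (dF s x) <= G x) ->
  cder (fun s => Cintegral D (F s)) t (Cintegral D (dF t)).
Proof.
move=> mD tuv iF dF_ iG dG.
have iG' : rint D (fun x => `|G x|) by exact: integrable_norm.
have It : `]u, v[%classic t by rewrite /= in_itv/=.
have I s : `]u, v[%classic s -> u < s < v by rewrite /= in_itv/=.
split => /=.
  have h1 s : `]u, v[%classic s -> rint D (fun x => re (F s x)) by move=> /I/iF[].
  have h2 s (x : R) : `]u, v[%classic s -> D x -> derivable (fun t => re (F t x)) s 1.
    by move=> /I sI Dx; have [[]] := dF_ s x sI Dx.
  have h4 s (x : R) : `]u, v[%classic s -> D x ->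
      `|partial1of2 (fun s x => re (F s x)) s x| <= `|G x|.
    move=> /I sI Dx; rewrite partial1of2E; have [[_ ->] _] := dF_ s x sI Dx.
    by rewrite (le_trans (cRe_le_nm _))// (le_trans (dG _ _ sI Dx))// ler_norm.
  split; first exact: (derivable_under_integral mD It h1 h2 _ iG' h4).
  rewrite -derive1E (differentiation_under_integral mD It h1 h2 _ iG' h4)//.
  apply: eq_Rintegral => x /set_mem Dx; rewrite partial1of2E.
  by have [[_ ->] _] := dF_ t x tuv Dx.
have h1 s : `]u, v[%classic s -> rint D (fun x => im (F s x)) by move=> /I/iF[].
have h2 s (x : R) : `]u, v[%classic s -> D x -> derivable (fun t => im (F t x)) s 1.
  by move=> /I sI Dx; have [_ []] := dF_ s x sI Dx.
have h4 s (x : R) : `]u, v[%classic s -> D x ->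
    `|partial1of2 (fun s x => im (F s x)) s x| <= `|G x|.
  move=> /I sI Dx; rewrite partial1of2E; have [_ [_ ->]] := dF_ s x sI Dx.
  by rewrite (le_trans (cIm_le_nm _))// (le_trans (dG _ _ sI Dx))// ler_norm.
split; first exact: (derivable_under_integral mD It h1 h2 _ iG' h4).
rewrite -derive1E (differentiation_under_integral mD It h1 h2 _ iG' h4)//.
apply: eq_Rintegral => x /set_mem Dx; rewrite partial1of2E.
by have [_ [_ ->]] := dF_ t x tuv Dx.
Qed.

Lemma Cintegral_setU D E f : measurable D -> measurable E ->
  cint (D `|` E) f -> [disjoint D & E] ->
  Cintegral (D `|` E) f = Cintegral D f + Cintegral E f.
Proof.
move=> mD mE [f1 f2] DE; apply: eqC; rewrite ?cReD ?cImD /=; exact: Rintegral_setU.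
Qed.

End ComplexIntegral.

Section HalfLine.
Context {R : realType}.
Notation mu := (@lebesgue_measure R).
Implicit Types (A : R) (f F : R -> R[i]).

Lemma cvg_invS : (n.+1%:R^-1 : R) @[n --> \oo] --> 0.
Proof. exact: (@cvg_harmonic R). Qed.

Lemma cvg_at_right_seq A (u : nat -> R) : (forall n, A < u n) ->
  u n @[n --> \oo] --> A -> u n @[n --> \oo] --> A^'+.
Proof.
move=> Au uA P /= [e /= e0 eP].
have : \forall n \near \oo, ball A e (u n) by apply: uA; exact: nbhsx_ballx.
by apply: filterS => n ?; apply: eP.
Qed.

(** The left ends start at A + 1/2 and not at A + 1, so that the segment with n = 0 is
    nondegenerate, as the exhaustion lemmas ask. *)
Lemma itv_oy_bigcup A :
  `]A, +oo[%classic = \bigcup_n `[A + n.+2%:R^-1, A + n.+1%:R]%classic.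
Proof.
apply/seteqP; split => x /=; rewrite in_itv/= ?andbT.
  move=> Ax; have d0 : 0 < x - A by rewrite subr_gt0.
  have := archi_boundP (ltW d0); set N := Num.Def.archi_bound _ => hN.
  have d1 : 0 <= (x - A)^-1 by rewrite invr_ge0 ltW.
  have := archi_boundP d1.
  set M := Num.Def.archi_bound _ => hM.
  exists (N + M)%N => //=; rewrite in_itv/=; apply/andP; split.
    rewrite -lerBrDl -(invrK (x - A)) lef_pV2 ?posrE ?invr_gt0//.
    by rewrite (le_trans (ltW hM))// ler_nat; lia.
  by rewrite -lerBlDl (le_trans (ltW hN))// ler_nat; lia.
move=> [n _] /=; rewrite in_itv/= => /andP[+ _]; apply: lt_le_trans.
by rewrite ltrDl invr_gt0.
Qed.

Section real.
Variables (A la lb : R) (F f : R -> R).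
Hypothesis dF : forall x, A < x -> is_derive x 1 F (f x).
Hypothesis cf : forall x, A < x -> {for x, continuous f}.
Hypothesis Fa : F x @[x --> A^'+] --> la.
Hypothesis Fb : F x @[x --> +oo] --> lb.

Let ex := @FTC_exhaust R `]A, +oo[%classic F f (fun n => A + n.+2%:R^-1) (fun n => A + n.+1%:R) la lb.
Let ex0 := @FTC_exhaust_ge0 R `]A, +oo[%classic F f (fun n => A + n.+2%:R^-1) (fun n => A + n.+1%:R) la lb.

Let H1 n : A + n.+2%:R^-1 < A + n.+1%:R :> R.
Proof.
rewrite ltrD2l (@lt_le_trans _ _ 1)//; first by rewrite invf_lt1 ?ltr1n.
by rewrite ler1n.
Qed.
Let H2 n : A + n.+3%:R^-1 <= A + n.+2%:R^-1 :> R.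
Proof. by rewrite lerD2l lef_pV2 ?posrE ?ler_nat. Qed.
Let H3 n : A + n.+1%:R <= A + n.+2%:R :> R.
Proof. by rewrite lerD2l ler_nat. Qed.
Let H4 x : `]A, +oo[%classic x -> A < x.
Proof. by rewrite /= in_itv/= andbT. Qed.
Let H5 : F (A + n.+2%:R^-1) @[n --> \oo] --> la.
Proof.
apply: (cvg_comp _ _ _ Fa); apply: cvg_at_right_seq.
  by move=> n; rewrite ltrDl invr_gt0.
rewrite -[X in _ --> X]addr0; apply: cvgD; first exact: cvg_cst.
have := @cvg_invS; rewrite -(cvg_shiftS (fun n => n.+1%:R^-1 : R)); exact.
Qed.
Let H6 : F (A + n.+1%:R) @[n --> \oo] --> lb.
Proof.
have h : (n.+1%:R : R) @[n --> \oo] --> +oo.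
  by rewrite (cvg_shiftS (fun n => n%:R : R)); exact: cvgr_idn.
exact: (cvg_comp _ _ (cvg_comp _ _ h (cvg_addrl A)) Fb).
Qed.

Lemma FTC_oy_ge0 : (forall x, A < x -> 0 <= f x) ->
  rint `]A, +oo[ f /\ Rintegral mu `]A, +oo[ f = lb - la.
Proof.
move=> f0.
have [i1 i2] := ex0 H1 H2 H3 (itv_oy_bigcup A) (fun x h => dF (H4 h)) (fun x h => cf (H4 h))
  H5 H6 (fun x h => f0 x (H4 h)).
by split => //; rewrite /Rintegral i2.
Qed.
Lemma FTC_oy : rint `]A, +oo[ f -> Rintegral mu `]A, +oo[ f = lb - la.
Proof.
exact: ex H1 H2 H3 (itv_oy_bigcup A) (fun x h => dF (H4 h)) (fun x h => cf (H4 h)) H5 H6.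
Qed.
End real.

Lemma CFTC_oy A F f la lb :
  (forall x, A < x -> cder F x (f x)) ->
  (forall x, A < x -> ccvg (nbhs x) f (f x)) ->
  ccvg A^'+ F la -> ccvg +oo F lb -> cint `]A, +oo[ f ->
  Cintegral `]A, +oo[ f = lb - la.
Proof.
move=> dF cf [a1 a2] [b1 b2] [i1 i2]; apply: eqC; rewrite ?cReB ?cImB /=.
  apply: (@FTC_oy _ _ _ (fun x => re (F x)) (fun x => re (f x))) => // x Ax.
    by have [] := dF x Ax.
  by have [] := cf x Ax.
apply: (@FTC_oy _ _ _ (fun x => im (F x)) (fun x => im (f x))) => // x Ax.
  by have [] := dF x Ax.
by have [] := cf x Ax.
Qed.
End HalfLine.

(** * Integrals of powers and change of variables *)

Section Powers.
Context {R : realType}.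
Implicit Types (g c v : R).
Notation mu := (@lebesgue_measure R).

Lemma mitv (i : interval R) : @measurable _ (measurableTypeR R) [set` i].
Proof. exact: measurable_itv. Qed.

Lemma cont_derive (u : R -> R) (x a : R) : is_derive x 1 u a -> {for x, continuous u}.
Proof. by move=> [h _]; exact: (differentiable_continuous (proj1 (derivable1_diffP _ _) h)). Qed.

Lemma powR_cvgy (g : R) : 0 < g -> x `^ g @[x --> +oo] --> +oo.
Proof.
move=> g0; apply/cvgryPge => M; near=> x.
have M0 : 0 <= Num.max M 0 by rewrite le_max lexx orbT.
apply: (@le_trans _ _ (Num.max M 0)); first by rewrite le_max lexx.
have gn : g != 0 by rewrite gt_eqF.
rewrite -[leLHS]powRr1// -(mulVf gn) powRrM.
by apply: ge0_ler_powR; rewrite ?nnegrE ?powR_ge0 ?ltW.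
Unshelve. all: end_near. Qed.

(* The derivative in v of - (1 + c * v^g)^-1. *)
Definition powkern (g c v : R) : R := g * (c * v `^ (g - 1)) / (1 + c * v `^ g) ^+ 2.

Lemma powkern_ge0 g c v : 0 < g -> 0 < c -> 0 <= powkern g c v.
Proof.
move=> g0 c0; rewrite /powkern divr_ge0 ?sqr_ge0//.
by rewrite mulr_ge0 ?mulr_ge0 ?powR_ge0// ltW.
Qed.

(** The primitive runs from -1 to 0 whatever g and c are. Integrability of powers at 0 and at
    infinity, with explicit constants, is derived from this one kernel of mass 1. *)
Lemma powkern_int g c : 0 < g -> 0 < c ->
  rint `]0, +oo[ (powkern g c) /\ Rintegral mu `]0, +oo[ (powkern g c) = 1.
Proof.
move=> g0 c0.
have P (v : R) : 0 < 1 + c * v `^ g by rewrite ltr_wpDr ?mulr_ge0 ?powR_ge0 ?ltW.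
have dP (v : R) : 0 < v -> is_derive v 1 (fun v => 1 + c * v `^ g) (c * (g * v `^ (g - 1))).
  move=> v0; apply: isd_eq (isdD (isdC 1 v) (isdZ c (isd_powR g v0))) _.
  by rewrite add0r.
have [|||||i1 i2] := @FTC_oy_ge0 R 0 (-1) 0 (fun v => - (1 + c * v `^ g)^-1) (powkern g c).
- move=> v v0; apply: isd_eq (isdN (isdV (u := fun v => 1 + c * v `^ g) (lt0r_neq0 (P v)) (dP v v0))) _.
  by rewrite /powkern; field; rewrite gt_eqF.
- move=> v v0; rewrite /powkern.
  have c1 : {for v, continuous (fun v => 1 + c * v `^ g)} by exact: cont_derive (dP v v0).
  have c2 : {for v, continuous (fun v : R => v `^ (g - 1))}.
    by apply: cont_derive; exact: isd_powR.
  apply: cvgM.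
    by apply: cvgM; [exact: cvg_cst|apply: cvgM c2; exact: cvg_cst].
  apply: cvgV; first by rewrite expf_neq0// gt_eqF.
  by rewrite expr2; under eq_fun do rewrite expr2; exact: cvgM.
- rewrite -{2}invr1; apply: cvgN; apply: cvgV => //.
  rewrite -[X in _ --> X]addr0; apply: cvgD; first exact: cvg_cst.
  rewrite -[X in _ --> X](mulr0 c); apply: cvgM; first exact: cvg_cst.
  exact: powR_cvg0.
- rewrite -[X in _ --> X]oppr0; apply: cvgN; apply/gtr0_cvgV0.
    by apply: nearW => v; exact: P.
  apply/cvgryPge => M; have /cvgryPge/(_ (M / c)) := powR_cvgy g0.
  apply: filterS => v; rewrite ler_pdivrMr// mulrC => /le_trans; apply.
  by rewrite lerDr.
- by move=> v v0; exact: powkern_ge0.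
by rewrite i2 opprK add0r.
Qed.

(** Where c v^g <= 1 the squared denominator of the kernel is at most 4. *)
Lemma powkern_small g c v : 0 < g -> 0 < c -> 0 < v -> c * v `^ g <= 1 ->
  v `^ (g - 1) <= 4 / (c * g) * powkern g c v.
Proof.
move=> g0 c0 v0 h.
have P : 0 <= c * v `^ g by rewrite mulr_ge0 ?powR_ge0 ?ltW.
have -> : 4 / (c * g) * powkern g c v = v `^ (g - 1) * (4 / (1 + c * v `^ g) ^+ 2).
  by rewrite /powkern; field; rewrite !gt_eqF// ltr_wpDr.
rewrite ler_peMr ?powR_ge0// ler_pdivlMr ?exprn_gt0 ?ltr_wpDr// mul1r.
nra.
Qed.

(** Where c v^g >= 1 one has 1 + c v^g <= 2 c v^g, which again costs a factor 4. *)
Lemma powkern_large g c v : 0 < g -> 0 < c -> 0 < v -> 1 <= c * v `^ g ->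
  v `^ (- g - 1) <= 4 * c / g * powkern g c v.
Proof.
move=> g0 c0 v0 h.
have -> : 4 * c / g * powkern g c v =
    v `^ (g - 1) * (4 * c ^+ 2 / (1 + c * v `^ g) ^+ 2).
  by rewrite /powkern; field; rewrite !gt_eqF// ltr_wpDr// (le_trans ler01).
have -> : v `^ (- g - 1) = v `^ (g - 1) * (v `^ g ^- 2).
  rewrite -powR_mulrn ?powR_ge0// -powRN -powRrM -powRD; last by rewrite (gt_eqF v0)/= implybT.
  by congr (_ `^ _); ring.
rewrite ler_wpM2l ?powR_ge0// ler_pdivlMr; last by rewrite exprn_gt0// ltr_wpDr// (le_trans ler01).
rewrite mulrC ler_pdivrMr ?exprn_gt0 ?powR_gt0// -mulrA -exprMn.
nra.
Qed.

Lemma Rintegral_subset (D E : set (measurableTypeR R)) (u : R -> R) :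
  measurable D -> measurable E -> E `<=` D -> rint D u -> (forall x : R, D x -> 0 <= u x) ->
  Rintegral mu E u <= Rintegral mu D u.
Proof.
move=> mD mE ED iu u0; apply: fine_le.
- by apply: integrable_fin_num => //; exact: rint_sub ED iu.
- exact: integrable_fin_num.
- apply: ge0_subset_integral => //; exact: measurable_int iu.
Qed.

Lemma mpowR (p : R) (D : set (measurableTypeR R)) : measurable_fun D (fun v : R => v `^ p).
Proof. by apply: measurable_funTS; exact: measurable_powR. Qed.

Lemma rint_pow_small (b A : R) : -1 < b -> 0 < A ->
  rint `]0, A] (fun v => v `^ b) /\
  Rintegral mu `]0, A] (fun v => v `^ b) <= 4 / (b + 1) * A `^ (b + 1).
Proof.
move=> b1 A0; have g0 : 0 < b + 1 by lra.
(* With this [c] the region c v^(b+1) <= 1 is exactly ]0, A], and the mass 1 of the kernel turns the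
   constant of [powkern_small] into the bound. *)
set c := A `^ (- (b + 1)); have c0 : 0 < c by rewrite powR_gt0.
have [i1 i2] := powkern_int g0 c0.
have S : `]0, A] `<=` `]0, +oo[.
  by move=> v /=; rewrite !in_itv/= => /andP[-> _].
have i3 : rint `]0, A] (fun v => 4 / (c * (b + 1)) * powkern (b + 1) c v).
  by apply: rint_sub S _; rewrite ?mitv//; apply: rintZ => //; exact: mitv.
have B v : `]0, A]%classic v -> v `^ b <= 4 / (c * (b + 1)) * powkern (b + 1) c v.
  rewrite /= in_itv/= => /andP[v0 vA]; rewrite -{1}(addrK 1 b); apply: powkern_small => //.
  rewrite /c powRN mulrC ler_pdivrMr ?powR_gt0// mul1r.
  by rewrite ge0_ler_powR// ?nnegrE ltW.
have i4 : rint `]0, A] (fun v => v `^ b).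
  apply: rint_le i3; [exact: mitv|exact: mpowR|].
  by move=> v vA; rewrite ger0_norm ?powR_ge0// B.
split => //.
apply: le_trans (le_Rintegral (mitv _) i4 i3 B) _.
rewrite RintegralZl; [|exact: mitv|by apply: rint_sub S i1; exact: mitv].
have h : Rintegral mu `]0, A] (powkern (b + 1) c) <= 1.
  rewrite -[leRHS]i2; apply: (Rintegral_subset (mitv _) (mitv _) S i1).
  by move=> v _; exact: powkern_ge0.
have k0 : 0 <= 4 / (c * (b + 1)) by rewrite divr_ge0// mulr_ge0 ?ltW.
apply: le_trans (ler_wpM2l k0 h) _.
by rewrite mulr1 invfM /c powRN invrK mulrCA mulrC.
Qed.

Lemma rint_pow_large (b A : R) : b < -1 -> 0 < A ->
  rint `]A, +oo[ (fun v => v `^ b) /\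
  Rintegral mu `]A, +oo[ (fun v => v `^ b) <= 4 / (- b - 1) * A `^ (b + 1).
Proof.
move=> b1 A0; have g0 : 0 < - b - 1 by lra.
set c := A `^ (b + 1); have c0 : 0 < c by rewrite powR_gt0.
have [i1 i2] := powkern_int g0 c0.
have S : `]A, +oo[ `<=` `]0, +oo[.
  by move=> v /=; rewrite !in_itv/= !andbT; exact: lt_trans.
have i3 : rint `]A, +oo[ (fun v => 4 * c / (- b - 1) * powkern (- b - 1) c v).
  by apply: rint_sub S _; rewrite ?mitv//; apply: rintZ => //; exact: mitv.
have B v : `]A, +oo[%classic v -> v `^ b <= 4 * c / (- b - 1) * powkern (- b - 1) c v.
  rewrite /= in_itv/= andbT => vA; have v0 := lt_trans A0 vA.
  have {1}-> : b = - (- b - 1) - 1 by ring.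
  apply: powkern_large => //.
  have -> : - b - 1 = - (b + 1) by ring.
  have -> : c = (A `^ (- (b + 1)))^-1 by rewrite powRN invrK.
  rewrite mulrC ler_pdivlMr ?powR_gt0// mul1r.
  by rewrite ge0_ler_powR// ?nnegrE ?ltW//; lra.
have i4 : rint `]A, +oo[ (fun v => v `^ b).
  apply: rint_le i3; [exact: mitv|exact: mpowR|].
  by move=> v vA; rewrite ger0_norm ?powR_ge0// B.
split => //.
apply: le_trans (le_Rintegral (mitv _) i4 i3 B) _.
rewrite RintegralZl; [|exact: mitv|by apply: rint_sub S i1; exact: mitv].
have h : Rintegral mu `]A, +oo[ (powkern (- b - 1) c) <= 1.
  rewrite -[leRHS]i2; apply: (Rintegral_subset (mitv _) (mitv _) S i1).
  by move=> v _; exact: powkern_ge0.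
have k0 : 0 <= 4 * c / (- b - 1) by rewrite divr_ge0 ?mulr_ge0// ltW.
apply: le_trans (ler_wpM2l k0 h) _.
by rewrite mulr1 mulrAC.
Qed.

(** The bound by v^p serves for v <= 1 and the bound by v^q for v > 1. With g = min (p + 1, - q - 1)
    one kernel dominates on both sides, so the half-line is not cut. *)
Lemma rint_pow2 (u : R -> R) (B p q : R) : measurable_fun (`]0, +oo[%classic : set (measurableTypeR R)) u ->
  -1 < p -> q < -1 -> (forall v, 0 < v -> `|u v| <= B * v `^ p) ->
  (forall v, 0 < v -> `|u v| <= B * v `^ q) -> rint `]0, +oo[ u.
Proof.
move=> mu_ p1 q1 up uq.
pose g := Num.min (p + 1) (- q - 1).
have g0 : 0 < g by rewrite lt_min; apply/andP; split; lra.
have gp : g <= p + 1 by rewrite ge_min lexx.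
have gq : g <= - q - 1 by rewrite ge_min lexx orbT.
have [i1 _] := powkern_int g0 ltr01.
have B0 : 0 <= B.
  have := le_trans (normr_ge0 _) (up 1 ltr01).
  by rewrite powR1 mulr1.
apply: (@rint_le _ _ _ (fun v => B * (4 / g) * powkern g 1 v)) => //.
  move=> v; rewrite /= in_itv/= andbT => v0; rewrite -mulrA.
  have [v1|v1] := leP v 1.
    apply: le_trans (up v v0) _; rewrite ler_wpM2l//.
    have : v `^ g <= 1.
      by rewrite -(powRr0 v) ger_powR ?v0// ltW.
    move=> h; have := @powkern_small g 1 v g0 ltr01 v0; rewrite !mul1r => /(_ h).
    by apply: le_trans; rewrite ger_powR ?v0//; lra.
  apply: le_trans (uq v v0) _; rewrite ler_wpM2l//.
  have : 1 <= v `^ g by rewrite -(powRr0 v) ler_powR ?ltW.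
  move=> h; have := @powkern_large g 1 v g0 ltr01 v0; rewrite !mul1r mulr1 => /(_ h).
  by apply: le_trans; rewrite ler_powR ?(ltW v1)//; lra.
by apply: rintZ => //; exact: mitv.
Qed.

Lemma cint_pow2 (f : R -> R[i]) (B p q : R) : cmeas `]0, +oo[ f ->
  -1 < p -> q < -1 -> (forall v, 0 < v -> nm (f v) <= B * v `^ p) ->
  (forall v, 0 < v -> nm (f v) <= B * v `^ q) -> cint `]0, +oo[ f.
Proof.
move=> mf p1 q1 fp fq; apply: (@cint_le _ _ f (fun v => nm (f v))) => //.
apply: (@rint_pow2 _ B p q) => //; first by apply: cmeas_nm.
  by move=> v v0; rewrite ger0_norm ?nm_ge0// fp.
by move=> v v0; rewrite ger0_norm ?nm_ge0// fq.
Qed.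

(** For v > 1 a single term (e v)^(n+1) / (n+1)! of the exponential series with n > - q suffices;
    for v <= 1 the power is at least 1. *)
Lemma expR_le_powR (e q : R) : 0 < e -> q <= 0 ->
  exists2 B, 0 <= B & forall v, 0 < v -> expR (- (e * v)) <= B * v `^ q.
Proof.
move=> e0 q0; have nq0 : 0 <= - q by lra.
have := archi_boundP nq0; set n := Num.Def.archi_bound _ => hn.
set K := (n.+1)`!%:R / e ^+ n.+1.
have K0 : 0 <= K by rewrite divr_ge0 ?exprn_ge0 ?ltW.
exists (1 + K); first by rewrite addr_ge0.
move=> v v0; have ev0 : 0 < e * v by rewrite mulr_gt0.
have [v1|v1] := leP v 1.
  apply: (@le_trans _ _ 1).
    by rewrite -expR0 ler_expR lerNl oppr0 ltW.
  have : 1 <= v `^ q by rewrite -(powRr0 v) ger_powR ?v0.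
  by move=> h; nra.
have h : expR (- (e * v)) <= K * v `^ q.
  have E := @expR_ge1Dxn R (e * v) n (ltW ev0).
  have E' : (e * v) ^+ n.+1 / (n.+1)`!%:R <= expR (e * v) by lra.
  have E'' : 0 < (e * v) ^+ n.+1 / (n.+1)`!%:R by rewrite divr_gt0 ?exprn_gt0 ?ltr0n ?fact_gt0.
  rewrite expRN; apply: (@le_trans _ _ (((e * v) ^+ n.+1 / (n.+1)`!%:R)^-1)).
    by rewrite lef_pV2 ?posrE ?expR_gt0.
  rewrite invf_div exprMn invfM mulrA ler_wpM2l//.
  rewrite -powR_mulrn ?(ltW v0)// -powRN ler_powR ?(ltW v1)//.
  by rewrite lerNl (le_trans (ltW hn))// ler_nat.
by rewrite mulrDl mul1r (le_trans h)// lerDr powR_ge0.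
Qed.
End Powers.

Section MeasurePreserving.
Context {R : realType}.
Notation mu := (@lebesgue_measure R).
Implicit Types (D : set (measurableTypeR R)).

Lemma lebesgue_measure_shift (c : R) (A : set (measurableTypeR R)) : measurable A ->
  pushforward mu ((fun x => c + x) : measurableTypeR R -> measurableTypeR R) A = mu A.
Proof.
have mh : measurable_fun setT ((fun x => c + x) : measurableTypeR R -> measurableTypeR R).
  exact: measurable_funD.
pose H := isMeasurableFun.Build _ _ _ _ _ mh.
pose h : {mfun (measurableTypeR R) >-> (measurableTypeR R)} :=
  MeasurableFun.Pack (MeasurableFun.Class H).
move=> mA; apply/esym; apply: (@lebesgue_measure_unique R (pushforward mu h)) => //=.
move=> _ [[a b]] _ <-; rewrite /pushforward.
have -> : h @^-1` `]a, b] = `]a - c, b - c]%classic.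
  by apply/seteqP; split => x /=; rewrite !in_itv/= ltrBlDl lerBrDl.
rewrite !lebesgue_measure_itv/= !lte_fin ltrD2r.
by case: ifP => // _; rewrite -EFinB; congr EFin; ring.
Qed.

Section preserve.
Variable h : measurableTypeR R -> measurableTypeR R.
Hypothesis mh : measurable_fun setT h.
Hypothesis hp : forall A : set (measurableTypeR R), measurable A -> pushforward mu h A = mu A.

Let H := isMeasurableFun.Build _ _ _ _ _ mh.
Let h' : {mfun (measurableTypeR R) >-> (measurableTypeR R)} :=
  MeasurableFun.Pack (MeasurableFun.Class H).

Lemma ge0_integral_pres D (f : R -> \bar R) : measurable D -> measurable_fun D f ->
  (forall x, 0 <= f x)%E ->
  (\int[mu]_(x in D) f x = \int[mu]_(x in h @^-1` D) f (h x))%E.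
Proof.
move=> mD mf f0.
have := @ge0_integral_pushforward _ _ _ _ R h' mh mu D f mD mf (fun x _ => f0 x).
move=> <-; apply: eq_measure_integral => A mA _; exact/esym/hp.
Qed.

Lemma Rintegral_pres D (u : R -> R) : measurable D -> measurable_fun D u ->
  Rintegral mu D u = Rintegral mu (h @^-1` D) (u \o h).
Proof.
move=> mD mu_; have mu' : measurable_fun D (EFin \o u) by exact/measurable_EFinP.
rewrite /Rintegral [in LHS]integralE [in RHS]integralE; congr (fine (_ - _)%E).
  rewrite ge0_integral_pres//; last exact: measurable_funepos.
  by apply: eq_integral => x _; rewrite !funeposE.
rewrite ge0_integral_pres//; last exact: measurable_funeneg.
by apply: eq_integral => x _; rewrite !funenegE.
Qed.

Lemma Cintegral_pres D (f : R -> R[i]) : measurable D -> cmeas D f ->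
  Cintegral D f = Cintegral (h @^-1` D) (f \o h).
Proof. by move=> mD [f1 f2]; apply: eqC => /=; rewrite Rintegral_pres. Qed.
Lemma rint_pres (D : set (measurableTypeR R)) (u : R -> R) : measurable D -> rint D u ->
  rint (h @^-1` D) (u \o h).
Proof.
move=> mD iu; have mD' : measurable (h @^-1` D) by rewrite -[_ @^-1` _]setTI; exact: mh.
have /integrableP[mu_ iu2] := iu.
apply/integrableP; split.
  apply: (measurable_comp mD _ mu_); first by move=> _ [x Dx <-].
  exact: measurable_funTS.
apply: le_lt_trans iu2; rewrite (ge0_integral_pres mD)//.
exact: measurableT_comp.
Qed.

Lemma cint_pres (D : set (measurableTypeR R)) (f : R -> R[i]) : measurable D -> cint D f ->
  cint (h @^-1` D) (f \o h).
Proof. by move=> mD [f1 f2]; split; [exact: rint_pres f1|exact: rint_pres f2]. Qed.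
End preserve.

Lemma Cintegral_opp (f : R -> R[i]) (A : R) : cmeas `]-oo, - A[ f ->
  Cintegral `]-oo, - A[ f = Cintegral `]A, +oo[ (fun v => f (- v)).
Proof.
move=> mf; rewrite (@Cintegral_pres -%R)//.
- congr (Cintegral _ _); apply/seteqP; split => x /=; rewrite !in_itv/= !andbT; lra.
- exact: lebesgue_measureN.
Qed.
End MeasurePreserving.

(** * Integrals over the real line and the Poisson kernel *)

Section LineIntegrals.
Context {R : realType}.
Notation mu := (@lebesgue_measure R).

Lemma rint_atan : rint setT (fun t : R => (1 + t ^+ 2)^-1).
Proof.
have C (n : nat) : (n.+1%:R : R) @[n --> \oo] --> +oo.
  by rewrite (cvg_shiftS (fun n => n%:R : R)); exact: cvgr_idn.
have P (t : R) : 0 < 1 + t ^+ 2 by rewrite ltr_wpDr ?sqr_ge0.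
have L : atan (n.+1%:R : R) @[n --> \oo] --> pi / 2.
  exact: (cvg_comp _ _ (C 0%N) (@cvgy_atan R)).
have [] // := @FTC_exhaust_ge0 R setT atan (fun t => (1 + t ^+ 2)^-1)
  (fun n => - n.+1%:R) (fun n => n.+1%:R) (- (pi / 2)) (pi / 2).
- by move=> n; rewrite (@lt_trans _ _ 0) ?oppr_lt0.
- by move=> n; rewrite lerN2 ler_nat.
- by move=> n; rewrite ler_nat.
- apply/seteqP; split => // x _.
  have := archi_boundP (normr_ge0 x); set n := Num.Def.archi_bound _ => hn.
  exists n => //=; rewrite in_itv/= -ler_norml (le_trans (ltW hn))// ler_nat//.
- move=> x _; apply: cvgV; first by rewrite gt_eqF.
  apply: cvgD; first exact: cvg_cst.
  by rewrite expr2; under eq_fun do rewrite expr2; apply: cvgM; exact: cvg_id.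
- by under eq_fun do rewrite atanN; apply: cvgN.
- by move=> x _; rewrite invr_ge0 ltW.
Qed.

Lemma cmeas_line (f : R -> R[i]) : (forall t, ccvg (nbhs t) f (f t)) -> cmeas setT f.
Proof. by move=> h; apply: cmeas_cont => //; exact: openT. Qed.

Lemma cint_line (f : R -> R[i]) (B : R) : cmeas setT f ->
  (forall t, nm (f t) <= B / (1 + t ^+ 2)) -> cint setT f.
Proof.
move=> mf fB; apply: (@cint_le _ _ f (fun t => B * (1 + t ^+ 2)^-1)) => //.
by apply: rintZ => //; exact: rint_atan.
Qed.

Definition ei (x : R) : R[i] := Cexp (0 +i* x).
Lemma eiD x y : ei (x + y) = ei x * ei y.
Proof. by rewrite /ei -CexpD; congr Cexp; apply: eqC => /=; rewrite ?addr0. Qed.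
Lemma nm_ei x : nm (ei x) = 1.
Proof. by rewrite /ei nm_Cexp expR0. Qed.
Lemma Re_ei x : re (ei x) = cos x. Proof. by rewrite /ei ReCexp /= expR0 mul1r. Qed.
Lemma Im_ei x : im (ei x) = sin x. Proof. by rewrite /ei ImCexp /= expR0 mul1r. Qed.
Lemma ccvg_ei {T : Type} (F : set_system T) {FF : Filter F} (u : T -> R) (l : R) :
  u x @[x --> F] --> l -> ccvg F (fun x => ei (u x)) (ei l).
Proof. by move=> ul; apply: ccvg_Cexp; split => //=; exact: cvg_cst. Qed.

Lemma cder_Cexp_lin (k : R[i]) (t : R) :
  cder (fun t => Cexp (k * t%:C)) t (k * Cexp (k * t%:C)).
Proof.
apply: cder_eq; first by apply: cder_Cexp; apply: cderZ; exact: cder_id.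
by rewrite mulr1.
Qed.

Lemma laplace_half (k : R[i]) : 0 < re k ->
  cint `]0, +oo[ (fun t => Cexp (- k * t%:C)) /\
  Cintegral `]0, +oo[ (fun t => Cexp (- k * t%:C)) = k^-1.
Proof.
move=> k0; have kn : k != 0 by apply/eqP => k1; rewrite k1 ltxx in k0.
have N (t : R) : nm (Cexp (- k * t%:C)) = expR (- (re k * t)).
  by rewrite nm_Cexp cReMr cReN mulNr.
have Co (t : R) : ccvg (nbhs t) (fun t => Cexp (- k * t%:C)) (Cexp (- k * t%:C)).
  by apply: cder_cont; exact: cder_Cexp_lin.
have [B B0 hB] := @expR_le_powR R (re k) (-2) k0 (ltac:(lra)).
have [B' B0' hB'] := @expR_le_powR R (re k) 0 k0 (lexx _).
have I : cint `]0, +oo[ (fun t => Cexp (- k * t%:C)).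
  apply: (@cint_pow2 _ _ (B + B') 0 (-2)); [|lra|lra| |].
  - by apply: cmeas_cont => [|x _]; [exact: interval_open|exact: Co].
  - by move=> v v0; rewrite N (le_trans (hB' v v0))// ler_wpM2r ?powR_ge0// lerDr.
  - by move=> v v0; rewrite N (le_trans (hB v v0))// ler_wpM2r ?powR_ge0// lerDl.
split => //.
have L : ccvg +oo (fun t => (- k)^-1 * Cexp (- k * t%:C)) 0.
  apply: (ccvg0_le (g := fun t => nm (- k)^-1 * expR (- (re k * t)))).
    by apply: nearW => t; rewrite nmM N.
  rewrite -[X in _ --> X](mulr0 (nm (- k)^-1)); apply: cvgM; first exact: cvg_cst.
  have h : re k * t @[t --> +oo] --> +oo.
    by apply: (gt0_cvgMry k0); exact: cvg_id.
  exact: (cvg_comp _ _ h (@cvgr_expR R)).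
rewrite (@CFTC_oy R 0 (fun t => (- k)^-1 * Cexp (- k * t%:C)) _ ((- k)^-1) 0) //; first by rewrite sub0r invrN opprK.
- move=> x _; apply: cder_eq; first by apply: cderZ; exact: cder_Cexp_lin.
  by rewrite mulrA mulVf ?oppr_eq0// mul1r.
- have E : (- k)^-1 = (- k)^-1 * Cexp (- k * 0%:C).
    by rewrite mulr0 Cexp0 mulr1.
  rewrite [X in ccvg _ _ X]E.
  have [c1 c2] := cder_cont (cderZ (- k)^-1 (cder_Cexp_lin (- k) 0)).
  by split; exact: cvg_at_right_filter.
Qed.

(** The regularising factor of Abel summation; its Fourier transform is the Poisson kernel. *)
Definition poisson (d t : R) : R := expR (- (d * `|t|)).

Lemma poisson_cont (d t : R) : {for t, continuous (poisson d)}.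
Proof.
have h : - (d * `|x|) @[x --> t] --> - (d * `|t|).
  apply: cvgN; apply: cvgM; first exact: cvg_cst.
  exact: norm_continuous.
by apply: continuous_cvg h; exact: continuous_expR.
Qed.

Lemma poisson_bound (d : R) : 0 < d ->
  exists B, forall t, poisson d t <= B / (1 + t ^+ 2).
Proof.
move=> d0; have [B B0 hB] := @expR_le_powR R d (-2) d0 (ltac:(lra)).
exists (1 + B) => t; rewrite ler_pdivlMr; last by rewrite ltr_wpDr ?sqr_ge0.
rewrite mulrDr mulr1 lerD//.
  by rewrite /poisson -expR0 ler_expR oppr_le0 mulr_ge0// ltW.
have [->|t0] := eqVneq t 0; first by rewrite expr0n mulr0.
have t1 : 0 < `|t| by rewrite normr_gt0.
rewrite /poisson -[t ^+ 2](real_normK (num_real t)) -ler_pdivlMr ?exprn_gt0//.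
by rewrite (le_trans (hB _ t1))// -powR_mulrn// -powRN.
Qed.

(** The two halves of the line contribute 1 / (d + i psi) and 1 / (d - i psi). *)
Lemma poisson_kernel (d psi : R) : 0 < d ->
  cint setT (fun t => (poisson d t)%:C * ei (t * psi)) /\
  Cintegral setT (fun t => (poisson d t)%:C * ei (t * psi)) =
    (2 * d / (d ^+ 2 + psi ^+ 2))%:C.
Proof.
move=> d0; have [B hB] := poisson_bound d0.
have mf : cmeas setT (fun t => (poisson d t)%:C * ei (t * psi)).
  apply: cmeas_line => t; apply: ccvgM; first by apply: ccvgR; exact: poisson_cont.
  by apply: ccvg_ei; apply: cvgM; [exact: cvg_id|exact: cvg_cst].
have I : cint setT (fun t => (poisson d t)%:C * ei (t * psi)).
  apply: (@cint_line _ B) => // t.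
  by rewrite nmM nm_ei mulr1 nmR ger0_norm ?expR_ge0.
split => //.
have E : [set: R] = `]-oo, 0[ `|` `[0, +oo[.
  by apply/seteqP; split => x //= _; rewrite !in_itv/= andbT; case: (ltP x 0); [left|right].
rewrite {1}E Cintegral_setU ?mitv//; last 2 first.
- by rewrite -E.
- rewrite disj_set2E; apply/eqP/seteqP; split => x //= [].
  by rewrite !in_itv/= andbT => /lt_le_trans h /h; rewrite ltxx.
have E2 : Cintegral `[0, +oo[ (fun t => (poisson d t)%:C * ei (t * psi)) =
    Cintegral `]0, +oo[ (fun t => (poisson d t)%:C * ei (t * psi)).
  have [m1 m2] := cint_sub measurableT (mitv `]0, +oo[) (@subsetT _ _) I.
  by rewrite /Cintegral; congr (_ +i* _); apply/esym; exact: Rintegral_itv_obnd_cbnd.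
rewrite E2 -{1}oppr0 Cintegral_opp; last first.
  by apply: cmeas_sub mf => //.
have k1 : 0 < re (d +i* psi) by [].
have k2 : 0 < re (d -i* psi) by [].
rewrite (eq_Cintegral (g := fun t => Cexp (- (d +i* psi) * t%:C))); last first.
  move=> t; rewrite /= in_itv/= andbT => t0; rewrite /poisson normrN gtr0_norm//.
  by rewrite -CexpR -CexpD; congr Cexp; apply: eqC => /=; ring.
rewrite (laplace_half k1).2.
rewrite (eq_Cintegral (g := fun t => Cexp (- (d -i* psi) * t%:C))); last first.
  move=> t; rewrite /= in_itv/= andbT => t0; rewrite /poisson gtr0_norm//.
  by rewrite -CexpR -CexpD; congr Cexp; apply: eqC => /=; ring.
rewrite (laplace_half k2).2.
have dp : d ^+ 2 + psi ^+ 2 != 0 by rewrite gt_eqF// ltr_wpDr ?sqr_ge0// exprn_gt0.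
by apply: eqC => /=; [field|rewrite sqrrN mulNr opprK addrC subrr].
Qed.
End LineIntegrals.

(** * Fubini's theorem for oscillating kernels *)

Section FubiniKernel.
Context {R : realType}.
Notation mu := (@lebesgue_measure R).
Let T := measurableTypeR R.

Lemma rint_prod (u v : R -> R) (g : T * T -> R) :
  rint setT u -> rint setT v -> measurable_fun setT g ->
  (forall t x, `|g (t, x)| <= u t * v x) ->
  (mu \x mu)%E.-integrable setT (EFin \o g).
Proof.
move=> iu iv mg gb; apply/integrable12ltyP; first exact/measurable_EFinP.
have iuv : mu.-integrable setT (fun t => (`|u t|)%:E * \int[mu]_x (`|v x|)%:E)%E.
  have fv : (\int[mu]_x (`|v x|)%:E)%E \is a fin_num.
    by apply: integrable_fin_num => //; exact: integrable_norm.
  rewrite -(fineK fv); apply: (@integrableZr _ _ _ mu setT measurableT _ (fun t => (`|u t|)%:E)).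
  exact: integrable_norm.
have /integrableP[_] := iuv; apply: le_lt_trans.
apply: ge0_le_integral => //=.
- by move=> x _; exact: integral_ge0.
- apply: (@measurable_fun_fubini_tonelli_F _ _ T T R mu (abse \o (EFin \o g))) => //.
  by apply: measurableT_comp => //; exact/measurable_EFinP.
- by move=> x; exact: abse_ge0.
- by apply: measurableT_comp => //; exact: (measurable_int mu).
move=> t _; rewrite gee0_abs; last by rewrite mule_ge0// integral_ge0.
have ivn : mu.-integrable setT (EFin \o (fun x => `|v x|)) by exact: integrable_norm.
rewrite -ge0_integralZl//=; last exact: measurable_int ivn.
apply: ge0_le_integral => //=.
- apply/measurable_EFinP; apply: measurableT_comp => //.
  exact: (measurableT_comp mg (pair1_measurable t)).
- by apply: measurable_funeM; exact: measurable_int ivn.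
move=> x _; rewrite -EFinM lee_fin (le_trans (gb _ _))// -normrM.
exact: ler_norm.
Qed.

Lemma Rfubini (g : T * T -> R) : (mu \x mu)%E.-integrable setT (EFin \o g) ->
  (forall t, rint setT (fun x => g (t, x))) -> (forall x, rint setT (fun t => g (t, x))) ->
  Rintegral mu setT (fun t => Rintegral mu setT (fun x => g (t, x))) =
  Rintegral mu setT (fun x => Rintegral mu setT (fun t => g (t, x))).
Proof.
move=> ig i1 i2; rewrite /Rintegral; congr fine.
transitivity (\int[mu]_t \int[mu]_x ((EFin \o g) (t, x)))%E.
  apply: eq_integral => t _; rewrite fineK//; apply: integrable_fin_num => //; exact: i1.
rewrite (Fubini ig); apply: eq_integral => x _; rewrite fineK//.
by apply: integrable_fin_num => //; exact: i2.
Qed.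

Lemma cint_mul_ei (D : set T) (k : R -> R[i]) (psi : R -> R) : measurable D ->
  cint D k -> measurable_fun D psi -> cint D (fun x => k x * ei (psi x)).
Proof.
move=> mD ik mpsi; apply: (cint_le mD _ _ (cint_nm mD ik)).
  apply: cmeasM; first exact: cint_meas.
  by apply: cmeas_Cexp => //; split => //=; exact: measurable_cst.
by move=> x _; rewrite nmM nm_ei mulr1.
Qed.

(** The variables are coupled by a unimodular phase only, so |f(t)| |k(x)| is an integrable majorant
    on the product. Both exchanges that occur later, in Mellin inversion and in the main terms, have
    this shape. *)
Lemma CfubiniT (f k : R -> R[i]) (psi : R -> R) :
  cint setT f -> cint setT k -> measurable_fun setT psi ->
  Cintegral setT (fun t => f t * Cintegral setT (fun x => k x * ei (t * psi x))) =
  Cintegral setT (fun x => k x * Cintegral setT (fun t => f t * ei (t * psi x))).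
Proof.
move=> if_ ik mpsi.
have mt x : measurable_fun setT (fun t : R => t * psi x) by apply: measurable_funM.
have mx t : measurable_fun setT (fun x : R => t * psi x) by apply: measurable_funM.
pose G (p : T * T) := f p.1 * (k p.2 * ei (p.1 * psi p.2)).
have iG1 t : cint setT (fun x => G (t, x)).
  by rewrite /G /=; apply: cintZ => //; exact: (cint_mul_ei measurableT ik (mx t)).
have iG2 x : cint setT (fun t => G (t, x)).
  have := cintZ (k x) measurableT (cint_mul_ei measurableT if_ (mt x)).
  apply: cint_eq => // t _; rewrite /G /=; ring.
have E1 : Cintegral setT (fun t => f t * Cintegral setT (fun x => k x * ei (t * psi x))) =
    Cintegral setT (fun t => Cintegral setT (fun x => G (t, x))).
  by apply: eq_Cintegral => t _; rewrite /G /= CintegralZ//; exact: (cint_mul_ei measurableT ik (mx t)).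
have E2 : Cintegral setT (fun x => k x * Cintegral setT (fun t => f t * ei (t * psi x))) =
    Cintegral setT (fun x => Cintegral setT (fun t => G (t, x))).
  apply: eq_Cintegral => x _; rewrite -CintegralZ//; last exact: (cint_mul_ei measurableT if_ (mt x)).
  by apply: eq_Cintegral => t _; rewrite /G /= mulrCA.
rewrite E1 E2.
have [mf1 mf2] := cint_meas if_; have [mk1 mk2] := cint_meas ik.
have M1 (u : R -> R) : measurable_fun setT u -> measurable_fun setT (fun p : T * T => u p.1).
  by move=> hu; apply: (measurableT_comp hu); exact: measurable_fst.
have M2 (u : R -> R) : measurable_fun setT u -> measurable_fun setT (fun p : T * T => u p.2).
  by move=> hu; apply: (measurableT_comp hu); exact: measurable_snd.
have Mth : measurable_fun setT (fun p : T * T => p.1 * psi p.2).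
  by apply: measurable_funM; [exact: (M1 id)|exact: M2].
have Mc : measurable_fun setT (fun p : T * T => cos (p.1 * psi p.2)).
  by apply: measurableT_comp Mth; apply: continuous_measurable_fun; exact: continuous_cos.
have Ms : measurable_fun setT (fun p : T * T => sin (p.1 * psi p.2)).
  by apply: measurableT_comp Mth; apply: continuous_measurable_fun; exact: continuous_sin.
have Mre : measurable_fun setT (fun p : T * T => re (G p)).
  rewrite /G; under eq_fun do rewrite cReM cReM Re_ei Im_ei cImM Re_ei Im_ei.
  apply: measurable_funB; apply: measurable_funM; [exact: (M1 (fun t => re (f t)))| |exact: (M1 (fun t => im (f t)))|].
    by apply: measurable_funB; apply: measurable_funM => //; [exact: (M2 (fun t => re (k t)))|exact: (M2 (fun t => im (k t)))].
  by apply: measurable_funD; apply: measurable_funM => //; [exact: (M2 (fun t => re (k t)))|exact: (M2 (fun t => im (k t)))].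
have Mim : measurable_fun setT (fun p : T * T => im (G p)).
  rewrite /G; under eq_fun do rewrite cImM cReM Re_ei Im_ei cImM Re_ei Im_ei.
  apply: measurable_funD; apply: measurable_funM; [exact: (M1 (fun t => re (f t)))| |exact: (M1 (fun t => im (f t)))|].
    by apply: measurable_funD; apply: measurable_funM => //; [exact: (M2 (fun t => re (k t)))|exact: (M2 (fun t => im (k t)))].
  by apply: measurable_funB; apply: measurable_funM => //; [exact: (M2 (fun t => re (k t)))|exact: (M2 (fun t => im (k t)))].
have nG t x : nm (G (t, x)) = nm (f t) * nm (k x).
  by rewrite /G /= nmM nmM nm_ei mulr1.
apply: eqC => /=.
  apply: (@Rfubini (fun p => re (G p))) => [|t|x].
  - apply: (rint_prod (cint_nm measurableT if_) (cint_nm measurableT ik)) => // t x.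
    by rewrite -nG cRe_le_nm.
  - by have [] := iG1 t.
  - by have [] := iG2 x.
apply: (@Rfubini (fun p => im (G p))) => [|t|x].
- apply: (rint_prod (cint_nm measurableT if_) (cint_nm measurableT ik)) => // t x.
  by rewrite -nG cIm_le_nm.
- by have [] := iG1 t.
- by have [] := iG2 x.
Qed.

Lemma Cintegral_mkcond (D : set T) (f : R -> R[i]) :
  Cintegral D f = Cintegral setT (fun x => (\1_D x)%:C * f x).
Proof.
have E x : \1_D x = if x \in D then 1 else 0 :> R by rewrite indicE; case: (x \in D).
apply: eqC => /=; rewrite Rintegral_mkcond; congr (Rintegral _ _ _); apply/funext => x;
  by rewrite patchE ?cReMl ?cImMl E; case: ifP => _; rewrite ?mul1r ?mul0r.
Qed.

Lemma cint_mkcond (D : set T) (f : R -> R[i]) : measurable D -> cint D f ->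
  cint setT (fun x => (\1_D x)%:C * f x).
Proof.
have E x : \1_D x = if x \in D then 1 else 0 :> R by rewrite indicE; case: (x \in D).
move=> mD [f1 f2]; split.
  have := (integrable_mkcond _ mD).1 f1; rewrite /rint; congr (_.-integrable _ _).
  apply/funext => x /=; rewrite patchE cReMl E; case: ifP => _; by rewrite ?mul1r ?mul0r.
have := (integrable_mkcond _ mD).1 f2; rewrite /rint; congr (_.-integrable _ _).
apply/funext => x /=; rewrite patchE cImMl E; case: ifP => _; by rewrite ?mul1r ?mul0r.
Qed.

Lemma Cfubini (D : set T) (f k : R -> R[i]) (psi : R -> R) : measurable D ->
  cint setT f -> cint D k -> measurable_fun setT psi ->
  Cintegral setT (fun t => f t * Cintegral D (fun x => k x * ei (t * psi x))) =
  Cintegral D (fun x => k x * Cintegral setT (fun t => f t * ei (t * psi x))).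
Proof.
move=> mD if_ ik mpsi; rewrite [RHS]Cintegral_mkcond.
under [RHS]eq_Cintegral do rewrite mulrA.
rewrite -(CfubiniT if_ (cint_mkcond mD ik) mpsi).
apply: eq_Cintegral => t _; congr (_ * _); rewrite Cintegral_mkcond.
by apply: eq_Cintegral => x _; rewrite mulrA.
Qed.
End FubiniKernel.

(** * Mellin transform and Mellin inversion *)

Section Mellin.
Context {R : realType}.
Notation mu := (@lebesgue_measure R).
Implicit Types (Psi dPsi : R -> R[i]) (x v t s d X tau : R).

(** Each power bounds [Psi] on the whole half-line: k = 0 serves near 0, very negative k at
    infinity, and a k in between becomes a power of the dilation parameter once [Psi] is dilated. *)
Definition rapid Psi : Prop := forall k : R, k <= 0 ->
  exists2 B, 0 <= B & forall x, 0 < x -> nm (Psi x) <= B * x `^ k.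

Lemma posI (x : R) : (`]0, +oo[%classic x) = (0 < x) :> Prop.
Proof. by rewrite /= in_itv/= andbT. Qed.

Lemma open_pos : open (`]0, +oo[%classic : set R).
Proof. exact: interval_open. Qed.

Lemma cmeas_pos (f : R -> R[i]) :
  (forall x, 0 < x -> ccvg (nbhs x) f (f x)) -> cmeas `]0, +oo[ f.
Proof. by move=> h; apply: (cmeas_cont open_pos) => x; rewrite posI; exact: h. Qed.

Lemma cmeas_cpow (w : R[i]) : cmeas `]0, +oo[ (fun x : R => cpow x%:C w).
Proof. by apply: cmeas_pos => x x0; exact: cder_cont (cder_cpowR w x0). Qed.

Lemma cpow_line (x : R) (z : R[i]) (t : R) : 0 < x ->
  cpow x%:C (z + (0 +i* t)) = cpow x%:C z * ei (t * ln x).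
Proof.
move=> x0; rewrite cpowDr; congr (_ * _); rewrite cpowR// /ei; congr Cexp.
by apply: eqC; rewrite ?cReMr ?cImMr /= ?mul0r.
Qed.

Lemma cint_mellin Psi (w : R[i]) : cmeas `]0, +oo[ Psi -> rapid Psi -> -1 < re w ->
  cint `]0, +oo[ (fun x => Psi x * cpow x%:C w).
Proof.
move=> mP rP w1; have [B B0 hB] := rP 0 (lexx _).
have [B' B0' hB'] := rP (- re w - 2) (ltac:(lra)).
apply: (@cint_pow2 _ _ (B + B') (re w) (-2)) => //; [|lra| |].
- by apply: cmeasM => //; exact: cmeas_cpow.
- move=> v v0; rewrite nmM nm_cpowR// ler_wpM2r ?powR_ge0//.
  by rewrite (le_trans (hB v v0))// powRr0 mulr1 lerDl.
- move=> v v0; rewrite nmM nm_cpowR//.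
  have -> : (-2 : R) = (- re w - 2) + re w by ring.
  rewrite powRD ?(gt_eqF v0) ?implybT// mulrA ler_wpM2r ?powR_ge0//.
  by rewrite (le_trans (hB' v v0))// ler_wpM2r ?powR_ge0// lerDr.
Qed.

Lemma mellin_line_cont Psi (tau : R) : cmeas `]0, +oo[ Psi -> rapid Psi -> 0 < tau ->
  forall t, ccvg (nbhs t) (fun t => mellin Psi (tau +i* t)) (mellin Psi (tau +i* t)).
Proof.
move=> mP rP t0; have h : -1 < re (tau%:C - 1) by rewrite /=; lra.
have iP := cint_mellin mP rP h.
apply: (@continuous_Cintegral _ `]0, +oo[ (fun t x => Psi x * cpow x%:C (tau +i* t - 1))
  (fun x => nm (Psi x * cpow x%:C (tau%:C - 1)))).
- exact: mitv.
- by move=> t; apply: cmeasM => //; exact: cmeas_cpow.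
- move=> t x; rewrite posI => x0; apply: ccvgMl.
  have E s : cpow x%:C (tau +i* s - 1) = cpow x%:C (tau%:C - 1) * ei (s * ln x).
    by rewrite -cpow_line//; congr cpow; apply: eqC => /=; ring.
  rewrite E; under eq_fun do rewrite E; apply: ccvgMl; apply: ccvg_ei.
  by apply: cvgM; [exact: cvg_id|exact: cvg_cst].
- by apply: cint_nm iP; exact: mitv.
- by move=> t x; rewrite posI => x0; rewrite nmM nmM !nm_cpowR//= subr0.
Qed.

(** Integration by parts; the boundary term at 0 vanishes by re u > 0 and the one at infinity by
    rapid decay. *)
Lemma mellin_theta Psi dPsi (u : R[i]) : 0 < re u ->
  (forall x, 0 < x -> cder Psi x (dPsi x)) ->
  (forall x, 0 < x -> ccvg (nbhs x) dPsi (dPsi x)) ->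
  rapid Psi -> rapid (fun x => x%:C * dPsi x) ->
  mellin (fun x => x%:C * dPsi x) u = - (u * mellin Psi u).
Proof.
move=> u0 dP cdP rP rdP.
have mP : cmeas `]0, +oo[ Psi by apply: cmeas_pos => x x0; exact: cder_cont (dP x x0).
have mdP : cmeas `]0, +oo[ (fun x : R => x%:C * dPsi x).
  apply: cmeas_pos => x x0; apply: ccvgM; last exact: cdP.
  by apply: ccvgR; exact: cvg_id.
have h : -1 < re (u - 1) by rewrite cReB/=; lra.
have i1 := cint_mellin mP rP h; have i2 := cint_mellin mdP rdP h.
have mI := mitv (`]0, +oo[ : interval R).
have := @CFTC_oy R 0 (fun x => Psi x * cpow x%:C u)
  (fun x => x%:C * dPsi x * cpow x%:C (u - 1) + u * (Psi x * cpow x%:C (u - 1))) 0 0.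
rewrite CintegralD//; last exact: cintZ.
rewrite CintegralZ// subr0 => H.
apply/eqP; rewrite -addr_eq0; apply/eqP; apply: H; last by apply: cintD => //; exact: cintZ.
- move=> x x0; apply: cder_eq; first by apply: cderM; [exact: dP|exact: cder_cpowR].
  have x1 : x%:C != 0 :> R[i] by apply/eqP => -[/eqP]; rewrite gt_eqF.
  have -> : cpow x%:C u = cpow x%:C (u - 1) * x%:C.
    by rewrite -[in LHS](subrK 1 u) [LHS]cpowDr cpow1.
  ring.
- move=> x x0; have c1 := cder_cont (dP x x0).
  have c2 := cder_cont (cder_cpowR (u - 1) x0).
  apply: ccvgD; last by apply: ccvgMl; exact: ccvgM.
  apply: ccvgM => //; apply: ccvgM; last exact: cdP.
  by apply: ccvgR; exact: cvg_id.
- have [B B0 hB] := rP 0 (lexx _).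
  apply: (ccvg0_le (g := fun x => B * x `^ re u)).
    near=> x; have x0 : 0 < x by near: x; exact: nbhs_right_gt.
    by rewrite nmM nm_cpowR// ler_wpM2r ?powR_ge0// (le_trans (hB x x0))// powRr0 mulr1.
  rewrite -[X in _ --> X](mulr0 B); apply: cvgM; [exact: cvg_cst|exact: powR_cvg0].
- have [B B0 hB] := rP (- re u - 1) (ltac:(lra)).
  apply: (ccvg0_le (g := fun x => B * x^-1)).
    near=> x; have x0 : 0 < x by near: x; exact: nbhs_pinfty_gt.
    rewrite nmM nm_cpowR// -powR_inv1 ?(ltW x0)//.
    have -> : (-1 : R) = (- re u - 1) + re u by ring.
    rewrite powRD ?(gt_eqF x0) ?implybT// mulrA ler_wpM2r ?powR_ge0//.
    exact: hB.
  rewrite -[X in _ --> X](mulr0 B); apply: cvgM; first exact: cvg_cst.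
  apply/gtr0_cvgV0; last exact: cvg_id.
  exact: nbhs_pinfty_gt.
Unshelve. all: end_near. Qed.

(* The Fourier transform of the Poisson factor e^(- d |t|) at ln x - ln X, with
   the Jacobian of ln. *)
Definition logkern (X d x : R) : R := 2 * d / (d ^+ 2 + (ln x - ln X) ^+ 2) * x^-1.

Lemma logkern_ge0 X d x : 0 < d -> 0 < x -> 0 <= logkern X d x.
Proof.
move=> d0 x0; rewrite /logkern mulr_ge0 ?invr_ge0 ?(ltW x0)// divr_ge0 ?addr_ge0 ?sqr_ge0//.
by rewrite mulr_ge0 ?ltW.
Qed.

(** The primitive is 2 atan ((ln x - ln X) / d). Divided by 2 pi, the kernel is a probability
    density which concentrates at X as d -> 0. *)
Lemma logkern_int X d : 0 < d ->
  rint `]0, +oo[ (logkern X d) /\ Rintegral mu `]0, +oo[ (logkern X d) = 2 * pi.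
Proof.
move=> d0.
have dn : d != 0 by rewrite gt_eqF.
have D0 (x : R) : 0 < d ^+ 2 + (ln x - ln X) ^+ 2 by rewrite ltr_wpDr ?sqr_ge0// exprn_gt0.
have dl (x : R) : 0 < x -> is_derive x 1 (fun x => (ln x - ln X) / d) (x^-1 / d).
  move=> x0; have h := isdB (is_derive1_ln x0) (isdC (ln X) x).
  apply: isd_eq (isdM h (isdC d^-1 x)) _.
  by rewrite mulr0 addr0 subr0.
have [|||||i1 i2] := @FTC_oy_ge0 R 0 (- pi) pi (fun x => 2 * atan ((ln x - ln X) / d)) (logkern X d).
- move=> x x0; apply: isd_eq (isdZ 2 (isdcomp (is_derive1_atan _) (dl x x0))) _.
  rewrite /logkern; have := D0 x; set l := ln x - ln X => D1.
  by field; rewrite (gt_eqF x0) dn (gt_eqF D1).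
- move=> x x0; have c1 : {for x, continuous (fun x : R => ln x - ln X)}.
    by apply: cvgB; [exact: continuous_ln|exact: cvg_cst].
  apply: cvgM; last by apply: cvgV; [rewrite gt_eqF|exact: cvg_id].
  apply: cvgM; first exact: cvg_cst.
  apply: cvgV; first by rewrite gt_eqF.
  apply: cvgD; first exact: cvg_cst.
  by rewrite expr2; under eq_fun do rewrite expr2; exact: cvgM.
- have -> : - pi = 2 * - (pi / 2) :> R by field.
  apply: cvgM; first exact: cvg_cst.
  have h : (ln x - ln X) / d @[x --> 0^'+] --> -oo.
    apply: gt0_cvgMlNy; first by rewrite invr_gt0.
    apply/cvgrNyPle => M; have /cvgrNyPle/(_ (M + ln X)) := @lnNy R.
    by apply: filterS => x; rewrite lerBlDr.
  have h2 : (atan x : R) @[x --> -oo] --> - (pi / 2).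
    apply/cvgNy_compNP; rewrite /comp; under eq_fun do rewrite atanN.
    by apply: cvgN; exact: cvgy_atan.
  exact: (cvg_comp _ _ h h2).
- have -> : pi = 2 * (pi / 2) :> R by field.
  apply: cvgM; first exact: cvg_cst.
  have h : (ln x - ln X) / d @[x --> +oo] --> +oo.
    apply: gt0_cvgMly; first by rewrite invr_gt0.
    apply/cvgryPge => M; near=> x; rewrite lerBrDr -[leLHS]expRK ler_ln ?posrE ?expR_gt0//.
  exact: (cvg_comp _ _ h (@cvgy_atan R)).
- by move=> x x0; exact: logkern_ge0.
by rewrite i2; split=> //; ring.
Unshelve. all: end_near. Qed.
End Mellin.

Section MellinInversion.
Context {R : realType}.
Notation mu := (@lebesgue_measure R).
Implicit Types (Psi dPsi : R -> R[i]) (x v t s d X tau B : R).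

(** In the coordinate y = ln x the derivative of f is x f'(x). *)
Lemma log_lipschitz (f df : R -> R[i]) B : (forall x, 0 < x -> cder f x (df x)) ->
  (forall x, 0 < x -> nm (x%:C * df x) <= B) ->
  forall x X, 0 < x -> 0 < X -> nm (f x - f X) <= 2 * (B * `|ln x - ln X|).
Proof.
move=> fd dfB.
have dG y : cder (fun y => f (expR y)) y (df (expR y) * (expR y)%:C).
  exact: (cder_comp (fd _ (expR_gt0 y)) (is_derive_expR y)).
have H a b : a < b -> nm (f (expR b) - f (expR a)) <= 2 * (B * `|b - a|).
  move=> ab; rewrite gtr0_norm ?subr_gt0//.
  apply: (@complex_mvi R (fun y => f (expR y)) (fun y => df (expR y) * (expR y)%:C)) => //.
  - by move=> y _ _; rewrite mulrC dfB ?expR_gt0.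
  - by have [c1 c2] := cder_cont (dG a); split; exact: cvg_at_right_filter.
have B0 : 0 <= B := le_trans (nm_ge0 _) (dfB 1 ltr01).
move=> x X x0 X0; have [h|h|h] := ltgtP (ln x) (ln X).
- by rewrite nmBC distrC -{1}(lnK x0) -{1}(lnK X0) H.
- by rewrite -{1}(lnK x0) -{1}(lnK X0) H.
- have -> : x = X by rewrite -(lnK x0) h lnK.
  by rewrite !subrr nm0 normr0 !mulr0.
Qed.

(** Multiplied by min (1, |l|) the Poisson kernel has a majorant free of d: for |l| <= 1 use 2 |l| d
    <= d^2 + l^2, for |l| > 1 drop d^2 from the denominator. This dominates the kernel times f(x) -
    f(X) as d -> 0. *)
Lemma logkern_min d l : 0 < d -> d <= 1 ->
  `|l| * (2 * d / (d ^+ 2 + l ^+ 2)) <= 4 / (1 + l ^+ 2) \/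
  (2 * d / (d ^+ 2 + l ^+ 2)) <= 4 / (1 + l ^+ 2).
Proof.
move=> d0 d1; have D0 : 0 < d ^+ 2 + l ^+ 2 by rewrite ltr_wpDr ?sqr_ge0// exprn_gt0.
have D1 : 0 < 1 + l ^+ 2 by rewrite ltr_wpDr ?sqr_ge0.
have n0 := normr_ge0 l; have l2 : l ^+ 2 = `|l| ^+ 2 by rewrite real_normK ?num_real.
have [l1|l1] := leP `|l| 1; [left|right].
  rewrite mulrA ler_pdivrMr// mulrAC ler_pdivlMr// l2; move: l1 n0.
  set y := `|l| => y1 y0.
  have : 2 * (y * d) <= d ^+ 2 + y ^+ 2 by have := sqr_ge0 (d - y); lra.
  have : y ^+ 2 <= 1 by rewrite expr_le1.
  have := mulr_ge0 y0 (ltW d0); nra.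
rewrite ler_pdivrMr// mulrAC ler_pdivlMr// l2; move: l1.
set y := `|l| => y1; have : 1 < y ^+ 2 by rewrite expr_gt1// ltW// (lt_trans ltr01).
nra.
Qed.

(** The factor e^(-d |t|) makes Fubini applicable and turns the left side into the integral of f(x)
    = Psi(x) x^tau against [logkern X d]. Then d = 1 / (n + 1) tends to 0: on the t-side the Mellin
    transform dominates, on the x-side the value f(X) times the mass 2 pi is split off first. *)
Lemma mellin_inversion Psi dPsi tau X : 0 < tau -> 0 < X ->
  (forall x, 0 < x -> cder Psi x (dPsi x)) ->
  rapid Psi -> rapid (fun x => x%:C * dPsi x) ->
  cint setT (fun t => mellin Psi (tau +i* t)) ->
  Cintegral setT (fun t => mellin Psi (tau +i* t) * ei (t * - ln X)) =
    (2 * pi)%:C * (Psi X * cpow X%:C tau%:C).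
Proof.
move=> t0 X0 dP rP rdP iM.
have mP : cmeas `]0, +oo[ Psi by apply: cmeas_pos => x x0; exact: cder_cont (dP x x0).
pose f x := Psi x * cpow x%:C tau%:C.
pose df x := dPsi x * cpow x%:C tau%:C + Psi x * (tau%:C * cpow x%:C (tau%:C - 1)).
have fd x : 0 < x -> cder f x (df x).
  by move=> x0; apply: cderM; [exact: dP|exact: cder_cpowR].
have ntau : - tau <= 0 by lra.
have [B1 B10 hB1] := rP (- tau) ntau; have [B2 B20 hB2] := rdP (- tau) ntau.
have pt v : 0 < v -> v `^ (- tau) * v `^ tau = 1.
  by move=> v0; rewrite -powRD ?(gt_eqF v0) ?implybT// addNr powRr0.
have fB x : 0 < x -> nm (f x) <= B1.
  move=> x0; rewrite nmM nm_cpowR//= -[leRHS]mulr1 -(pt x x0) mulrA.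
  by rewrite ler_wpM2r ?powR_ge0// hB1.
have dfB x : 0 < x -> nm (x%:C * df x) <= B2 + tau * B1.
  move=> x0; have x1 : x%:C != 0 :> R[i] by apply/eqP => -[/eqP]; rewrite gt_eqF.
  have -> : x%:C * df x = x%:C * dPsi x * cpow x%:C tau%:C + tau%:C * f x.
    rewrite /df /f.
    have -> : cpow x%:C tau%:C = cpow x%:C (tau%:C - 1) * x%:C.
      by rewrite -[in LHS](subrK 1 tau%:C) [LHS]cpowDr cpow1.
    ring.
  rewrite (le_trans (nmD _ _))// nmM (nmM tau%:C) nmR nm_cpowR//= (gtr0_norm t0) lerD//.
    rewrite -[leRHS]mulr1 -(pt x x0) mulrA.
    by rewrite ler_wpM2r ?powR_ge0// hB2.
  by rewrite ler_wpM2l ?fB// ltW.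
have Lip := log_lipschitz fd dfB.
(* [B] is at once a bound for |f(x) - f(X)| and a Lipschitz constant in ln x, so that each
   alternative of [logkern_min] can be met. *)
set B := 2 * (B2 + tau * B1) + 2 * B1.
have tB : 0 <= tau * B1 by rewrite mulr_ge0// ltW.
have B0 : 0 <= B by rewrite /B; lra.
have Lip1 x : 0 < x -> nm (f x - f X) <= B * `|ln x - ln X|.
  move=> x0; apply: le_trans (Lip x X x0 X0) _; rewrite mulrA ler_wpM2r// /B; lra.
have Lip2 x : 0 < x -> nm (f x - f X) <= B.
  by move=> x0; rewrite (le_trans (nmB _ _))// /B; have := fB x x0; have := fB X X0; lra.
pose dn (n : nat) : R := n.+1%:R^-1.
have dn0 n : 0 < dn n by rewrite invr_gt0.
have dn1 n : dn n <= 1 by rewrite invf_le1// ler1n.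
have dnl : dn n @[n --> \oo] --> 0 by exact: cvg_invS.
have mI := mitv (`]0, +oo[ : interval R).
have h : -1 < re (tau%:C - 1 : R[i]) by rewrite /=; lra.
have iP := cint_mellin mP rP h.
pose I n := Cintegral setT (fun t => ((poisson (dn n) t)%:C * ei (t * - ln X)) * mellin Psi (tau +i* t)).
have E1 n : I n = Cintegral `]0, +oo[ (fun x => (logkern X (dn n) x)%:C * f x).
  have [ip _] := poisson_kernel (- ln X) (dn0 n).
  rewrite /I.
  transitivity (Cintegral setT (fun t => ((poisson (dn n) t)%:C * ei (t * - ln X)) *
    Cintegral `]0, +oo[ (fun x => Psi x * cpow x%:C (tau%:C - 1) * ei (t * ln x)))).
    apply: eq_Cintegral => t _; congr (_ * _); apply: eq_Cintegral => x; rewrite posI => x0.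
    by rewrite -mulrA -cpow_line//; congr (_ * cpow _ _); apply: eqC => /=; ring.
  rewrite (Cfubini mI ip iP); last exact: measurable_ln.
  apply: eq_Cintegral => x; rewrite posI => x0.
  have -> : Cintegral setT (fun t => (poisson (dn n) t)%:C * ei (t * - ln X) * ei (t * ln x)) =
    Cintegral setT (fun t => (poisson (dn n) t)%:C * ei (t * (ln x - ln X))).
    apply: eq_Cintegral => t _; rewrite -mulrA -eiD; congr (_ * ei _); ring.
  have [_ ->] := poisson_kernel (ln x - ln X) (dn0 n).
  have x1 : x%:C != 0 :> R[i] by apply/eqP => -[/eqP]; rewrite gt_eqF.
  rewrite /f /logkern cpowDr cpowN cpow1// [in RHS]rmorphM/= [(x^-1)%:C]fmorphV; ring.
have iK n := logkern_int X (dn0 n).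
have iKC n : cint `]0, +oo[ (fun x => f X * (logkern X (dn n) x)%:C).
  by apply: cintZ => //; split; [exact: (iK n).1|exact: integrable0].
have mf : cmeas `]0, +oo[ f by apply: cmeas_pos => x x0; exact: cder_cont (fd x x0).
have mlk n : cmeas `]0, +oo[ (fun x => (logkern X (dn n) x)%:C).
  by apply: cmeasR; apply/measurable_EFinP; exact: measurable_int (iK n).1.
pose g n x := (logkern X (dn n) x)%:C * (f x - f X).
have gB n x : 0 < x -> nm (g n x) <= 2 * B * logkern X 1 x.
  move=> x0; rewrite /g nmM nmR ger0_norm ?logkern_ge0// /logkern.
  set l := ln x - ln X; rewrite mulrAC (mulrA (2 * B)) ler_wpM2r ?invr_ge0 ?(ltW x0)//.
  have k0 : 0 <= 2 * dn n / (dn n ^+ 2 + l ^+ 2).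
    by rewrite divr_ge0 ?addr_ge0 ?sqr_ge0 ?mulr_ge0// ltW.
  have -> : 2 * B * (2 * 1 / (1 ^+ 2 + l ^+ 2)) = B * (4 / (1 + l ^+ 2)).
    by rewrite expr1n mulr1 !mulrA; congr (_ / _); ring.
  have [H|H] := logkern_min l (dn0 n) (dn1 n).
    apply: le_trans (ler_wpM2l B0 H).
    by rewrite [leRHS]mulrA [leLHS]mulrC ler_wpM2r// Lip1.
  apply: le_trans (ler_wpM2l B0 H); rewrite [leLHS]mulrC ler_wpM2r//.
  exact: Lip2.
have gl x : 0 < x -> ccvg \oo (fun n => g n x) 0.
  move=> x0; have [xX|xX] := eqVneq (ln x) (ln X).
    have -> : (fun n => g n x) = (fun=> 0).
      apply/funext => n; rewrite /g; have -> : x = X by rewrite -(lnK x0) xX lnK.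
      by rewrite subrr mulr0.
    exact: ccvg_cst.
  set l := ln x - ln X; have l0 : l != 0 by rewrite subr_eq0.
  rewrite -(mul0r (f x - f X)); apply: ccvgM; last exact: ccvg_cst.
  apply: ccvgR; rewrite /logkern.
  have -> : 0 = 2 * 0 / (0 ^+ 2 + l ^+ 2) * x^-1 by rewrite mulr0 !mul0r.
  apply: cvgM; last exact: cvg_cst.
  apply: cvgM; first by apply: cvgM; [exact: cvg_cst|exact: dnl].
  apply: cvgV; first by rewrite expr0n add0r expf_neq0.
  apply: cvgD; last exact: cvg_cst.
  by rewrite expr2; under eq_fun do rewrite expr2; exact: cvgM.
have ig n : cint `]0, +oo[ (g n).
  apply: (@cint_le _ _ _ (fun x => 2 * B * logkern X 1 x)) => //.
  - by apply: cmeasM => //; apply: cmeasD => //; exact: cmeas_cst.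
  - by move=> x; rewrite posI; exact: gB.
  - by apply: rintZ => //; exact: (logkern_int X ltr01).1.
have G0 : ccvg \oo (fun n => Cintegral `]0, +oo[ (g n)) 0.
  rewrite -(Cintegral0 `]0, +oo[).
  apply: (@dominated_Cintegral _ _ g _ (fun x => 2 * B * logkern X 1 x)) => //.
  - by move=> n; exact: cint_meas.
  - by move=> x; rewrite posI; exact: gl.
  - by apply: rintZ => //; exact: (logkern_int X ltr01).1.
  - by move=> n x; rewrite posI; exact: gB.
have E2 n : I n = Cintegral `]0, +oo[ (g n) + f X * (2 * pi)%:C.
  rewrite E1.
  have -> : f X * (2 * pi)%:C = Cintegral `]0, +oo[ (fun x => f X * (logkern X (dn n) x)%:C).
    rewrite CintegralZ//; last by split; [exact: (iK n).1|exact: integrable0].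
    congr (_ * _); apply: eqC => /=; first by rewrite (iK n).2.
    by rewrite /Rintegral integral0_eq.
  rewrite -CintegralD//; apply: eq_Cintegral => x _; rewrite /g; ring.
have L1 : ccvg \oo I (0 + f X * (2 * pi)%:C).
  by have -> : I = _ := funext E2; apply: ccvgD G0 _; exact: ccvg_cst.
have mM := cint_meas iM.
have mnl : measurable_fun setT (fun t => t * - ln X) by apply: measurable_funM.
have L2 : ccvg \oo I (Cintegral setT (fun t => mellin Psi (tau +i* t) * ei (t * - ln X))).
  apply: (@dominated_Cintegral _ _ _ _ (fun t => nm (mellin Psi (tau +i* t)))) => //.
  - by move=> n; apply: cmeasM => //; exact: cint_meas (poisson_kernel (- ln X) (dn0 n)).1.
  - move=> t _; have -> : mellin Psi (tau +i* t) * ei (t * - ln X) =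
        1 * ei (t * - ln X) * mellin Psi (tau +i* t) by rewrite mul1r mulrC.
    apply: ccvgM; last exact: ccvg_cst.
    apply: ccvgM; last exact: ccvg_cst.
    have -> : 1 = (expR (- (0 * `|t|)))%:C :> R[i] by rewrite mul0r oppr0 expR0.
    apply: ccvgR; rewrite /poisson.
    have H : - (dn n * `|t|) @[n --> \oo] --> - (0 * `|t|).
      by apply: cvgN; apply: cvgM => //; exact: cvg_cst.
    by apply: continuous_cvg H; exact: continuous_expR.
  - exact: cint_nm.
  - move=> n t _; rewrite nmM nmM nm_ei mulr1 nmR ger0_norm ?expR_ge0//.
    rewrite ler_piMl ?nm_ge0// /poisson -expR0 ler_expR oppr_le0 mulr_ge0//.
    exact: ltW.
by rewrite (ccvg_unique L2 L1) add0r mulrC.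
Qed.
End MellinInversion.

(** * The Gamma integral along rays of the right half-plane *)

Section GammaRotation.
Context {R : realType}.
Notation mu := (@lebesgue_measure R).
Implicit Types (z w s : R[i]) (v t x : R).

Lemma cmeas_Cexp_lin z : cmeas `]0, +oo[ (fun v : R => Cexp (- z * v%:C)).
Proof. by apply: cmeas_pos => v _; exact: cder_cont (cder_Cexp_lin (- z) v). Qed.

Lemma nm_Cexp_lin z v : nm (Cexp (- z * v%:C)) = expR (- (re z * v)).
Proof. by rewrite nm_Cexp cReMr cReN mulNr. Qed.

Lemma cint_exp (f : R -> R[i]) (B p : R) z : cmeas `]0, +oo[ f -> -1 < p -> 0 < re z ->
  (forall v, 0 < v -> nm (f v) <= B * v `^ p) ->
  cint `]0, +oo[ (fun v => f v * Cexp (- z * v%:C)).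
Proof.
move=> mf p1 z0 fB.
have B0 : 0 <= B by have := le_trans (nm_ge0 _) (fB 1 ltr01); rewrite powR1 mulr1.
pose q := Num.min 0 (- 2 - p); have q0 : q <= 0 by rewrite ge_min lexx.
have q2 : q <= -2 - p by rewrite ge_min lexx orbT.
have [B1 B10 hB1] := expR_le_powR z0 q0; have [B2 B20 hB2] := expR_le_powR z0 (lexx 0).
apply: (@cint_pow2 _ _ (B * (B1 + B2)) p (p + q)) => //; [|lra| |].
- by apply: cmeasM => //; exact: cmeas_Cexp_lin.
- move=> v v0; rewrite nmM nm_Cexp_lin mulrAC ler_pM ?nm_ge0 ?expR_ge0 ?fB//.
  by rewrite (le_trans (hB2 v v0))// powRr0 mulr1 lerDr.
- move=> v v0; rewrite nmM nm_Cexp_lin.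
  rewrite powRD ?(gt_eqF v0) ?implybT// mulrACA ler_pM ?nm_ge0 ?expR_ge0 ?fB//.
  by rewrite (le_trans (hB1 v v0))// ler_wpM2r ?powR_ge0// lerDl.
Qed.

(** The Laplace transform of v^(s-1), that is Gamma(s) z^(-s); at z = 1 it is Euler's integral. *)
Definition Kz z s : R[i] :=
  Cintegral `]0, +oo[ (fun v => cpow v%:C (s - 1) * Cexp (- z * v%:C)).

Lemma cint_Kz z s : 0 < re z -> 0 < re s ->
  cint `]0, +oo[ (fun v => cpow v%:C (s - 1) * Cexp (- z * v%:C)).
Proof.
move=> z0 s0; apply: (@cint_exp _ 1 (re s - 1)) => //.
- exact: cmeas_cpow.
- by lra.
- by move=> v v0; rewrite nm_cpowR// cReB mul1r.
Qed.

Lemma Kz1 s : Kz 1 s = CGamma s.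
Proof.
apply: eq_Cintegral => v _; rewrite mulrC; congr (_ * _).
by rewrite mulN1r -rmorphN/= CexpR.
Qed.

Lemma Kz_succ z s : 0 < re z -> 0 < re s -> z * Kz z (s + 1) = s * Kz z s.
Proof.
move=> z0 s0; have s1 : 0 < re (s + 1) by rewrite cReD/= ltr_wpDr.
have i1 := cint_Kz z0 s0; have i2 := cint_Kz z0 s1.
have mI := mitv (`]0, +oo[ : interval R).
apply/esym/eqP; rewrite -subr_eq0 /Kz -!CintegralZ// -CintegralB//; try exact: cintZ.
apply/eqP; rewrite -[RHS](subrr (0 : R[i])).
apply: (@CFTC_oy _ _ (fun v => cpow v%:C s * Cexp (- z * v%:C))).
- move=> v v0; apply: cder_eq.
    by apply: cderM; [exact: cder_cpowR|exact: cder_Cexp_lin].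
  by rewrite addrK; ring.
- move=> v v0; have c1 := cder_cont (cder_Cexp_lin (- z) v).
  have c2 := cder_cont (cder_cpowR (s - 1) v0).
  have c3 := cder_cont (cder_cpowR (s + 1 - 1) v0).
  by apply: ccvgB; apply: ccvgMl; exact: ccvgM.
- have [B B0 hB] := expR_le_powR z0 (lexx 0).
  apply: (ccvg0_le (g := fun x => B * x `^ re s)).
    near=> x; have x0 : 0 < x by near: x; exact: nbhs_right_gt.
    rewrite nmM nm_cpowR// nm_Cexp_lin mulrC ler_wpM2r ?powR_ge0//.
    by rewrite (le_trans (hB x x0))// powRr0 mulr1.
  rewrite -[X in _ --> X](mulr0 B); apply: cvgM; [exact: cvg_cst|exact: powR_cvg0].
- have h : - re s - 1 <= 0 by lra.
  have [B B0 hB] := expR_le_powR z0 h.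
  apply: (ccvg0_le (g := fun x => B * x^-1)).
    near=> x; have x0 : 0 < x by near: x; exact: nbhs_pinfty_gt.
    rewrite nmM nm_cpowR// nm_Cexp_lin -powR_inv1 ?(ltW x0)//.
    have -> : (-1 : R) = (- re s - 1) + re s by ring.
    by rewrite powRD ?(gt_eqF x0) ?implybT// mulrA mulrC ler_wpM2r ?powR_ge0// hB.
  rewrite -[X in _ --> X](mulr0 B); apply: cvgM; first exact: cvg_cst.
  apply/gtr0_cvgV0; last exact: cvg_id.
  exact: nbhs_pinfty_gt.
- have mI2 := mitv (`]0, +oo[ : interval R).
  have := cintD mI2 (cintZ s mI2 i1) (cintZ (-1) mI2 (cintZ z mI2 i2)).
  by apply: cint_eq => // x _; rewrite mulN1r.
Unshelve. all: end_near. Qed.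

(* K_z(s) z^s is constant along the path z^theta, 0 <= theta <= 1: there
   d/dtheta K(theta) = - zeta s K(theta) where zeta = log z. *)
Lemma Kz_Gamma z s : 0 < re z -> 0 < re s -> Kz z s = cpow z (- s) * CGamma s.
Proof.
move=> z0 s0; have zn : z != 0 by apply/eqP => k1; rewrite k1 ltxx in z0.
pose zeta := Clog z; pose w t := Cexp (zeta * t%:C).
have wE t : re (w t) = expR (re zeta * t) * cos (im zeta * t).
  by rewrite ReCexp cReMr cImMr.
have /andP[a1 a2] := Carg_lt z0.
have w0 t : 0 <= t <= 1 -> 0 < re (w t).
  move=> /andP[t0 t1]; rewrite wE mulr_gt0 ?expR_gt0// cos_gt0_pihalf//=.
  by apply/andP; split; nra.
have cw t : cder w t (zeta * w t) by exact: cder_Cexp_lin.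
have s1 : 0 < re (s + 1) by rewrite cReD/= ltr_wpDr.
have mI := mitv (`]0, +oo[ : interval R).
have dK t : 0 <= t <= 1 -> cder (fun t => Kz (w t) s) t (- (zeta * s) * Kz (w t) s).
  (* Near t the real part of w stays above c, so e^(- c v) dominates the differentiated
     integrand. *)
  move=> t01; have wt := w0 t t01; pose c := re (w t) / 2.
  have c0 : 0 < c by rewrite divr_gt0.
  have [cre _] := cder_cont (cw t).
  have H : \forall x \near t, c < re (w x) /\ nm (w x) < nm (w t) + 1.
    have h1 : \forall x \near t, c < re (w x).
      by apply: (cvgr_gt _ cre); rewrite /c ltr_pdivrMr// ltr_pMr// ltr1n.
    have h2 : \forall x \near t, nm (w x) < nm (w t) + 1.
      by apply: (cvgr_lt _ (ccvg_nm (cder_cont (cw t)))); rewrite ltrDl.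
    by near=> x; split; near: x.
  have [e /= e0 He] := H.
  have J x : t - e < x < t + e -> c < re (w x) /\ nm (w x) < nm (w t) + 1.
    by move=> h; apply: He; rewrite /ball/= distrC ltr_distl.
  have J0 x : t - e < x < t + e -> 0 < re (w x) by move=> /J[h _]; exact: lt_trans h.
  have tt : t - e < t < t + e by rewrite ltrBlDr ltrDl e0.
  pose G v := nm zeta * (nm (w t) + 1) * nm (cpow v%:C (s + 1 - 1) * Cexp (- c%:C * v%:C)).
  have iG : rint `]0, +oo[ G.
    by apply: rintZ => //; apply: cint_nm => //; apply: cint_Kz.
  apply: cder_eq.
    apply: (@cder_Cintegral _ _ _ (fun t v => - (zeta * w t) * (cpow v%:C (s + 1 - 1) * Cexp (- w t * v%:C)))
       G (t - e) (t + e)) => //.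
    - by move=> x /J0 wx; exact: cint_Kz.
    - move=> x v _; rewrite posI => v0; apply: cder_eq.
        apply: cderZ; apply: cder_Cexp.
        apply: cderM; [apply: cderN; exact: cw|exact: cder_cst].
      have -> : cpow v%:C (s + 1 - 1) = cpow v%:C (s - 1) * v%:C.
        rewrite addrK -[in LHS](subrK 1 s) [LHS]cpowDr cpow1//.
        by apply/eqP => -[/eqP]; rewrite gt_eqF.
      by rewrite mulr0 addr0; ring.
    - move=> x v /J[h1 h2]; rewrite posI => v0.
      rewrite nmM nmN nmM /G ler_pM ?nm_ge0 ?mulr_ge0 ?nm_ge0//.
        by rewrite ler_wpM2l ?nm_ge0// ltW.
      rewrite nmM nmM ler_wpM2l ?nm_ge0// !nm_Cexp_lin ler_expR lerN2.
      by rewrite ler_wpM2r ?(ltW v0)// ltW.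
  (* Differentiation under the integral produces w K_w(s + 1), which [Kz_succ] brings back to s
     K_w(s). *)
  rewrite CintegralZ//; last exact: cint_Kz.
  rewrite -/(Kz (w t) (s + 1)) mulNr -mulrA Kz_succ// mulNr; congr (- _).
  by rewrite mulrA.
pose Q t := Cexp (s * zeta * t%:C) * Kz (w t) s.
have dQ t : 0 <= t <= 1 -> cder Q t 0.
  move=> t01; apply: cder_eq.
    by apply: cderM; [exact: cder_Cexp_lin|exact: dK].
  by cbv beta; ring.
have Q01 : nm (Q 1 - Q 0) <= 2 * (0 * (1 - 0)).
  apply: (@complex_mvi _ _ (fun=> 0)) => //.
  - by move=> y y0 y1; apply: dQ; rewrite ltW.
  - by move=> y _ _; rewrite nm0.
  - have [|c1 c2] := cder_cont (dQ 0 _); first by rewrite lexx ler01.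
    by split; exact: cvg_at_right_filter.
have {Q01} : Q 1 = Q 0.
  by apply/eqP; rewrite -subr_eq0 -nm_eq0 eq_le nm_ge0 andbT (le_trans Q01)// !mul0r mulr0.
rewrite /Q /w !mulr1 !mulr0 Cexp0 mul1r Kz1 CexpLog// => <-.
by rewrite cpowN /cpow mulrA mulVf ?mul1r// Cexp_neq0.
Unshelve. all: end_near. Qed.
End GammaRotation.

(** * Symbols and oscillatory integrals *)

Section SymbolClass.
Context {R : realType} {P : Type}.
Notation mu := (@lebesgue_measure R).
Implicit Types (U V : set R) (w : P -> R) (b c v : R) (f g : P -> R -> R[i]).

(* Symbols of order b: the k-th derivative in v, k <= n, is O(w p * v^(b - k)) on
   U, uniformly in the parameter p. *)
Fixpoint sym U w b n f : Prop :=
  (exists2 B, 0 <= B & forall p v, U v -> nm (f p v) <= B * w p * v `^ b) /\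
  if n is m.+1 then
    exists f', (forall p v, U v -> cder (f p) v (f' p v)) /\ sym U w (b - 1) m f'
  else True.

Lemma sym_bound U w b n f : sym U w b n f ->
  exists2 B, 0 <= B & forall p v, U v -> nm (f p v) <= B * w p * v `^ b.
Proof. by case: n => [|n] []. Qed.

Lemma sym_ext n U w b f g : open U -> (forall p v, U v -> f p v = g p v) ->
  sym U w b n f -> sym U w b n g.
Proof.
move=> oU fg; case: n => [|n] [[B B0 hB] H]; (split; first by exists B => // p v Uv; rewrite -fg// hB).
  by [].
have [f' [df sf]] := H; exists f'; split => // p v Uv.
apply: cder_near (df p v Uv); have := open_nbhs_nbhs (conj oU Uv).
by apply: filterS => x Ux; exact: fg.
Qed.

Lemma sym_sub n U V w b f : V `<=` U -> sym U w b n f -> sym V w b n f.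
Proof.
move=> VU; elim: n b f => [|n IH] b f [[B B0 hB] H];
  (split; first by exists B => // p v /VU; exact: hB) => //.
have [f' [df sf]] := H; exists f'; split; last exact: IH.
by move=> p v /VU; exact: df.
Qed.

Lemma sym_le_n n m U w b f : (m <= n)%N -> sym U w b n f -> sym U w b m f.
Proof.
elim: n m b f => [|n IH] [|m] b f //= mn [H1 H2]; split => //.
by have [f' [df sf]] := H2; exists f'; split => //; exact: IH.
Qed.

Lemma sym_weight n U w w' b f (C : R) : 0 <= C -> (forall p, w p <= C * w' p) ->
  sym U w b n f -> sym U w' b n f.
Proof.
move=> C0 ww; elim: n b f => [|n IH] b f [[B B0 hB] H].
  split => //; exists (B * C); first exact: mulr_ge0.
  move=> p v Uv; rewrite (le_trans (hB p v Uv))// ler_wpM2r ?powR_ge0// -mulrA.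
  exact: ler_wpM2l.
split; last by have [f' [df sf]] := H; exists f'; split => //; exact: IH.
exists (B * C); first exact: mulr_ge0.
move=> p v Uv; rewrite (le_trans (hB p v Uv))// ler_wpM2r ?powR_ge0// -mulrA.
exact: ler_wpM2l.
Qed.

Lemma symD n U w b f g : sym U w b n f -> sym U w b n g ->
  sym U w b n (fun p v => f p v + g p v).
Proof.
elim: n b f g => [|n IH] b f g [[B B0 hB] H] [[B' B0' hB'] H'].
  split => //; exists (B + B'); first exact: addr_ge0.
  by move=> p v Uv; rewrite (le_trans (nmD _ _))// !mulrDl lerD ?hB ?hB'.
split.
  exists (B + B'); first exact: addr_ge0.
  by move=> p v Uv; rewrite (le_trans (nmD _ _))// !mulrDl lerD ?hB ?hB'.
have [f' [df sf]] := H; have [g' [dg sg]] := H'.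
exists (fun p v => f' p v + g' p v); split; last exact: IH.
by move=> p v Uv; apply: cderD; [exact: df|exact: dg].
Qed.

Lemma symZ n U w b (k : R[i]) f : sym U w b n f -> sym U w b n (fun p v => k * f p v).
Proof.
elim: n b f => [|n IH] b f [[B B0 hB] H].
  split => //; exists (nm k * B); first by rewrite mulr_ge0// nm_ge0.
  by move=> p v Uv; rewrite nmM -!mulrA ler_wpM2l ?nm_ge0// mulrA hB.
split.
  exists (nm k * B); first by rewrite mulr_ge0// nm_ge0.
  by move=> p v Uv; rewrite nmM -!mulrA ler_wpM2l ?nm_ge0// mulrA hB.
have [f' [df sf]] := H; exists (fun p v => k * f' p v); split; last exact: IH.
by move=> p v Uv; apply: cderZ; exact: df.
Qed.

Lemma sym0 n U w b : (forall p, 0 <= w p) -> sym U w b n (fun _ _ => 0).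
Proof.
move=> w0; elim: n b => [|n IH] b; (split; first by exists 0 => // p v _; rewrite nm0 !mul0r) => //.
exists (fun _ _ => 0); split; last exact: IH.
by move=> p v _; exact: cder_cst.
Qed.

Lemma sym_sum n U w b I (s : seq I) (F : I -> P -> R -> R[i]) :
  (forall p, 0 <= w p) -> (forall i, sym U w b n (F i)) ->
  open U -> sym U w b n (fun p v => \sum_(i <- s) F i p v).
Proof.
move=> w0 H oU; elim: s => [|i s IH].
  apply: (@sym_ext n U w b (fun _ _ => 0)) => //; last exact: sym0.
  by move=> p v _; rewrite big_nil.
apply: (sym_ext oU _ (symD (H i) IH)) => p v _.
by rewrite big_cons.
Qed.

Lemma symM n U w w' b b' f g : U `<=` `]0, +oo[ ->
  (forall p, 0 <= w p) -> (forall p, 0 <= w' p) ->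
  sym U w b n f -> sym U w' b' n g ->
  sym U (fun p => w p * w' p) (b + b') n (fun p v => f p v * g p v).
Proof.
move=> Upos w0 w0'.
elim: n b b' f g => [|n IH] b b' f g sf sg.
  have [B B0 hB] := sym_bound sf; have [B' B0' hB'] := sym_bound sg.
  split => //; exists (B * B'); first exact: mulr_ge0.
  move=> p v Uv; have v0 : 0 < v by have := Upos v Uv; rewrite posI.
  rewrite nmM powRD ?(gt_eqF v0) ?implybT//.
  have -> : B * B' * (w p * w' p) * (v `^ b * v `^ b') =
    (B * w p * v `^ b) * (B' * w' p * v `^ b') by ring.
  by rewrite ler_pM ?nm_ge0 ?hB ?hB'.
have [B B0 hB] := sym_bound sf; have [B' B0' hB'] := sym_bound sg.
split.
  exists (B * B'); first exact: mulr_ge0.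
  move=> p v Uv; have v0 : 0 < v by have := Upos v Uv; rewrite posI.
  rewrite nmM powRD ?(gt_eqF v0) ?implybT//.
  have -> : B * B' * (w p * w' p) * (v `^ b * v `^ b') =
    (B * w p * v `^ b) * (B' * w' p * v `^ b') by ring.
  by rewrite ler_pM ?nm_ge0 ?hB ?hB'.
have [_ [f' [df sf']]] := sf; have [_ [g' [dg sg']]] := sg.
exists (fun p v => f' p v * g p v + f p v * g' p v); split.
  by move=> p v Uv; apply: cderM; [exact: df|exact: dg].
apply: symD.
  have -> : b + b' - 1 = (b - 1) + b' by ring.
  by apply: IH => //; exact: sym_le_n sg.
rewrite -addrA; apply: IH => //; exact: sym_le_n sf.
Qed.

(** Comparing the powers at top order is enough: both exponents drop by one with each derivative,
    which only divides the inequality by v. Orders can thus be lowered on bounded sets and raised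
    away from 0. *)
Lemma sym_exponent n U w b b' f (C : R) : U `<=` `]0, +oo[ -> 0 <= C -> (forall p, 0 <= w p) ->
  (forall v, U v -> v `^ b <= C * v `^ b') -> sym U w b n f -> sym U w b' n f.
Proof.
move=> Upos C0 w0; elim: n b b' f => [|n IH] b b' f bb [[B B0 hB] H].
  split => //; exists (B * C); first exact: mulr_ge0.
  move=> p v Uv; rewrite (le_trans (hB p v Uv))//.
  have -> : B * C * w p * v `^ b' = B * w p * (C * v `^ b') by ring.
  by rewrite ler_wpM2l ?bb// mulr_ge0.
split.
  exists (B * C); first exact: mulr_ge0.
  move=> p v Uv; rewrite (le_trans (hB p v Uv))//.
  have -> : B * C * w p * v `^ b' = B * w p * (C * v `^ b') by ring.
  by rewrite ler_wpM2l ?bb// mulr_ge0.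
have [f' [df sf]] := H; exists f'; split => //; apply: IH sf => v Uv.
have v0 : 0 < v by have := Upos v Uv; rewrite posI.
by rewrite !powRD ?(gt_eqF v0) ?implybT// mulrA ler_wpM2r ?powR_ge0// bb.
Qed.

(** On the overlap the two derivatives agree by uniqueness, so they glue to a single witness. *)
Lemma sym_union n U V w b f : open U -> open V -> (forall p, 0 <= w p) ->
  sym U w b n f -> sym V w b n f -> sym (U `|` V) w b n f.
Proof.
move=> oU oV w0; elim: n b f => [|n IH] b f sU sV.
  have [B B0 hB] := sym_bound sU; have [B' B0' hB'] := sym_bound sV.
  split => //; exists (B + B'); first exact: addr_ge0.
  move=> p v [/hB h|/hB' h]; rewrite (le_trans (h p))// ler_wpM2r ?powR_ge0// ler_wpM2r//.
    by rewrite lerDl.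
  by rewrite lerDr.
have [B B0 hB] := sym_bound sU; have [B' B0' hB'] := sym_bound sV.
split.
  exists (B + B'); first exact: addr_ge0.
  move=> p v [/hB h|/hB' h]; rewrite (le_trans (h p))// ler_wpM2r ?powR_ge0// ler_wpM2r//.
    by rewrite lerDl.
  by rewrite lerDr.
have [_ [f1 [df1 sf1]]] := sU; have [_ [f2 [df2 sf2]]] := sV.
exists (fun p v => if v \in U then f1 p v else f2 p v); split.
  move=> p v UV; case: ifPn => [/set_mem Uv|/negP h]; first exact: df1.
  by apply: df2; case: UV => // Uv; case: h; exact: mem_set.
apply: IH.
  by apply: (sym_ext oU _ sf1) => p v Uv; rewrite mem_set.
apply: (sym_ext oV _ sf2) => p v Vv; case: ifP => // /set_mem Uv.
by apply: (@cder_unique _ (f p) v); [exact: df2|exact: df1].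
Qed.

Lemma sym_seq n U w b (F : nat -> P -> R -> R[i]) :
  (forall k p v, U v -> cder (F k p) v (F k.+1 p v)) ->
  (forall k, exists2 B, 0 <= B & forall p v, U v -> nm (F k p v) <= B * w p * v `^ (b - k%:R)) ->
  sym U w b n (F 0%N).
Proof.
elim: n b F => [|n IH] b F dF FB; (split; first by have := FB 0%N; rewrite subr0) => //.
exists (F 1%N); split; first exact: dF.
apply: (IH _ (fun k => F k.+1)) => [k|k]; first exact: dF.
have [B B0 hB] := FB k.+1; exists B => // p v Uv.
by rewrite (le_trans (hB p v Uv))// -addrA -opprD -[X in - (X + _)]/(1%:R) -natrD.
Qed.

(** Each derivative multiplies the coefficient by the current exponent, of size O(1 + L p), so n
    derivatives cost n further powers of 1 + L p. With p = t, the imaginary part of the Mellin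
    variable, this records polynomial growth along a vertical line. *)
Lemma sym_cpow_family n m (L : P -> R) (c s : P -> R[i]) (C C' sg : R) :
  (forall p, 0 <= L p) -> 0 <= C -> 0 <= C' -> (forall p, re (s p) = sg) ->
  (forall p, nm (c p) <= C * (1 + L p) ^+ m) -> (forall p, nm (s p) <= C' * (1 + L p)) ->
  sym `]0, +oo[ (fun p => (1 + L p) ^+ (m + n)) sg n (fun p v => c p * cpow v%:C (s p)).
Proof.
move=> L0; have L1 p : 1 <= 1 + L p by rewrite lerDl.
elim: n m c s C C' sg => [|n IH] m c s C C' sg C0 C0' rs cC sC.
  split => //; exists C => // p v; rewrite posI => v0.
  by rewrite nmM nm_cpowR// rs addn0 ler_wpM2r ?powR_ge0.
split.
  exists C => // p v; rewrite posI => v0.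
  rewrite nmM nm_cpowR// rs ler_wpM2r ?powR_ge0// (le_trans (cC p))// ler_wpM2l//.
  by rewrite ler_weXn2l// leq_addr.
exists (fun p v => c p * s p * cpow v%:C (s p - 1)); split.
  move=> p v; rewrite posI => v0; apply: cder_eq.
    by apply: cderZ; exact: cder_cpowR.
  by rewrite mulrA.
rewrite addnS -addSn; apply: (IH m.+1 (fun p => c p * s p) (fun p => s p - 1) (C * C') (C' + 1)).
- exact: mulr_ge0.
- exact: addr_ge0.
- by move=> p; rewrite cReB rs.
- move=> p; rewrite nmM exprSr mulrACA.
  by rewrite ler_pM ?nm_ge0// mulr_ge0// (le_trans ler01).
- move=> p; rewrite (le_trans (nmB _ _))// mulrDl lerD//.
  by rewrite Normc.normc1 mul1r.
Qed.

Lemma sym_cpow n (s : R[i]) : sym `]0, +oo[ (fun=> 1) (re s) n (fun _ v => cpow v%:C s).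
Proof.
have := @sym_cpow_family n 0 (fun=> 0) (fun=> 1) (fun=> s) 1 (nm s) (re s).
move=> H; apply: (@sym_ext n _ _ _ (fun _ v => 1 * cpow v%:C s)) => //.
  by move=> p v _; rewrite mul1r.
apply: (@sym_weight n _ (fun=> (1 + 0) ^+ (0 + n)) _ _ _ 1) => //.
  by move=> p; rewrite addr0 expr1n mulr1.
by apply: H => // [|p|p]; rewrite ?nm_ge0 ?addr0 ?mulr1// Normc.normc1.
Qed.

Lemma sym_cmeas n w b f p : sym `]0, +oo[ w b n.+1 f -> cmeas `]0, +oo[ (f p).
Proof.
move=> [_ [f' [df _]]]; apply: cmeas_pos => v v0; apply: cder_cont (df p v _).
by rewrite posI.
Qed.

Lemma tail_cint n w b f p (z : R[i]) (A : R) : (forall p, 0 <= w p) -> 0 < A -> 0 < re z ->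
  sym `]0, +oo[ w b n.+1 f -> cint `]A, +oo[ (fun v => f p v * Cexp (- z * v%:C)).
Proof.
move=> w0 A0 z0 sf; have [B B0 hB] := sym_bound sf.
pose q := Num.min 0 (- 2 - b); have q0 : q <= 0 by rewrite ge_min lexx.
have q2 : q <= -2 - b by rewrite ge_min lexx orbT.
have [B1 B10 hB1] := expR_le_powR z0 q0.
have bq : b + q < -1 by lra.
have [i1 _] := rint_pow_large bq A0.
have S : `]A, +oo[ `<=` `]0, +oo[.
  by move=> v /=; rewrite !in_itv/= !andbT; exact: lt_trans.
apply: (@cint_le _ _ _ (fun v => B * w p * B1 * v `^ (b + q))).
- exact: mitv.
- apply: cmeas_sub S _; first exact: mitv.
  by apply: cmeasM; [exact: sym_cmeas sf|exact: cmeas_Cexp_lin].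
- move=> v vA; have := S v vA; rewrite posI => v0.
  rewrite nmM nm_Cexp_lin powRD ?(gt_eqF v0) ?implybT//.
  have -> : B * w p * B1 * (v `^ b * v `^ q) = (B * w p * v `^ b) * (B1 * v `^ q) by ring.
  by rewrite ler_pM ?nm_ge0 ?expR_ge0 ?hB1// hB// posI.
- by apply: rintZ => //; exact: mitv.
Qed.

(** Each integration by parts lowers the order by one and gains 1 / z, until the order is below -1
    and absolute values suffice. The bound involves |z| and not re z, so it survives re z -> 0. One
    derivative more than the number of integrations by parts is asked for, to have the last
    integrand continuous. *)
Lemma sym_tail n w b f : (forall p, 0 <= w p) -> b - n%:R < -1 ->
  sym `]0, +oo[ w b n.+1 f ->
  exists2 K, 0 <= K & forall p (z : R[i]), 0 < re z ->
    nm (Cintegral `](nm z)^-1, +oo[ (fun v => f p v * Cexp (- z * v%:C)))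
      <= K * w p * (nm z)^-1 `^ (b + 1).
Proof.
move=> w0; elim: n b f => [|n IH] b f bn sf.
  have b1 : b < -1 by move: bn; rewrite subr0.
  have [B B0 hB] := sym_bound sf.
  exists (2 * (B * (4 / (- b - 1)))).
    by rewrite !mulr_ge0// invr_ge0; lra.
  move=> p z z0; have zn : 0 < nm z by rewrite (lt_le_trans z0)// (le_trans (ler_norm _))// cRe_le_nm.
  have A0 : 0 < (nm z)^-1 by rewrite invr_gt0.
  have [i1 i2] := rint_pow_large b1 A0.
  have S : `](nm z)^-1, +oo[ `<=` `]0, +oo[.
    by move=> v /=; rewrite !in_itv/= !andbT; exact: lt_trans.
  have := @nm_Cintegral _ `](nm z)^-1, +oo[ (fun v => f p v * Cexp (- z * v%:C))
    (fun v => B * w p * v `^ b) (mitv _).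
  move=> H; apply: le_trans (H _ _ _) _.
  - exact: cint_meas (tail_cint p w0 A0 z0 sf).
  - move=> v vA; have := S v vA; rewrite posI => v0.
    rewrite nmM nm_Cexp_lin -[leRHS]mulr1 ler_pM ?nm_ge0 ?expR_ge0//; first by rewrite hB// posI.
    by rewrite -expR0 ler_expR oppr_le0 mulr_ge0 ?ltW.
  - by apply: rintZ => //; exact: mitv.
  rewrite RintegralZl//.
  have -> : 2 * (B * (4 / (- b - 1))) * w p * (nm z)^-1 `^ (b + 1) =
    2 * (B * w p * (4 / (- b - 1) * (nm z)^-1 `^ (b + 1))) by ring.
  by rewrite ler_wpM2l// ler_wpM2l// mulr_ge0.
have [B B0 hB] := sym_bound sf; have [_ [f' [df sf']]] := sf.
have bn' : b - 1 - n%:R < -1 by move: bn; rewrite -natr1; lra.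
have [K K0 hK] := IH _ _ bn' sf'.
exists (K + B); first exact: addr_ge0.
move=> p z z0; have zn : 0 < nm z by rewrite (lt_le_trans z0)// (le_trans (ler_norm _))// cRe_le_nm.
set A := (nm z)^-1; have A0 : 0 < A by rewrite invr_gt0.
have mI := mitv (`]A, +oo[ : interval R).
have i1 := tail_cint p w0 A0 z0 sf; have i2 := tail_cint p w0 A0 z0 sf'.
set I := Cintegral _ _.
(* Since re z > 0 the boundary term at infinity vanishes; the one at A = 1 / |z|, divided by z, has
   the claimed size A^(b+1). *)
have E : - z * I + Cintegral `]A, +oo[ (fun v => f' p v * Cexp (- z * v%:C)) =
    0 - f p A * Cexp (- z * A%:C).
  rewrite -CintegralZ// -CintegralD//; last exact: cintZ.
  apply: (@CFTC_oy _ _ (fun v => f p v * Cexp (- z * v%:C))).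
  - move=> v vA; have v0 := lt_trans A0 vA; apply: cder_eq.
      apply: cderM; last exact: cder_Cexp_lin.
      by apply: df; rewrite posI.
    by cbv beta; ring.
  - move=> v vA; have v0 := lt_trans A0 vA.
    have c1 := cder_cont (cder_Cexp_lin (- z) v).
    have c2 : ccvg (nbhs v) (f p) (f p v) by apply: cder_cont (df p v _); rewrite posI.
    have [_ [f'' [df' _]]] := sf'.
    have c3 : ccvg (nbhs v) (f' p) (f' p v) by apply: cder_cont (df' p v _); rewrite posI.
    by apply: ccvgD; [apply: ccvgMl; exact: ccvgM|exact: ccvgM].
  - have c1 := cder_cont (cder_Cexp_lin (- z) A).
    have c2 : ccvg (nbhs A) (f p) (f p A) by apply: cder_cont (df p A _); rewrite posI.
    have [c3 c4] := ccvgM c2 c1.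
    by split; exact: cvg_at_right_filter.
  - pose q := Num.min 0 (- 1 - b); have q0 : q <= 0 by rewrite ge_min lexx.
    have q2 : b + q <= -1.
      have : q <= -1 - b by rewrite ge_min lexx orbT.
      by lra.
    have [B1 B10 hB1] := expR_le_powR z0 q0.
    apply: (ccvg0_le (g := fun v => B * w p * B1 * v^-1)).
      near=> v; have v1 : 1 < v by near: v; exact: nbhs_pinfty_gt.
      have v0 : 0 < v by exact: lt_trans v1.
      rewrite nmM nm_Cexp_lin.
      apply: (@le_trans _ _ ((B * w p * v `^ b) * (B1 * v `^ q))).
        by rewrite ler_pM ?nm_ge0 ?expR_ge0 ?hB1// hB// posI.
      have -> : (B * w p * v `^ b) * (B1 * v `^ q) = B * w p * B1 * v `^ (b + q).
        by rewrite powRD ?(gt_eqF v0) ?implybT//; ring.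
      rewrite -powR_inv1 ?(ltW v0)// ler_wpM2l ?mulr_ge0//.
      by rewrite ler_powR// ltW.
    rewrite -[X in _ --> X](mulr0 (B * w p * B1)); apply: cvgM; first exact: cvg_cst.
    apply/gtr0_cvgV0; last exact: cvg_id.
    exact: nbhs_pinfty_gt.
  - by apply: cintD => //; exact: cintZ.
have zn0 : z != 0 by rewrite -nm_gt0.
have -> : I = z^-1 * (Cintegral `]A, +oo[ (fun v => f' p v * Cexp (- z * v%:C)) +
    f p A * Cexp (- z * A%:C)).
  move: E; set J := Cintegral _ _; set k := f p A * _ => E.
  have -> : J = 0 - k + z * I by rewrite -E; ring.
  by rewrite sub0r addrAC addNr add0r mulrA mulVf// mul1r.
rewrite nmM nmV -/A.
have E1 : A `^ (b + 1) = A * A `^ b.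
  by rewrite powRD ?(gt_eqF A0) ?implybT// powRr1 ?(ltW A0)// mulrC.
rewrite E1 [leRHS]mulrCA ler_wpM2l ?(ltW A0)// (le_trans (nmD _ _))// !mulrDl lerD//.
  by have := hK p z z0; rewrite subrK.
rewrite nmM nm_Cexp_lin -[leRHS]mulr1 ler_pM ?nm_ge0 ?expR_ge0//.
  by rewrite hB// posI.
by rewrite -expR0 ler_expR oppr_le0 mulr_ge0 ?ltW.
Unshelve. all: end_near. Qed.

(** The cut at 1 / |z| is where the phase starts to turn: below it absolute values give
    |z|^(-(b+1)), using b > -1, and this is also the size of the tail. *)
Lemma sym_osc n w b f : (forall p, 0 <= w p) -> -1 < b -> b - n%:R < -1 ->
  sym `]0, +oo[ w b n.+1 f ->
  exists2 K, 0 <= K & forall p (z : R[i]), 0 < re z ->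
    nm (Cintegral `]0, +oo[ (fun v => f p v * Cexp (- z * v%:C)))
      <= K * w p * nm z `^ (- (b + 1)).
Proof.
move=> w0 b1 bn sf; have [K K0 hK] := sym_tail w0 bn sf.
have [B B0 hB] := sym_bound sf.
exists (2 * (B * (4 / (b + 1))) + K).
  by rewrite addr_ge0// !mulr_ge0// invr_ge0; lra.
move=> p z z0; have zn : 0 < nm z by rewrite (lt_le_trans z0)// (le_trans (ler_norm _))// cRe_le_nm.
have A0 : 0 < (nm z)^-1 by rewrite invr_gt0.
have -> : nm z `^ (- (b + 1)) = (nm z)^-1 `^ (b + 1).
  by rewrite powRN -[X in _ = X `^ _](powR_inv1 (ltW zn)) -powRrM mulN1r powRN.
have hB' v : 0 < v -> nm (f p v) <= B * w p * v `^ b by move=> v0; apply: hB; rewrite posI.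
have iT : cint `]0, +oo[ (fun v => f p v * Cexp (- z * v%:C)).
  by apply: (@cint_exp _ _ _ b _ _ b1 z0 hB'); exact: sym_cmeas sf.
have E : `]0, +oo[%classic = `]0, (nm z)^-1] `|` `](nm z)^-1, +oo[ :> set R.
  apply/seteqP; split => x /=; rewrite !in_itv/= !andbT.
    by move=> ->/=; case: (leP x (nm z)^-1) => h; [left|right].
  by move=> [/andP[]//|]; exact: lt_trans.
rewrite E Cintegral_setU ?mitv//; last 2 first.
- by rewrite -E.
- rewrite disj_set2E; apply/eqP/seteqP; split => x //= [].
  by rewrite !in_itv/= andbT => /andP[_ /le_lt_trans h] /h; rewrite ltxx.
have -> : (2 * (B * (4 / (b + 1))) + K) * w p * (nm z)^-1 `^ (b + 1) =
  2 * (B * (4 / (b + 1))) * w p * (nm z)^-1 `^ (b + 1) + K * w p * (nm z)^-1 `^ (b + 1) by ring.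
apply: le_trans (nmD _ _) (lerD _ (hK p z z0)).
have [i1 i2] := rint_pow_small b1 A0.
have S : `]0, (nm z)^-1] `<=` `]0, +oo[.
  by move=> v /=; rewrite !in_itv/= => /andP[->].
have := @nm_Cintegral _ `]0, (nm z)^-1] (fun v => f p v * Cexp (- z * v%:C))
    (fun v => B * w p * v `^ b) (mitv _).
move=> H; apply: le_trans (H _ _ _) _.
- exact: cint_meas (cint_sub (mitv _) (mitv _) S iT).
- move=> v /S; rewrite posI => v0.
  rewrite nmM nm_Cexp_lin -[leRHS]mulr1 ler_pM ?nm_ge0 ?expR_ge0 ?hB'//.
  by rewrite -expR0 ler_expR oppr_le0 mulr_ge0 ?ltW.
- by apply: rintZ => //; exact: mitv.
rewrite RintegralZl//.
have -> : 2 * (B * (4 / (b + 1))) * w p * (nm z)^-1 `^ (b + 1) =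
  2 * (B * w p * (4 / (b + 1) * (nm z)^-1 `^ (b + 1))) by ring.
by rewrite ler_wpM2l// ler_wpM2l// mulr_ge0.
Qed.
End SymbolClass.

(** * The main terms as Mellin-Barnes integrals *)

Section MainTerm.
Context {R : realType}.
Notation mu := (@lebesgue_measure R).
Implicit Types (z : R[i]) (v t x y tau : R).

(** Of the N + 2 powers of decay two are left after the growth (1 + |t|)^N, and (1 + |t|)^2 >= 1 +
    t^2. *)
Lemma fast_cint (f : R -> R[i]) (g : R -> R) (N : nat) (K : R) :
  cmeas setT f -> 0 <= K -> (forall t, nm (f t) <= K * g t * (1 + `|t|) ^+ N) ->
  (exists B, forall t, g t <= B * (1 + `|t|) ^- (N + 2)) ->
  exists2 G, rint setT G & forall t, nm (f t) <= G t.
Proof.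
move=> mf K0 fg [B hB]; exists (fun t => K * B * (1 + t ^+ 2)^-1).
  by apply: rintZ => //; exact: rint_atan.
have B0 : 0 <= K * B.
  have := le_trans (nm_ge0 _) (fg 0); have := hB 0.
  rewrite normr0 addr0 !expr1n invr1 !mulr1 => h1 h2.
  by apply: le_trans h2 _; rewrite ler_wpM2l.
move=> t; have p1 : 0 < 1 + `|t| by rewrite ltr_wpDr.
have D1 : 0 < 1 + t ^+ 2 by rewrite ltr_wpDr ?sqr_ge0.
apply: (le_trans (fg t)); apply: (@le_trans _ _ (K * B * (1 + `|t|) ^- 2)).
  have -> : K * B * (1 + `|t|) ^- 2 = K * (B * (1 + `|t|) ^- (N + 2)) * (1 + `|t|) ^+ N.
    by rewrite exprD invfM; field; rewrite expf_neq0 gt_eqF.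
  by rewrite ler_wpM2r ?exprn_ge0 ?(ltW p1)// ler_wpM2l.
rewrite ler_wpM2l// lef_pV2 ?posrE ?exprn_gt0//.
by rewrite sqrrD expr1n mul1r real_normK ?num_real// lerD2r lerDl mulrn_wge0.
Qed.

(** Along the sequence the imaginary part is the constant y != 0, so [Carg] keeps one branch and
    continuity of ln and acos is enough. *)
Lemma Clog_line (y : R) : y != 0 ->
  ccvg \oo (fun n => Clog (n.+1%:R^-1 +i* y)) (Clog (0 +i* y)).
Proof.
move=> y0; have zl : ccvg \oo (fun n => (n.+1%:R^-1 : R) +i* y) (0 +i* y).
  by split => /=; [exact: cvg_invS|exact: cvg_cst].
have n0 : 0 < nm (0 +i* y) by rewrite nm_gt0; apply/eqP => -[/eqP]; apply/negP.
have nl : nm ((n.+1%:R^-1 : R) +i* y) @[n --> \oo] --> nm (0 +i* y) by exact: ccvg_nm zl.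
split.
  have H : ln (nm ((n.+1%:R^-1 : R) +i* y)) @[n --> \oo] --> ln (nm (0 +i* y)).
    exact: (@continuous_cvg nat R R \oo _ _ (@ln R) _ (continuous_ln n0) nl).
  exact: H.
rewrite /Clog /= /Carg /=.
have h : n.+1%:R^-1 / nm (n.+1%:R^-1 +i* y) @[n --> \oo] --> 0 / nm (0 +i* y).
  apply: cvgM; first exact: cvg_invS.
  by apply: cvgV => //; rewrite gt_eqF.
have h2 : acos (n.+1%:R^-1 / nm (n.+1%:R^-1 +i* y)) @[n --> \oo] --> acos (0 / nm (0 +i* y)).
  apply: continuous_cvg h; rewrite mul0r; apply: continuous_acos.
  by rewrite ltrN10 ltr01.
by case: ifP => _ //; exact: cvgN.
Qed.

Variables (Psi dPsi : R -> R[i]) (alpha : R[i]) (lam tau : R).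
Hypothesis dP : forall x, 0 < x -> cder Psi x (dPsi x).
Hypothesis rP : rapid Psi.
Hypothesis rdP : rapid (fun x => x%:C * dPsi x).
Hypothesis fast : forall N, exists B, forall t, nm (mellin Psi (tau +i* t)) <= B * (1 + `|t|) ^- N.
Hypothesis lam0 : 0 < lam.
Hypothesis tau0 : 0 < tau.
Hypothesis alpha0 : 0 < re alpha.

Let u t : R[i] := tau +i* t.
Let s t : R[i] := alpha + u t / 2.
Let X v : R := lam * (2 * v) `^ (- (1 / 2)).

Definition Jint z : R[i] := Cintegral `]0, +oo[
  (fun v => cpow v%:C (alpha - 1) * Psi (lam * (2 * v) `^ (- (1 / 2))) * Cexp (- z * v%:C)).

Lemma X_gt0 v : 0 < v -> 0 < X v.
Proof. by move=> v0; rewrite mulr_gt0// powR_gt0// mulr_gt0. Qed.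

Lemma lnX v : 0 < v -> - ln (X v) = (ln 2 + ln v) / 2 - ln lam.
Proof.
move=> v0; rewrite /X lnM ?posrE ?powR_gt0 ?mulr_gt0// ln_powR lnM ?posrE//.
by field.
Qed.

Lemma reu t : re (u t / 2) = tau / 2. Proof. by rewrite cRe_half. Qed.
Lemma res t : re (s t) = re alpha + tau / 2. Proof. by rewrite cReD reu. Qed.
Lemma res_gt0 t : 0 < re (s t).
Proof. by rewrite res addr_gt0// divr_gt0. Qed.

Lemma mPsi : cmeas `]0, +oo[ Psi.
Proof. by apply: cmeas_pos => x x0; exact: cder_cont (dP x0). Qed.

Lemma cint_mellin_line : cint setT (fun t => mellin Psi (tau +i* t)).
Proof.
have mf : cmeas setT (fun t => mellin Psi (tau +i* t)).
  by apply: cmeas_line; exact: mellin_line_cont mPsi rP tau0.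
have [||G iG hG] := @fast_cint _ (fun t => nm (mellin Psi (tau +i* t))) 0 1 mf ler01.
- by move=> t; rewrite mul1r expr0 mulr1.
- exact: fast.
- exact: cint_le iG.
Qed.

(** Both sides are v^(alpha - 1) X(v)^(- u) with X(v) = lam (2 v)^(-1/2); on the right the power is
    split into modulus and phase, the form which [Cfubini] takes. *)
Lemma lineM_u v t : 0 < v ->
  cpow 2%:C (u t / 2) * cpow lam%:C (- u t) * cpow v%:C (s t - 1) =
  cpow v%:C (alpha - 1) * cpow (X v)%:C (- tau%:C) * ei (t * ((ln 2 + ln v) / 2 - ln lam)).
Proof.
move=> v0; have -> : s t - 1 = (alpha - 1) + u t / 2 by rewrite /s; ring.
rewrite [cpow v%:C (_ + _)]cpowDr.
suff H : cpow 2%:C (u t / 2) * cpow lam%:C (- u t) * cpow v%:C (u t / 2) =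
    cpow (X v)%:C (- tau%:C) * ei (t * ((ln 2 + ln v) / 2 - ln lam)).
  by rewrite -[RHS]mulrA -H mulrCA mulrA.
rewrite -lnX//.
have XE : ln (X v) = ln lam - (ln 2 + ln v) / 2.
  by apply: oppr_inj; rewrite lnX//; ring.
rewrite !cpowR ?X_gt0// /ei -!CexpD; congr Cexp.
by apply: eqC; rewrite !(cReD, cImD, cReMr, cImMr, cReN, cImN, cRe_half, cIm_half) /= XE; field.
Qed.

Lemma X_derive v : 0 < v ->
  is_derive v 1 X (lam * (- (1 / 2) * (2 * v) `^ (- (1 / 2) - 1) * 2)).
Proof.
move=> v0; have v2 : 0 < 2 * v by rewrite mulr_gt0.
have h : is_derive v 1 (fun y => 2 * y) 2 by apply: isd_eq (isdZ 2 (isdid v)) _; rewrite mulr1.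
exact: (isdZ lam (isdcomp (isd_powR (- (1 / 2)) v2) h)).
Qed.

Lemma cint_Jint z : 0 < re z -> cint `]0, +oo[ (fun v =>
  cpow v%:C (alpha - 1) * Psi (lam * (2 * v) `^ (- (1 / 2))) * Cexp (- z * v%:C)).
Proof.
move=> z0; have [B B0 hB] := rP (lexx 0).
apply: (@cint_exp _ _ B (re alpha - 1)) => //.
- apply: cmeasM; first exact: cmeas_cpow.
  apply: cmeas_pos => v v0; apply: cder_cont.
  exact: (cder_comp (v := X) (dP (X_gt0 v0)) (X_derive v0)).
- by move: alpha0; lra.
- move=> v v0; rewrite nmM nm_cpowR// cReB/= mulrC ler_wpM2r ?powR_ge0//.
  by have := hB _ (X_gt0 v0); rewrite powRr0 mulr1.
Qed.

(** After the exchange of integrals the inner one, over t, is Mellin inversion at X(v); the factor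
    X(v)^(- tau) split off from the line cancels against X(v)^tau. *)
Lemma main_term_parseval z : 0 < re z ->
  Cintegral setT (fun t => mellin Psi (u t) *
    (cpow 2%:C (u t / 2) * cpow lam%:C (- u t) * Kz z (s t))) = (2 * pi)%:C * Jint z.
Proof.
move=> z0; have mI := mitv (`]0, +oo[ : interval R).
pose k v := cpow v%:C (alpha - 1) * cpow (X v)%:C (- tau%:C) * Cexp (- z * v%:C).
have ik : cint `]0, +oo[ k.
  apply: (@cint_exp _ _ ((lam * 2 `^ (- (1 / 2))) `^ (- tau)) (re alpha - 1 + tau / 2)) => //.
  - apply: cmeasM; first exact: cmeas_cpow.
    apply: cmeas_pos => v v0; apply: cder_cont.
    exact: (cder_comp (cder_cpowR (- tau%:C) (X_gt0 v0)) (X_derive v0)).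
  - by move: alpha0 tau0; lra.
  - move=> v v0; rewrite nmM !nm_cpowR ?X_gt0// cReB cReN /=.
    have XE : X v = lam * 2 `^ (- (1 / 2)) * v `^ (- (1 / 2)).
      by rewrite /X powRM ?(ltW v0)// mulrA.
    have c0 : 0 <= lam * 2 `^ (- (1 / 2)) by rewrite mulr_ge0 ?powR_ge0// ltW.
    rewrite XE (powRM _ c0) ?powR_ge0// -(powRrM v).
    have -> : - (1 / 2) * - tau = tau / 2 by field.
    have -> : v `^ (re alpha - 1 + tau / 2) = v `^ (re alpha - 1) * v `^ (tau / 2).
      by rewrite -powRD// (gt_eqF v0) implybT.
    by rewrite mulrCA.
have mpsi : measurable_fun setT (fun v : R => (ln 2 + ln v) / 2 - ln lam).
  apply: measurable_funB => //; apply: measurable_funM => //.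
  by apply: measurable_funD => //; exact: measurable_ln.
transitivity (Cintegral setT (fun t => mellin Psi (tau +i* t) *
    Cintegral `]0, +oo[ (fun v => k v * ei (t * ((ln 2 + ln v) / 2 - ln lam))))).
  apply: eq_Cintegral => t _; congr (_ * _).
  rewrite /Kz -CintegralZ//; last by apply: cint_Kz => //; exact: res_gt0.
  by apply: eq_Cintegral => v; rewrite posI => v0; rewrite [LHS]mulrA lineM_u// /k [LHS]mulrAC.
rewrite (Cfubini mI cint_mellin_line ik mpsi).
transitivity (Cintegral `]0, +oo[ (fun v => (2 * pi)%:C *
    (cpow v%:C (alpha - 1) * Psi (X v) * Cexp (- z * v%:C)))).
  apply: eq_Cintegral => v; rewrite posI => v0.
  rewrite -lnX// (mellin_inversion tau0 (X_gt0 v0) dP rP rdP cint_mellin_line).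
  have E : cpow (X v)%:C (- tau%:C) * cpow (X v)%:C tau%:C = 1.
    by rewrite -cpowDr addNr cpow0.
  rewrite /k; set A := cpow v%:C _; set E' := Cexp _.
  have -> : A * cpow (X v)%:C (- tau%:C) * E' * ((2 * pi)%:C * (Psi (X v) * cpow (X v)%:C tau%:C))
    = (2 * pi)%:C * (A * Psi (X v) * E') * (cpow (X v)%:C (- tau%:C) * cpow (X v)%:C tau%:C) by ring.
  by rewrite E mulr1.
by rewrite CintegralZ//; exact: cint_Jint.
Qed.

Lemma Kz_line_cont z : 0 < re z -> forall t, ccvg (nbhs t) (fun t => Kz z (s t)) (Kz z (s t)).
Proof.
move=> z0; apply: (@continuous_Cintegral _ `]0, +oo[ (fun t v => cpow v%:C (s t - 1) * Cexp (- z * v%:C))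
   (fun v => nm (cpow v%:C (s 0 - 1) * Cexp (- z * v%:C)))).
- exact: mitv.
- by move=> t; apply: cmeasM; [exact: cmeas_cpow|exact: cmeas_Cexp_lin].
- move=> t v; rewrite posI => v0; apply: ccvgM; last exact: ccvg_cst.
  have E r : cpow v%:C (s r - 1) = cpow v%:C (s 0 - 1) * ei (r / 2 * ln v).
    rewrite -cpow_line//; congr cpow; apply: eqC;
    by rewrite !(cReD, cImD, cReN, cImN, cRe_half, cIm_half) /=; field.
  rewrite E; under eq_fun do rewrite E; apply: ccvgMl; apply: ccvg_ei.
  by apply: cvgM; [apply: cvgM; [exact: cvg_id|]|]; exact: cvg_cst.
- by apply: cint_nm; [exact: mitv|apply: cint_Kz => //; exact: res_gt0].
- move=> t v; rewrite posI => v0.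
  have N r : nm (cpow v%:C (s r - 1)) = v `^ (re alpha + tau / 2 - 1).
    by rewrite nm_cpowR// cReB res.
  by rewrite nmM [leRHS]nmM (N t) (N 0).
Qed.

(** The limit needs a majorant in t uniform in z. Estimating Gamma(s) and z^(-s) apart would require
    their exponential rates to be matched; instead the product K_z(s) is bounded as an oscillatory
    integral with parameter t. The result is polynomial in t, and the fast decay of the Mellin
    transform absorbs it. *)
Lemma main_term_limit y : y != 0 ->
  let f t := mellin Psi (u t) * (cpow 2%:C (u t / 2) * cpow lam%:C (- u t) *
    (cpow (0 +i* y) (- s t) * CGamma (s t))) in
  cint setT f /\ ccvg \oo (fun n => (2 * pi)%:C * Jint (n.+1%:R^-1 +i* y)) (Cintegral setT f).
Proof.
move=> y0 f; pose z n : R[i] := n.+1%:R^-1 +i* y.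
have z0 n : 0 < re (z n) by rewrite /= invr_gt0.
pose sg := re alpha + tau / 2 - 1.
have sg1 : -1 < sg by rewrite /sg; move: alpha0 tau0; lra.
(* Enough integrations by parts to bring the order [sg] below -1; the resulting growth in t has
   degree N + 1. *)
pose N := (Num.Def.archi_bound (`|sg| + 1)).+1.
have hN : sg - N%:R < -1.
  have := archi_boundP (addr_ge0 (normr_ge0 sg) ler01) => h.
  have := ler_norm sg; rewrite /N -natr1; lra.
have S : sym `]0, +oo[ (fun t => (1 + `|t|) ^+ (0 + N.+1)) sg N.+1
    (fun t v => 1 * cpow v%:C (s t - 1)).
  apply: (@sym_cpow_family _ _ _ _ (fun t : R => `|t|) (fun=> 1) (fun t => s t - 1) 1
     (nm (alpha - 1) + (tau + 1))).
  - by [].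
  - exact: ler01.
  - by rewrite addr_ge0 ?nm_ge0// addr_ge0// ltW.
  - by move=> t; rewrite cReB res.
  - by move=> t; rewrite Normc.normc1 expr0 mulr1.
  - move=> t; have -> : s t - 1 = (alpha - 1) + u t / 2 by rewrite /s; ring.
    rewrite (le_trans (nmD _ _))// mulrDl lerD ?ler_peMr ?nm_ge0 ?lerDl//.
    rewrite nm_half (le_trans (_ : _ <= nm (u t))) ?ler_pdivrMr ?ler_peMr ?nm_ge0 ?ler1n//.
    rewrite (le_trans (nm_le_ReIm _))//= gtr0_norm//.
    have := mulr_ge0 (ltW tau0) (normr_ge0 t); have := normr_ge0 t.
    by set x := `|t|; move: tau0; nra.
have [K K0 hK] := sym_osc (fun t => exprn_ge0 _ (addr_ge0 ler01 (normr_ge0 t))) sg1 hN S.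
have yz n : `|y| <= nm (z n) by have := cIm_le_nm (z n).
have hKz n t : nm (Kz (z n) (s t)) <= K * `|y| `^ (- (sg + 1)) * (1 + `|t|) ^+ N.+1.
  have -> : Kz (z n) (s t) = Cintegral `]0, +oo[ (fun v => 1 * cpow v%:C (s t - 1) * Cexp (- z n * v%:C)).
    by apply: eq_Cintegral => v _; rewrite mul1r.
  apply: le_trans (hK t _ (z0 n)) _; rewrite add0n mulrAC ler_wpM2r ?exprn_ge0 ?addr_ge0//.
  rewrite ler_wpM2l// !powRN lef_pV2 ?posrE ?powR_gt0 ?normr_gt0// ?(lt_le_trans _ (yz n)) ?normr_gt0//.
  by rewrite ge0_ler_powR ?nnegrE ?nm_ge0 ?yz//; lra.
set W := 2 `^ (tau / 2) * lam `^ (- tau).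
have W0 : 0 <= W by rewrite mulr_ge0 ?powR_ge0.
pose fn n t := mellin Psi (u t) * (cpow 2%:C (u t / 2) * cpow lam%:C (- u t) * Kz (z n) (s t)).
have fE n : (2 * pi)%:C * Jint (n.+1%:R^-1 +i* y) = Cintegral setT (fn n).
  exact/esym/(main_term_parseval (z0 n)).
have mf n : cmeas setT (fn n).
  apply: cmeas_line => t; apply: ccvgM; first exact: (mellin_line_cont mPsi rP tau0).
  apply: ccvgM; last exact: Kz_line_cont.
  have cu : ccvg (nbhs t) u (u t) by split => /=; [exact: cvg_cst|exact: cvg_id].
  have two : 0 < 2 :> R by [].
  rewrite !cpowR//; apply: ccvgM.
    under eq_fun do rewrite cpowR//; apply: ccvg_Cexp; apply: ccvgM; last exact: ccvg_cst.
    by apply: ccvgM => //; exact: ccvg_cst.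
  under eq_fun do rewrite cpowR//; apply: ccvg_Cexp; apply: ccvgM; last exact: ccvg_cst.
  exact: ccvgN.
have fB n t : nm (fn n t) <= W * (K * `|y| `^ (- (sg + 1))) * nm (mellin Psi (tau +i* t)) * (1 + `|t|) ^+ N.+1.
  rewrite /fn nmM nmM nmM !nm_cpowR// reu cReN -/W.
  have -> : W * (K * `|y| `^ (- (sg + 1))) * nm (mellin Psi (tau +i* t)) * (1 + `|t|) ^+ N.+1 =
    nm (mellin Psi (u t)) * (W * (K * `|y| `^ (- (sg + 1)) * (1 + `|t|) ^+ N.+1)).
    by rewrite /u; ring.
  by rewrite ler_wpM2l ?nm_ge0// ler_wpM2l.
have C0 : 0 <= W * (K * `|y| `^ (- (sg + 1))) by rewrite !mulr_ge0// powR_ge0.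
pose g t := W * (K * `|y| `^ (- (sg + 1))) * nm (mellin Psi (tau +i* t)) * (1 + `|t|) ^+ N.+1.
have [G iG hG] : exists2 G, rint setT G & forall t, g t <= G t.
  have [||G iG hG] := @fast_cint (fun t => (g t)%:C) (fun t => nm (mellin Psi (tau +i* t))) N.+1 _ _ C0 _ (fast (N.+1 + 2)).
  - apply: cmeasR; apply: measurable_funM.
      apply: measurable_funM => //; apply: cmeas_nm => //.
      by apply: cmeas_line; exact: mellin_line_cont mPsi rP tau0.
    by apply: measurable_funX; apply: measurable_funD => //; exact: measurable_normr.
  - by move=> t; rewrite nmR ger0_norm// mulr_ge0 ?exprn_ge0 ?addr_ge0// mulr_ge0// nm_ge0.
  - exists G => // t; have := hG t; rewrite nmR; apply: le_trans; exact: ler_norm.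
have -> : (fun n => (2 * pi)%:C * Jint (n.+1%:R^-1 +i* y)) = (fun n => Cintegral setT (fn n)).
  exact/funext.
apply: (dominated_Cintegral_cint measurableT mf _ iG).
  move=> t _; apply: ccvgMl; apply: ccvgMl.
  under eq_fun do rewrite Kz_Gamma ?z0 ?res_gt0//.
  apply: ccvgM; last exact: ccvg_cst.
  by apply: ccvg_Cexp; apply: ccvgMl; exact: Clog_line.
by move=> n t _; apply: le_trans (fB n t) (hG t).
Qed.
End MainTerm.

(** * Schwartz functions on the half-line and the functions Phi_j *)

Section SchwartzSequence.
Context {R : realType}.
Notation mu := (@lebesgue_measure R).
Implicit Types (f Phi : R -> R[i]) (x t tau : R).

Definition cD f x : R[i] :=
  derive1 (fun y => re (f y)) x +i* derive1 (fun y => im (f y)) x.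

Lemma cD_cder f x d : cder f x d -> cD f x = d.
Proof.
by move=> [[_ h1] [_ h2]]; rewrite /cD !derive1E h1 h2; case: d {h1 h2}.
Qed.

(** The Schwartz condition on ]0, +oo[ in scale-invariant form, f^(i) = O(x^(k - i)) for all k <= 0.
    In the language of symbols its stability under x d/dx is the product rule. *)
Definition schwartz_pos f : Prop :=
  forall n k, k <= 0 -> sym `]0, +oo[ (fun _ : unit => 1) k n (fun=> f).

Lemma schwartz_pos_cder f x : schwartz_pos f -> 0 < x -> cder f x (cD f x).
Proof.
move=> Gf x0; have [_ [f' [df _]]] := Gf 1%N 0 (lexx _).
have := df tt x; rewrite posI => /(_ x0) h.
by rewrite (cD_cder h).
Qed.

Lemma schwartz_pos_rapid f : schwartz_pos f -> rapid f.
Proof.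
move=> Gf k k0; have [B B0 hB] := sym_bound (Gf 0%N k k0).
by exists B => // x x0; have := hB tt x; rewrite mulr1 posI; apply.
Qed.

Lemma schwartz_pos_theta f : schwartz_pos f -> schwartz_pos (fun x => x%:C * cD f x).
Proof.
move=> Gf n k k0; have [_ [f' [df sf]]] := Gf n.+1 k k0.
have S : sym `]0, +oo[ (fun _ : unit => 1) (k - 1) n (fun=> cD f).
  apply: (sym_ext open_pos _ sf) => p x; rewrite posI => x0.
  by apply: (@cder_unique _ f x); [apply: df; rewrite posI|exact: schwartz_pos_cder].
have S1 := @sym_cpow R unit n 1.
have pos1 (p : unit) : 0 <= 1 :> R by exact: ler01.
have := symM (fun _ h => h) pos1 pos1 S1 S.
rewrite [re 1]/(1 : R) addrC subrK mulr1; apply: sym_ext; first exact: open_pos.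
move=> p x; rewrite posI => x0; rewrite cpow1//.
by apply/eqP => -[/eqP]; rewrite gt_eqF.
Qed.

Lemma schwartz_posZD f g (a b : R[i]) : schwartz_pos f -> schwartz_pos g ->
  schwartz_pos (fun x => a * f x + b * g x).
Proof.
move=> Gf Gg n k k0.
by have := symD (symZ a (Gf n k k0)) (symZ b (Gg n k k0)).
Qed.

Lemma cD_cont f x : schwartz_pos f -> 0 < x -> ccvg (nbhs x) (cD f) (cD f x).
Proof.
move=> Gf x0; have [_ [f' [df [_ [f'' [df' _]]]]]] := Gf 2%N 0 (lexx _).
have E y : 0 < y -> cD f y = f' tt y.
  by move=> y0; apply: cD_cder; have := df tt y; rewrite posI; apply.
rewrite E//; apply: (@ccvg_near _ _ _ _ _ (f' tt)).
  by near=> y; apply: E; near: y; exact: lt_nbhsr.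
by apply: cder_cont (df' tt x _); rewrite posI.
Unshelve. all: end_near. Qed.

Lemma schwartz_schwartz_pos Phi : schwartz Phi -> schwartz_pos Phi.
Proof.
move=> [[d1 b1] [d2 b2]] n k k0.
pose F (i : nat) (_ : unit) x : R[i] :=
  derive1n i (fun y => re (Phi y)) x +i* derive1n i (fun y => im (Phi y)) x.
have FE : F 0%N = (fun=> Phi).
  by apply/funext => p; apply/funext => x; rewrite /F /=; case: (Phi x).
rewrite -FE; apply: sym_seq => [i p x _|i].
  split=> /=.
    by split; [exact: d1|rewrite -derive1E].
  by split; [exact: d2|rewrite -derive1E].
have nq : 0 <= i%:R - k by rewrite subr_ge0 (le_trans k0).
have ki : k - i%:R <= 0 by rewrite -oppr_ge0 opprB.
have := archi_boundP nq; set N := Num.Def.archi_bound _ => hN.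
have [B1 hB1] := b1 0%N i; have [B2 hB2] := b2 0%N i.
have [B3 hB3] := b1 N i; have [B4 hB4] := b2 N i.
exists (`|B1| + `|B2| + `|B3| + `|B4|); first by rewrite !addr_ge0.
move=> p x; rewrite posI => x0; rewrite mulr1.
apply: le_trans (nm_le_ReIm _) _; rewrite /F /=.
(* For x <= 1 the power x^(k - i) is at least 1 and boundedness of the i-th derivative suffices; for
   x > 1 the seminorm with N > i - k is used. *)
have [x1|x1] := leP x 1.
  have : 1 <= x `^ (k - i%:R) by rewrite -[leLHS](powRr0 x) ger_powR// x0.
  have := hB1 x; have := hB2 x; rewrite expr0 !mul1r.
  set u := `|derive1n _ _ _|; set v := `|derive1n _ _ _|; set q := x `^ _ => h2 h1 q1.
  have e1 := ler_norm B1; have e2 := ler_norm B2.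
  have e3 := normr_ge0 B3; have e4 := normr_ge0 B4.
  have e5 := normr_ge0 B1; have e6 := normr_ge0 B2.
  apply: (@le_trans _ _ (`|B1| + `|B2| + `|B3| + `|B4|)); first by lra.
  by rewrite ler_peMr// !addr_ge0.
have h (u B : R) : `|x| ^+ N * u <= B -> u <= `|B| * x `^ (k - i%:R).
  rewrite gtr0_norm// -powR_mulrn ?(ltW x0)// => hu.
  have -> : u = x `^ N%:R * u * x `^ (- N%:R).
    by rewrite mulrAC -powRD ?(gt_eqF x0) ?implybT// subrr powRr0 mul1r.
  apply: (@le_trans _ _ (`|B| * x `^ (- N%:R))).
    by rewrite ler_wpM2r ?powR_ge0// (le_trans hu) ?ler_norm.
  by rewrite ler_wpM2l// ler_powR ?(ltW x1)//; move: hN; lra.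
have := h _ _ (hB3 x); have := h _ _ (hB4 x).
rewrite !mulrDl; set q := x `^ _.
have q0 : 0 <= q by exact: powR_ge0.
have e1 := mulr_ge0 (normr_ge0 B1) q0; have e2 := mulr_ge0 (normr_ge0 B2) q0.
by lra.
Qed.

(* The recursion makes the Mellin transform of Phi_ Phi j equal to
   cbinom (u / 2) j * mellin Phi u, since x * d/dx acts as multiplication by - u. *)
Fixpoint Phi_ Phi (j : nat) : R -> R[i] :=
  if j is i.+1 then
    fun x => (- (2^-1)) / i.+1%:R * (x%:C * cD (Phi_ Phi i) x) + - i%:R / i.+1%:R * Phi_ Phi i x
  else Phi.

Section sequence.
Variable Phi : R -> R[i].
Hypothesis GPhi : schwartz_pos Phi.

Lemma Phi_schwartz j : schwartz_pos (Phi_ Phi j).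
Proof.
elim: j => [|j IH] //=; apply: schwartz_posZD => //; exact: schwartz_pos_theta.
Qed.

Lemma Phi_cder j x : 0 < x -> cder (Phi_ Phi j) x (cD (Phi_ Phi j) x).
Proof. by apply: schwartz_pos_cder; exact: Phi_schwartz. Qed.

Lemma Phi_rapid j : rapid (Phi_ Phi j).
Proof. exact: schwartz_pos_rapid (Phi_schwartz j). Qed.

Lemma Phi_theta_rapid j : rapid (fun x => x%:C * cD (Phi_ Phi j) x).
Proof. exact: schwartz_pos_rapid (schwartz_pos_theta (Phi_schwartz j)). Qed.

Lemma Phi_meas j : cmeas `]0, +oo[ (Phi_ Phi j).
Proof. by apply: cmeas_pos => x x0; exact: cder_cont (Phi_cder j x0). Qed.

Lemma mellin_PhiS j (u : R[i]) : 0 < re u ->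
  mellin (Phi_ Phi j.+1) u = (u / 2 - j%:R) / j.+1%:R * mellin (Phi_ Phi j) u.
Proof.
move=> u0; have mI := mitv (`]0, +oo[ : interval R).
have h : -1 < re (u - 1) by rewrite cReB/=; lra.
have i1 := cint_mellin (Phi_meas j) (Phi_rapid j) h.
have mt : cmeas `]0, +oo[ (fun x => x%:C * cD (Phi_ Phi j) x).
  apply: cmeas_pos => x x0; apply: ccvgM; first by apply: ccvgR; exact: cvg_id.
  by apply: cD_cont => //; exact: Phi_schwartz.
have i2 := cint_mellin mt (Phi_theta_rapid j) h.
have E := mellin_theta u0 (@Phi_cder j) (fun _ => cD_cont (Phi_schwartz j))
  (Phi_rapid j) (Phi_theta_rapid j).
transitivity (- (2^-1) / j.+1%:R * mellin (fun x => x%:C * cD (Phi_ Phi j) x) u +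
  - j%:R / j.+1%:R * mellin (Phi_ Phi j) u).
  rewrite /mellin -!CintegralZ// -CintegralD//; try exact: cintZ.
  by apply: eq_Cintegral => x _ /=; rewrite [LHS]mulrDl !mulrA.
rewrite E; ring.
Qed.

Lemma mellin_Phi_binom j (u : R[i]) : 0 < re u ->
  mellin (Phi_ Phi j) u = cbinom (u / 2) j * mellin Phi u.
Proof.
move=> u0; elim: j => [|j IH]; first by rewrite /cbinom big_ord0 fact0 divr1 mul1r.
rewrite mellin_PhiS// IH /cbinom big_ord_recr /= factS natrM.
by rewrite mulrA; congr (_ * _); rewrite invfM; ring.
Qed.

(** Writing M_j for the Mellin transform of Phi_j, the relation (u / 2 - j) M_j = (j + 1) M_(j+1)
    gains a factor 1 / |t| at the price of raising j; hence the induction on [N] for all j at once.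
    The constant 4 comes from |u / 2 - j| >= |t| / 2 >= (1 + |t|) / 4 for |t| > 1. *)
Lemma mellin_Phi_fast j tau : 0 < tau ->
  forall N, exists B, forall t, nm (mellin (Phi_ Phi j) (tau +i* t)) <= B * (1 + `|t|) ^- N.
Proof.
move=> t0 N; elim: N j => [|N IH] j.
  have h : -1 < re (tau%:C - 1 : R[i]) by rewrite /=; lra.
  have iP := cint_mellin (Phi_meas j) (Phi_rapid j) h.
  exists (2 * Rintegral mu `]0, +oo[ (fun x => nm (Phi_ Phi j x * cpow x%:C (tau%:C - 1)))).
  move=> t; rewrite expr0 invr1 mulr1; apply: nm_Cintegral.
  - exact: mitv.
  - by apply: cmeasM; [exact: Phi_meas|exact: cmeas_cpow].
  - by move=> x; rewrite posI => x0; rewrite [leLHS]nmM [leRHS]nmM !nm_cpowR//= subr0.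
  - by apply: cint_nm iP; exact: mitv.
have [B hB] := IH j.+1; have [B' hB'] := IH j.
exists (4 * j.+1%:R * `|B| + 2 * `|B'|) => t.
have p1 : 0 < 1 + `|t| by rewrite ltr_wpDr.
have [t1|t1] := leP `|t| 1.
  apply: le_trans (hB' t) _.
  apply: (@le_trans _ _ (2 * `|B'| * (1 + `|t|) ^- N.+1)).
    rewrite exprS invfM mulrA ler_wpM2r ?invr_ge0 ?exprn_ge0 ?(ltW p1)//.
    rewrite ler_pdivlMr// (le_trans (ler_wpM2r _ (ler_norm _))) ?(ltW p1)//.
    by rewrite mulrC ler_wpM2r//; lra.
  by rewrite ler_wpM2r ?invr_ge0 ?exprn_ge0 ?(ltW p1)// lerDr !mulr_ge0.
have := hB t; rewrite mellin_PhiS// nmM nmM nmV nm_nat => H.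
have ul : `|t| / 2 <= nm ((tau +i* t) / 2 - j%:R).
  have := cIm_le_nm ((tau +i* t) / 2 - j%:R).
  by rewrite cImB cIm_half cIm_nat subr0 /= normrM [`|2^-1|]ger0_norm ?invr_ge0.
apply: (@le_trans _ _ (4 * j.+1%:R * `|B| * (1 + `|t|) ^- N.+1)); last first.
  by rewrite ler_wpM2r ?invr_ge0 ?exprn_ge0 ?(ltW p1)// lerDl !mulr_ge0.
move: H; set m := nm (mellin _ _); set a := nm _ => H; rewrite -/a in ul.
have m0 : 0 <= m by exact: nm_ge0.
have j0 : 0 < j.+1%:R :> R by [].
have H2 : a * m <= j.+1%:R * `|B| * (1 + `|t|) ^- N.
  have : a * m = j.+1%:R * (a / j.+1%:R * m) by field; rewrite gt_eqF.
  by move=> ->; rewrite -[leRHS]mulrA ler_wpM2l// (le_trans H)// ler_wpM2r ?ler_norm//.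
have -> : 4 * j.+1%:R * `|B| * (1 + `|t|) ^- N.+1 =
    4 * (j.+1%:R * `|B| * (1 + `|t|) ^- N) / (1 + `|t|).
  by rewrite exprS invfM; ring.
rewrite ler_pdivlMr//.
apply: (@le_trans _ _ (4 * (a * m))); last by rewrite ler_wpM2l.
have : (1 + `|t|) <= 4 * a by move: ul t1; lra.
by move=> h; rewrite [leRHS]mulrA [leLHS]mulrC ler_wpM2r.
Qed.
End sequence.
End SchwartzSequence.

(** * Taylor expansion of Phi (|C| / sqrt w) around w = 2 v *)

Section DilatedDerivatives.
Context {R : realType} {P : Type}.
Implicit Types (v w x : R).
Variables (Phi : R -> R[i]) (lam : P -> R) (kap : R).
Hypothesis GPhi : schwartz_pos Phi.
Hypothesis lam0 : forall p, 0 < lam p.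
Hypothesis kap0 : kap <= 0.

(* The j-th derivative in w of Phi (lam / sqrt w). *)
Definition gd j (p : P) w : R[i] :=
  (j`!%:R * w `^ (- j%:R))%:C * Phi_ Phi j (lam p * w `^ (- (1 / 2))).

(** By the chain rule for lam w^(-1/2), w d/dw acts on functions of x as - (1/2) x d/dx; the
    prefactor w^(-j) adds - j. The recursion of [Phi_] is exactly what makes these derivatives close
    up. *)
Lemma gd_cder j p w : 0 < w -> cder (gd j p) w (gd j.+1 p w).
Proof.
move=> w0; have r0 : 0 < lam p * w `^ (- (1 / 2)) by rewrite mulr_gt0// powR_gt0.
apply: cder_eq.
  apply: cderM.
    by apply: cderR; apply: isdZ; exact: (isd_powR (- j%:R) w0).
  exact: (cder_comp (v := fun y => lam p * y `^ (- (1 / 2))) (Phi_cder GPhi j r0)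
    (isdZ (lam p) (isd_powR (- (1 / 2)) w0))).
have E1 (a : R) : w `^ (a - 1) = w `^ a * w^-1.
  by rewrite powRD ?(gt_eqF w0) ?implybT// powR_inv1// ltW.
have E2 : w `^ (- j.+1%:R) = w `^ (- j%:R) * w^-1.
  by rewrite -E1; congr (_ `^ _); rewrite -natr1; ring.
rewrite /gd /= !E1 E2 factS natrM.
set r := lam p * _ in r0 *; set c := cD _ _; set f := Phi_ Phi j r.
have -> : lam p * (- (1 / 2) * (w `^ (- (1 / 2)) * w^-1)) = - (1 / 2) * (r * w^-1).
  by rewrite /r; ring.
set q := w `^ (- j%:R); set F := (j`!)%:R.
rewrite !(rmorphM, rmorphN, rmorphV, rmorph1, rmorph_nat) ?unitfE ?gt_eqF//= ?rmorph1.
have w1 : (w%:C : R[i]) != 0 by apply/eqP => -[/eqP]; rewrite gt_eqF.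
have j1 : (j.+1%:R : R[i]) != 0 by rewrite pnatr_eq0.
by field; apply/andP; split; [rewrite addrC natr1|exact: w1].
Qed.

(** The bound O(x^kap) is taken at x = lam w^(-1/2). Here the weight lam^kap and the gain w^(- kap /
    2) arise, uniformly in lam. *)
Lemma gd_bound j : exists2 B, 0 <= B & forall p w, `]0, +oo[%classic w ->
  nm (gd j p w) <= B * lam p `^ kap * w `^ (- (kap / 2) - j%:R).
Proof.
have [B B0 hB] := Phi_rapid GPhi j kap0.
exists (j`!%:R * B); first by rewrite mulr_ge0.
move=> p w; rewrite posI => w0.
have r0 : 0 < lam p * w `^ (- (1 / 2)) by rewrite mulr_gt0// powR_gt0.
rewrite /gd nmM nmR ger0_norm; last by rewrite mulr_ge0 ?powR_ge0.
apply: le_trans (ler_wpM2l _ (hB _ r0)) _; first by rewrite mulr_ge0 ?powR_ge0.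
rewrite powRM ?(ltW (lam0 _)) ?powR_ge0// -(powRrM w) powRD ?(gt_eqF w0) ?implybT//.
have -> : - (1 / 2) * kap = - (kap / 2) by field.
rewrite le_eqVlt; apply/orP; left; apply/eqP; ring.
Qed.
End DilatedDerivatives.

Section QuadraticTaylor.
Context {R : realType} {P : Type}.
Implicit Types (v w x : R).
Variables (G : nat -> P -> R -> R[i]) (W : P -> R) (b L : R).
Hypothesis dG : forall k p w, 0 < w -> cder (G k p) w (G k.+1 p w).
Hypothesis bG : forall k, exists2 B, 0 <= B & forall p w, `]0, +oo[%classic w ->
  nm (G k p w) <= B * W p * w `^ (b - k%:R).
Hypothesis W0 : forall p, 0 <= W p.
Hypothesis L0 : 0 < L.

(** Taylor remainder of degree J of the k-th derivative, from 2 v to 2 v + v^2. With G_i = O(w^(b -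
    i)) each further Taylor term gains v^2 / v = v. *)
Definition quad_rem J k (p : P) v : R[i] :=
  G k p (2 * v + v ^+ 2) -
  \sum_(j < J.+1) G (k + j)%N p (2 * v) * ((v ^+ 2) ^+ j / j`!%:R)%:C.

Lemma itvL v : (`]0, L[%classic v) = (0 < v < L) :> Prop.
Proof. by rewrite /= in_itv/=. Qed.

Lemma itvL_pos : `]0, L[ `<=` `]0, +oo[.
Proof. by move=> v; rewrite itvL posI => /andP[]. Qed.

Lemma open_itvL : open (`]0, L[%classic : set R).
Proof. exact: interval_open. Qed.

(** For v < L every point between 2 v and 2 v + v^2 is at most (2 + L) v, hence comparable to v; the
    two summands of [C] serve the two signs of the exponent [e]. *)
Lemma quad_rem_bound J k : exists2 B, 0 <= B & forall p v, `]0, L[%classic v ->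
  nm (quad_rem J k p v) <= B * W p * v `^ (b - k%:R + J.+1%:R).
Proof.
have [B B0 hB] := bG (k + J.+1).
pose e := b - (k + J.+1)%:R; pose C := 2 `^ e + (2 + L) `^ e.
have C0 : 0 <= C by rewrite addr_ge0 ?powR_ge0.
have hC v x : 0 < v -> v < L -> 2 * v <= x -> x <= 2 * v + v ^+ 2 -> x `^ e <= C * v `^ e.
  move=> v0 vL x1 x2.
  have x3 : x <= (2 + L) * v by apply: (le_trans x2); rewrite [leRHS]mulrDl lerD2l expr2 ler_wpM2r ?ltW.
  have [e0|e0] := leP 0 e.
    apply: (@le_trans _ _ ((2 + L) `^ e * v `^ e)).
      rewrite -powRM ?(ltW v0)//; last by rewrite addr_ge0// ltW.
      by apply: ge0_ler_powR => //; rewrite nnegrE ?mulr_ge0 ?addr_ge0 ?(ltW v0) ?(ltW L0)//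
        (le_trans _ x1)// mulr_ge0// ltW.
    by rewrite ler_wpM2r ?powR_ge0// lerDr powR_ge0.
  apply: (@le_trans _ _ (2 `^ e * v `^ e)).
    have EN y : y `^ e = (y `^ (- e))^-1 by rewrite powRN invrK.
    rewrite -powRM ?(ltW v0)// (EN x) (EN (2 * v)).
    have p2 : 0 < 2 * v by rewrite mulr_gt0.
    have px : 0 < x by exact: lt_le_trans x1.
    rewrite lef_pV2 ?posrE ?powR_gt0//.
    by apply: ge0_ler_powR => //; rewrite ?nnegrE ?(ltW p2) ?(ltW px)//; lra.
  by rewrite ler_wpM2r ?powR_ge0// lerDl powR_ge0.
exists (2 ^+ J.+1 * (B * C)); first by rewrite !mulr_ge0// exprn_ge0.
move=> p v; rewrite itvL => /andP[v0 vL].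
have v2 : 0 < 2 * v by rewrite mulr_gt0.
have vv : 0 < v ^+ 2 by rewrite exprn_gt0.
have E : 2 * v + v ^+ 2 - 2 * v = v ^+ 2 by ring.
have T := @taylor_bound R J (fun i => G (k + i)%N p) (fun i => G (k + i)%N p (2 * v))
  (2 * v) (2 * v + v ^+ 2) (B * W p * (C * v `^ e)).
have {T} := T _ _ _ (2 * v + v ^+ 2) _ _; rewrite E addn0 => T.
apply: le_trans (T _ _ _ _ _) _.
- by move=> i y _ y1 y2; rewrite addnS; apply: dG; exact: lt_trans y1.
- move=> i _; have [c1 c2] := cder_cont (dG (k + i) p v2).
  by split; exact: cvg_at_right_filter.
- move=> y y1 y2; apply: le_trans (hB p y _) _; first by rewrite posI (lt_trans v2).
  by rewrite ler_wpM2l ?hC ?(ltW y1)// mulr_ge0.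
- by rewrite ltrDl.
- by [].
have -> : (v ^+ 2) ^+ J.+1 = v `^ (2 * J.+1%:R).
  by rewrite -exprM -powR_mulrn ?(ltW v0)// natrM.
have -> : b - k%:R + J.+1%:R = e + 2 * J.+1%:R by rewrite /e natrD; ring.
rewrite [v `^ (e + _)]powRD ?(gt_eqF v0) ?implybT//.
rewrite le_eqVlt; apply/orP; left; apply/eqP; ring.
Qed.

(** The centre moves with speed 2 and the increment v^2 with speed 2 v. The sums recombine into (2 +
    2 v) times the next remainder, except for the top term j = J, absent from the sum with factor 2
    v; this leftover has order b - k + J, just what the derivative of a symbol of order b - k + J +
    1 may have. *)
Lemma quad_rem_cder J k p v : 0 < v -> cder (quad_rem J k p) v
  ((2 + 2 * v)%:C * quad_rem J k.+1 p v +
   (2 / J`!%:R)%:C * (v%:C ^+ (2 * J).+1 * G (k.+1 + J)%N p (2 * v))).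
Proof.
move=> v0; have v2 : 0 < 2 * v by rewrite mulr_gt0.
have vv : 0 < 2 * v + v ^+ 2 by rewrite addr_gt0// exprn_gt0.
have d2 : is_derive v 1 (fun v => 2 * v) 2 by apply: isd_eq (isdZ 2 (isdid v)) _; rewrite mulr1.
have dsq : is_derive v 1 (fun v => v ^+ 2) (2 * v).
  have := isd_subX 1 0 v; rewrite subr0 expr1.
  by under eq_fun do rewrite subr0.
have dpow (j : nat) : is_derive v 1 (fun v => (v ^+ 2) ^+ j.+1 / (j.+1)`!%:R)
    (2 * v * ((v ^+ 2) ^+ j / j`!%:R)).
  have h := isdcomp (u := fun y => (y - 0) ^+ j.+1) (v := fun y => y ^+ 2) (isd_subX j 0 (v ^+ 2)) dsq.
  have h2 := isdZ ((j.+1)`!%:R^-1) h.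
  have E : (fun v => (v ^+ 2) ^+ j.+1 / (j.+1)`!%:R) =
      (fun y : R => (j.+1)`!%:R^-1 * (y ^+ 2 - 0) ^+ j.+1).
    by apply/funext => y; rewrite subr0 mulrC.
  rewrite E; apply: isd_eq h2 _; rewrite subr0 factS natrM.
  by field; rewrite addrC natr1 !pnatr_eq0 -lt0n fact_gt0.
pose A i := G (k.+1 + i)%N p (2 * v) * ((v ^+ 2) ^+ i / i`!%:R)%:C.
apply: cder_eq.
  apply: cderB; first exact: (cder_comp (v := fun v => 2 * v + v ^+ 2) (dG k p vv) (isdD d2 dsq)).
  apply: (@cder_sum _ _ _ _ _ _ (fun j : 'I_J.+1 => G (k.+1 + j)%N p (2 * v) * 2%:C * ((v ^+ 2) ^+ j / j`!%:R)%:C +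
     G (k + j)%N p (2 * v) * (if (j : nat) is i.+1 then 2 * v * ((v ^+ 2) ^+ i / i`!%:R) else 0)%:C)).
  move=> j _; apply: cderM.
    by rewrite addSn; exact: (cder_comp (v := fun v => 2 * v) (dG (k + j) p v2) d2).
  apply: cderR; case: (j : nat) => [|i]; last exact: dpow.
  under eq_fun do rewrite expr0; exact: isdC.
rewrite big_split /=.
have -> : \sum_(j < J.+1) G (k.+1 + j)%N p (2 * v) * 2%:C * ((v ^+ 2) ^+ j / j`!%:R)%:C =
    2%:C * \sum_(j < J.+1) A j.
  by rewrite mulr_sumr; apply: eq_bigr => j _; rewrite /A mulrCA mulrA mulrAC.
have -> : \sum_(j < J.+1) G (k + j)%N p (2 * v) *
    (if (j : nat) is i.+1 then 2 * v * ((v ^+ 2) ^+ i / i`!%:R) else 0)%:C =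
    (2 * v)%:C * \sum_(j < J) A j.
  rewrite big_ord_recl /= mulr0 add0r mulr_sumr; apply: eq_bigr => j _.
  by rewrite /A /bump /= add1n addnS -addSn rmorphM/= mulrCA.
rewrite /quad_rem -/(A _) (big_ord_recr J)/=.
have -> : (2 / J`!%:R)%:C * (v%:C ^+ (2 * J).+1 * G (k.+1 + J)%N p (2 * v)) =
    (2 * v)%:C * A J.
  rewrite /A -exprM [RHS]mulrCA -rmorphM /= -rmorphXn /= mulrA -rmorphM/= mulrC.
  by congr (_ * _%:C); rewrite exprS; field; rewrite pnatr_eq0 -lt0n fact_gt0.
rewrite !rmorphD/=; ring.
Qed.

Lemma sym_linear n : sym `]0, L[ (fun _ : P => 1) 0 n (fun _ v => (2 + 2 * v)%:C).
Proof.
have S0 := sym_sub itvL_pos (@sym_cpow R P n 0).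
have S1 := sym_sub itvL_pos (@sym_cpow R P n 1).
have one0 (p : P) : 0 <= 1 :> R by exact: ler01.
have S1' : sym `]0, L[ (fun _ : P => 1) 0 n (fun _ v => cpow v%:C 1).
  apply: (sym_exponent itvL_pos (ltW L0) one0) S1 => v; rewrite itvL => /andP[v0 vL].
  by rewrite powRr0 mulr1 powRr1 ?(ltW v0)// ltW.
apply: sym_ext open_itvL _ (symD (symZ 2 S0) (symZ 2 S1')) => p v; rewrite itvL => /andP[v0 _].
rewrite cpow0 mulr1 cpow1; first by rewrite rmorphD rmorphM/= !natrC.
by apply/eqP => -[/eqP]; rewrite gt_eqF.
Qed.

Lemma sym_G2 n k : sym `]0, +oo[ W (b - k%:R) n (fun p v => G k p (2 * v)).
Proof.
pose F i p v := (2 ^+ i)%:C * G (k + i)%N p (2 * v).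
apply: (@sym_ext _ _ n _ W (b - k%:R) (F 0%N)); first exact: open_pos.
  by move=> p v _; rewrite /F expr0 mul1r addn0.
apply: sym_seq => [i p v|i].
  rewrite posI => v0; have v2 : 0 < 2 * v by rewrite mulr_gt0.
  have d2 : is_derive v 1 (fun v => 2 * v) 2 by apply: isd_eq (isdZ 2 (isdid v)) _; rewrite mulr1.
  apply: cder_eq; first exact: (cderZ _ (cder_comp (v := fun v => 2 * v) (dG (k + i) p v2) d2)).
  by rewrite /F addnS exprSr rmorphM/=; ring.
have [B B0 hB] := bG (k + i).
exists (2 ^+ i * (B * 2 `^ (b - (k + i)%:R))).
  by rewrite !mulr_ge0 ?exprn_ge0 ?powR_ge0.
move=> p v; rewrite posI => v0; have v2 : 0 < 2 * v by rewrite mulr_gt0.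
rewrite /F nmM nmR ger0_norm ?exprn_ge0// -!mulrA ler_wpM2l ?exprn_ge0//.
apply: le_trans (hB p _ _) _; first by rewrite posI.
rewrite powRM ?(ltW v0)//.
have -> : b - k%:R - i%:R = b - (k + i)%:R by rewrite natrD; ring.
rewrite le_eqVlt; apply/orP; left; apply/eqP; ring.
Qed.

Lemma quad_rem_sym n J k : sym `]0, L[ W (b - k%:R + J.+1%:R) n (quad_rem J k).
Proof.
have one0 (p : P) : 0 <= 1 :> R by exact: ler01.
elim: n k => [|n IH] k; (split; first exact: quad_rem_bound) => //.
exists (fun p v => (2 + 2 * v)%:C * quad_rem J k.+1 p v +
   (2 / J`!%:R)%:C * (v%:C ^+ (2 * J).+1 * G (k.+1 + J)%N p (2 * v))); split.
  by move=> p v; rewrite itvL => /andP[v0 _]; exact: quad_rem_cder.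
apply: symD.
  have S := symM itvL_pos one0 W0 (sym_linear n) (IH k.+1).
  have -> : b - k%:R + J.+1%:R - 1 = 0 + (b - k.+1%:R + J.+1%:R).
    by rewrite -(natr1 k); ring.
  by apply: (sym_weight ler01) S => p; rewrite !mul1r.
apply: symZ.
have S1 := sym_sub itvL_pos (@sym_cpow R P n (2 * J).+1%:R).
have S := symM itvL_pos one0 W0 S1 (sym_sub itvL_pos (sym_G2 n (k.+1 + J))).
have -> : b - k%:R + J.+1%:R - 1 = re ((2 * J).+1%:R : R[i]) + (b - (k.+1 + J)%:R).
  by rewrite cRe_nat natrD -(natr1 k) -(natr1 J) -(natr1 (2 * J)) natrM; ring.
have {}S : sym `]0, L[ W (re ((2 * J).+1%:R : R[i]) + (b - (k.+1 + J)%:R)) n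
    (fun p v => cpow v%:C (2 * J).+1%:R * G (k.+1 + J)%N p (2 * v)).
  by apply: (sym_weight ler01) S => p; rewrite !mul1r.
apply: sym_ext open_itvL _ S => p v; rewrite itvL => /andP[v0 _].
by rewrite cpow_nat//; apply/eqP => -[/eqP]; rewrite gt_eqF.
Qed.
End QuadraticTaylor.

(** * Expansion at the boundary points *)

Section BoundarySmooth.
Context {R : realType}.
Implicit Types (f g : R -> R[i]) (v x L B : R).

(** Encoded by right limits at 0 of all derivatives up to n, the form in which [smooth_up_to_bd]
    supplies them. *)
Fixpoint bsmooth n f : Prop :=
  (exists l, ccvg 0^'+ f l) /\
  if n is m.+1 then
    exists f', (forall v, 0 < v -> cder f v (f' v)) /\ bsmooth m f'
  else True.

Lemma bsmooth_lim n f : bsmooth n f -> exists l, ccvg 0^'+ f l.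
Proof. by case: n => [|n] []. Qed.

Lemma bsmooth_pred n f : bsmooth n.+1 f -> bsmooth n f.
Proof.
elim: n f => [|n IH] f [lf [f' [df sf]]]; split => //.
by exists f'; split => //; exact: IH.
Qed.

Lemma bsmoothD n f g : bsmooth n f -> bsmooth n g -> bsmooth n (fun v => f v + g v).
Proof.
elim: n f g => [|n IH] f g [[l fl] Hf] [[k gk] Hg]; (split; first by exists (l + k); exact: ccvgD) => //.
have [f' [df sf]] := Hf; have [g' [dg sg]] := Hg.
exists (fun v => f' v + g' v); split; last exact: IH.
by move=> v v0; apply: cderD; [exact: df|exact: dg].
Qed.

Lemma bsmoothM n f g : bsmooth n f -> bsmooth n g -> bsmooth n (fun v => f v * g v).
Proof.
elim: n f g => [|n IH] f g bf bg.
  by case: bf => [[l fl] _]; case: bg => [[k gk] _]; split => //; exists (l * k); exact: ccvgM.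
have [[l fl] [f' [df sf]]] := bf; have [[k gk] [g' [dg sg]]] := bg.
split; first by exists (l * k); exact: ccvgM.
exists (fun v => f' v * g v + f v * g' v); split.
  by move=> v v0; apply: cderM; [exact: df|exact: dg].
by apply: bsmoothD; apply: IH => //; exact: bsmooth_pred.
Qed.

Lemma bsmooth_cpow n (c z : R[i]) : bsmooth n (fun v => c * cpow (2 + v)%:C z).
Proof.
have D v c' w : -2 < v -> cder (fun v => c' * cpow (2 + v)%:C w) v (c' * w * cpow (2 + v)%:C (w - 1)).
  move=> v2; have v0 : 0 < 2 + v by lra.
  apply: cder_eq; first exact: (cderZ c' (cder_comp (v := fun v => 2 + v) (cder_cpowR w v0) (isdD (isdC 2 v) (isdid v)))).
  by rewrite add0r mulr1 mulrA.
elim: n c z => [|n IH] c z; (split; first (exists (c * cpow (2 + 0)%:C z);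
  have [|c1 c2] := cder_cont (D 0 c z _); [by lra|split; exact: cvg_at_right_filter])) => //.
exists (fun v => c * z * cpow (2 + v)%:C (z - 1)); split; last exact: IH.
by move=> v v0; apply: D; lra.
Qed.

Lemma bsmooth_seq n (F : nat -> R -> R[i]) : (forall k, exists l, ccvg 0^'+ (F k) l) ->
  (forall k v, 0 < v -> cder (F k) v (F k.+1 v)) -> bsmooth n (F 0%N).
Proof.
elim: n F => [|n IH] F lF dF; split => //.
by exists (F 1%N); split; [exact: dF|apply: (IH (fun k => F k.+1)) => k; [exact: lF|exact: dF]].
Qed.

Lemma bsmooth_bounded f L : 0 < L -> bsmooth 1 f ->
  exists2 B, 0 <= B & forall v, 0 < v < L -> nm (f v) <= B.
Proof.
move=> L0 [[l fl] [f' [df _]]].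
have nl : nm (f v) @[v --> 0^'+] --> nm l by exact: ccvg_nm fl.
have : \forall v \near 0^'+, nm (f v) < nm l + 1 by apply: (cvgr_lt _ nl); rewrite ltrDl.
move=> [e /= e0 he].
have [c0 c1] : 0 < Num.min (e / 2) (L / 2) /\ Num.min (e / 2) (L / 2) < e.
  split; first by rewrite lt_min !divr_gt0.
  by rewrite gt_min ltr_pdivrMr// ltr_pMr// ltr1n.
set d := Num.min _ _ in c0 c1.
have dL : d <= L by rewrite ge_min; apply/orP; right; lra.
have cn : {within `[d, L], continuous (fun v => nm (f v))}.
  apply: continuous_in_subspaceT => v; rewrite inE/= in_itv/= => /andP[dv _].
  exact: ccvg_nm (cder_cont (df v (lt_le_trans c0 dv))).
have [c _ hc] := EVT_max dL cn.
exists (nm l + 1 + nm (f c)); first by rewrite !addr_ge0 ?nm_ge0.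
move=> v /andP[v0 vL]; have [vd|vd] := ltP v d.
  rewrite (le_trans (ltW (he v _ v0)))//; last by rewrite lerDl nm_ge0.
  by rewrite /ball/= sub0r normrN gtr0_norm// (lt_trans vd).
have := hc v; rewrite in_itv/= vd (ltW vL) => /(_ isT) h.
by rewrite (le_trans h)// lerDr addr_ge0// nm_ge0.
Qed.

Let one (_ : unit) : R := 1.
Let one0 p : 0 <= one p. Proof. exact: ler01. Qed.

(** Derivatives bounded on ]0, L[ are O(v^b) there for every b <= 0, in particular at the decreasing
    orders which [sym] demands. *)
Lemma bsmooth_sym n f L b : 0 < L -> b <= 0 -> bsmooth n.+1 f ->
  sym `]0, L[ one b n (fun=> f).
Proof.
move=> L0; elim: n f b => [|n IH] f b b0 sf.
  have [B B0 hB] := bsmooth_bounded L0 sf; split => //.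
  exists (B / L `^ b); first by rewrite divr_ge0 ?powR_ge0.
  move=> p v; rewrite itvL => /andP[v0 vL].
  rewrite mulr1 -mulrA mulrC -[leLHS]mul1r (ler_pM ler01 (nm_ge0 _))//; last by rewrite hB ?v0.
  rewrite mulrC ler_pdivlMr ?powR_gt0// mul1r.
  rewrite -(opprK b) !(powRN _ (- b)) lef_pV2 ?posrE ?powR_gt0//.
  by apply: ge0_ler_powR; rewrite ?nnegrE ?(ltW v0) ?(ltW L0) ?(ltW vL)//; lra.
have [_ [f' [df sf']]] := sf.
have s1 : bsmooth 1 f.
  split; first exact: bsmooth_lim sf.
  by exists f'; split; [exact: df|split; [exact: (@bsmooth_lim n.+1 f' sf')|]].
have [B B0 hB] := bsmooth_bounded L0 s1.
split; last first.
  exists (fun=> f'); split; last by apply: IH => //; lra.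
  by move=> p v; rewrite itvL => /andP[v0 _]; exact: df.
exists (B / L `^ b); first by rewrite divr_ge0 ?powR_ge0.
move=> p v; rewrite itvL => /andP[v0 vL].
rewrite mulr1 -mulrA mulrC -[leLHS]mul1r (ler_pM ler01 (nm_ge0 _))//; last by rewrite hB ?v0.
rewrite mulrC ler_pdivlMr ?powR_gt0// mul1r.
rewrite -(opprK b) !(powRN _ (- b)) lef_pV2 ?posrE ?powR_gt0//.
by apply: ge0_ler_powR; rewrite ?nnegrE ?(ltW v0) ?(ltW L0) ?(ltW vL)//; lra.
Qed.

(** The expansion of f' is integrated by the mean value inequality from the limit 0 at 0+, so that
    the remainder is controlled together with its derivatives. One order of smoothness is spent per
    Taylor term. *)
Lemma bsmooth_taylor N n f L : 0 < L -> bsmooth (n + N).+1 f ->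
  exists d : nat -> R[i],
    sym `]0, L[ one N%:R n (fun _ v => f v - \sum_(k < N) d k * v%:C ^+ k).
Proof.
move=> L0; elim: N n f => [|N IH] n f sf.
  exists (fun=> 0); rewrite addn0 in sf.
  have S := bsmooth_sym L0 (lexx 0) sf.
  apply: (sym_ext (@open_itvL R L) _ S) => p v _.
  by rewrite big_ord0 subr0.
rewrite addnS in sf; have [[l fl] [f' [df sf']]] := sf.
have [d hd] := IH n f' sf'.
pose e k : R[i] := if k is i.+1 then d i / i.+1%:R else l.
exists e.
pose Rm v := f v - \sum_(k < N.+1) e k * v%:C ^+ k.
pose Rd v := f' v - \sum_(k < N) d k * v%:C ^+ k.
have dR v : 0 < v -> cder Rm v (Rd v).
  move=> v0; apply: cderB; first exact: df.
  have -> : (fun v => \sum_(k < N.+1) e k * v%:C ^+ k) =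
      (fun v => l + \sum_(k < N) d k / k.+1%:R * v%:C ^+ k.+1).
    by apply/funext => x; rewrite big_ord_recl /= expr0 mulr1.
  rewrite -[X in cder _ _ X]add0r; apply: cderD; first exact: cder_cst.
  apply: cder_sum => k _; apply: cder_eq.
    have := isd_subX k 0 v; rewrite subr0; under eq_fun do rewrite subr0.
    move=> /cderR h; apply: (@cder_ext _ (fun v => d k / k.+1%:R * (v ^+ k.+1)%:C)).
      by move=> x; rewrite rmorphXn.
    exact: cderZ h.
  have k0 : (k.+1%:R : R[i]) != 0 by rewrite pnatr_eq0.
  by rewrite rmorphM rmorphXn/= -natrC; field; rewrite addrC natr1.
have Rl : ccvg 0^'+ Rm 0.
  rewrite -(subrr l); apply: ccvgB => //.
  have -> : l = \sum_(k < N.+1) e k * 0%:C ^+ k.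
    by rewrite big_ord_recl /= expr0 mulr1 big1 ?addr0// => k _; rewrite expr0n mulr0.
  apply: ccvg_sum => k _; apply: ccvgMl.
  have h : ccvg 0^'+ (fun x : R => x%:C) (0 : R)%:C.
    by apply: ccvgR; apply: cvg_at_right_filter; exact: cvg_id.
  elim: (k : nat) => [|i IHi]; first by under eq_fun do rewrite expr0; exact: ccvg_cst.
  by rewrite exprS; under eq_fun do rewrite exprS; exact: ccvgM.
have [B B0 hB] := sym_bound hd.
have bR v : 0 < v < L -> nm (Rm v) <= 2 * B * v `^ N.+1%:R.
  move=> /andP[v0 vL].
  have := @complex_mvi R Rm Rd 0 v (B * v ^+ N) 0 v0 _ _ Rl.
  rewrite !subr0 => H; apply: le_trans (H _ _) _.
  - by move=> y y0 _; exact: dR.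
  - move=> y y0 yv; have := hB tt y; rewrite itvL y0 (lt_trans yv vL) => /(_ isT).
    move=> h; apply: le_trans h _; rewrite mulr1 powR_mulrn ?(ltW y0)// ler_wpM2l//.
    by rewrite lerXn2r ?nnegrE ?(ltW v0) ?(ltW y0)// ltW.
  by rewrite powR_mulrn ?(ltW v0)// exprSr !mulrA.
suff : sym `]0, L[ one N.+1%:R n.+1 (fun _ v => Rm v) by exact: sym_le_n.
split.
  exists (2 * B); first exact: mulr_ge0.
  by move=> p v; rewrite itvL mulr1; exact: bR.
exists (fun _ v => Rd v); split.
  by move=> p v; rewrite itvL => /andP[v0 _]; exact: dR.
by rewrite -natr1 addrK.
Qed.

(** The constant term is the limit at 0+, hence 0; dividing by v leads to the remaining ones. It
    matches Taylor coefficients with those of the assumed asymptotic expansion. *)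
Lemma coef_unique N (e : nat -> R[i]) (K : R) :
  (\forall v \near 0^'+, nm (\sum_(k < N) e k * v%:C ^+ k) <= K * v ^+ N) ->
  forall k, (k < N)%N -> e k = 0.
Proof.
have h : ccvg 0^'+ (fun x : R => x%:C) (0 : R)%:C.
  by apply: ccvgR; apply: cvg_at_right_filter; exact: cvg_id.
elim: N e => [|N IH] e // H.
have e0 : e 0%N = 0.
  have C1 : ccvg 0^'+ (fun v : R => \sum_(k < N.+1) e k * v%:C ^+ k) (e 0%N).
    have -> : e 0%N = \sum_(k < N.+1) e k * 0%:C ^+ k.
      by rewrite big_ord_recl /= expr0 mulr1 big1 ?addr0// => k _; rewrite expr0n mulr0.
    apply: ccvg_sum => k _; apply: ccvgMl.
    elim: (k : nat) => [|i IHi]; first by under eq_fun do rewrite expr0; exact: ccvg_cst.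
    by rewrite exprS; under eq_fun do rewrite exprS; exact: ccvgM.
  apply: (ccvg_unique C1); apply: ccvg0_le H _.
  have E0 : 0 = K * 0 ^+ N.+1 :> R by rewrite expr0n mulr0.
  rewrite [X in _ --> X]E0; apply: cvgM; first exact: cvg_cst.
  have C2 : (fun x : R => x ^+ N.+1) @ (0 : R) --> (0 : R) ^+ N.+1.
    have : (fun x : R => (x - 0) ^+ N.+1) @ (0 : R) --> ((0 : R) - 0) ^+ N.+1.
      exact: cont_derive (isd_subX N 0 0).
    by rewrite subr0; under eq_fun do rewrite subr0.
  by apply: cvg_at_right_filter; exact: C2.
case=> [|k]; first by rewrite e0.
rewrite ltnS; apply: (IH (fun k => e k.+1)); near=> v.
have v0 : 0 < v by near: v; exact: nbhs_right_gt.
have : nm (\sum_(k < N.+1) e k * v%:C ^+ k) <= K * v ^+ N.+1 by near: v.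
rewrite big_ord_recl e0 mul0r add0r.
have -> : \sum_(i < N) e (lift ord0 i) * v%:C ^+ lift ord0 i =
    v%:C * \sum_(i < N) e i.+1 * v%:C ^+ i.
  by rewrite mulr_sumr; apply: eq_bigr => i _; rewrite /= /bump add1n exprS mulrCA.
by rewrite nmM nmR gtr0_norm// exprS mulrCA ler_pM2l.
Unshelve. all: end_near. Qed.
End BoundarySmooth.

Section OneSide.
Context {R : realType}.
Implicit Types (v w x y z : R).
Variables (a : R[i]) (h1 : R -> R[i]) (c : nat -> R[i]) (s : bool).
Hypothesis a2 : -2 < complex.Re a.
Hypothesis ch1 : compactly_supported h1.
Hypothesis sh1 : smooth_up_to_bd h1.
Let sgn : R := (-1) ^+ s.
Hypothesis ash : has_asymp_expansion a (h_ a h1) sgn c.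

Definition Hside v : R[i] := cpow (2 + v)%:C (a / 2) * h1 (sgn * (1 + v)).

Let sgn2 : sgn ^+ 2 = 1.
Proof. by rewrite /sgn; case: s; rewrite ?expr1 ?expr0 ?sqrrN expr1n. Qed.

Let sgnN : `|sgn| = 1.
Proof. by rewrite /sgn normrX normrN1 expr1n. Qed.

Lemma h1_bsmooth n : bsmooth n (fun v => h1 (sgn * (1 + v))).
Proof.
have [s1 s2] := sh1.
pose D (k : nat) x : R[i] :=
  derive1n k (fun y => re (h1 y)) x +i* derive1n k (fun y => im (h1 y)) x.
pose F (k : nat) v : R[i] := (sgn ^+ k)%:C * D k (sgn * (1 + v)).
have E : (fun v => h1 (sgn * (1 + v))) = F 0%N.
  by apply/funext => v; rewrite /F /D /= mul1r; case: (h1 _).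
rewrite E; apply: bsmooth_seq => [k|k v v0].
  have [_ p1 m1] := s1 k; have [_ p2 m2] := s2 k.
  have [l fl] : exists l, ccvg 0^'+ (fun v => D k (sgn * (1 + v))) l.
    have Hp : (1 * (1 + v) : R) @[v --> 0^'+] --> (1 : R)^'+.
      move=> Q [e /= e0 eQ]; exists e => //= v; rewrite /ball/= sub0r normrN => ve v0.
      by apply: eQ; rewrite /ball/= mul1r ?ltrDl// opprD addrA subrr sub0r normrN.
    have Hm : (-1 * (1 + v) : R) @[v --> 0^'+] --> (-1 : R)^'-.
      move=> Q [e /= e0 eQ]; exists e => //= v; rewrite /ball/= sub0r normrN => ve v0.
      apply: eQ; rewrite /ball/= mulN1r; last by rewrite ltrN2 ltrDl.
      by rewrite opprK addrA addNr add0r.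
    rewrite /sgn; case: s.
      exists (lim (derive1n k (fun y => re (h1 y)) x @[x --> (-1 : R)^'-]) +i*
              lim (derive1n k (fun y => im (h1 y)) x @[x --> (-1 : R)^'-])).
      by rewrite expr1; split => /=; [exact: (cvg_comp _ _ Hm m1)|exact: (cvg_comp _ _ Hm m2)].
    exists (lim (derive1n k (fun y => re (h1 y)) x @[x --> (1 : R)^'+]) +i*
            lim (derive1n k (fun y => im (h1 y)) x @[x --> (1 : R)^'+])).
    by rewrite expr0; split => /=; [exact: (cvg_comp _ _ Hp p1)|exact: (cvg_comp _ _ Hp p2)].
  by exists ((sgn ^+ k)%:C * l); exact: ccvgMl.
have xv : 1 < `|sgn * (1 + v)|.
  by rewrite normrM sgnN mul1r gtr0_norm ?ltrDl// addr_gt0.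
have dsv : is_derive v 1 (fun v => sgn * (1 + v)) sgn.
  by apply: isd_eq (isdZ sgn (isdD (isdC 1 v) (isdid v))) _; rewrite add0r mulr1.
have [d1 _ _] := s1 k; have [d2 _ _] := s2 k.
have dD : cder (D k) (sgn * (1 + v)) (D k.+1 (sgn * (1 + v))).
  split=> /=.
    by split; [exact: d1|rewrite -derive1E].
  by split; [exact: d2|rewrite -derive1E].
apply: cder_eq; first exact: (cderZ _ (cder_comp (v := fun v => sgn * (1 + v)) dD dsv)).
by rewrite /F exprSr rmorphM/=; ring.
Qed.

Lemma Hside_bsmooth n : bsmooth n Hside.
Proof.
have := bsmoothM (bsmooth_cpow n 1 (a / 2)) (h1_bsmooth n).
by under eq_fun do rewrite mul1r.
Qed.

Lemma h1_support : exists2 L0, 0 < L0 & forall v, L0 <= v -> Hside v = 0.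
Proof.
have [M [_ HM]] := compact_bounded ch1.
exists (`|M| + 1); first by rewrite ltr_wpDl.
move=> v vL; rewrite /Hside.
have v0 : 0 < v by apply: lt_le_trans vL; rewrite ltr_wpDl.
suff -> : h1 (sgn * (1 + v)) = 0 by rewrite mulr0.
apply/eqP/negPn/negP => hn.
have M1 : M < `|M| + 1 by rewrite (le_lt_trans (ler_norm M))// ltrDl.
have := HM (`|M| + 1) M1 (sgn * (1 + v)) ((@subset_closure _ [set x | h1 x != 0] : _ `<=` _) _ hn).
rewrite /= normrM sgnN mul1r gtr0_norm ?addr_gt0// => h2.
by have := le_trans h2 vL; rewrite gerDr ler10.
Qed.

Lemma h_side v : 0 < v ->
  h_ a h1 (sgn * (1 + v)) = cpow v%:C (a / 2) * Hside v.
Proof.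
move=> v0; have v2 : 0 < 2 + v by rewrite addr_gt0.
rewrite /h_; have -> : `|1 - (sgn * (1 + v)) ^+ 2| = v * (2 + v).
  rewrite exprMn sgn2 mul1r.
  have -> : 1 - (1 + v) ^+ 2 = - (v * (2 + v)) by ring.
  by rewrite normrN gtr0_norm// mulr_gt0.
by rewrite cpowMR// /Hside mulrA.
Qed.

(** The expansion is read at x = - v, the side of the boundary point where |s (1 - x)| > 1; hence
    the signs (-1)^m. The common factor v^(a / 2) cancels, being nonzero. *)
Lemma Hside_expansion M' : exists K, \forall v \near 0^'+,
  nm (Hside v - \sum_(m < M'.+1) ((-1) ^+ m * c m) * v%:C ^+ m) <= K * v ^+ M'.+1.
Proof.
have [K HK] := ash M'; exists K.
have N0 : (fun v : R => - v) @ 0^'+ --> (0 : R)^'.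
  move=> Q [e /= e0 eQ]; exists e => //= v; rewrite /ball/= sub0r normrN => ve v0.
  by apply: eQ; rewrite /ball/= ?sub0r ?opprK// oppr_eq0 gt_eqF.
have := N0 _ HK; rewrite nbhs_filterE => H.
near=> v; have v0 : 0 < v by near: v; exact: nbhs_right_gt.
have : `|h_ a h1 (sgn * (1 - - v)) -
   cpow `|- v|%:C (a / 2) * \sum_(m < M'.+1) c m * (- v)%:C ^+ m|
   <= K%:C * `|cpow `|- v|%:C (a / 2) * (- v)%:C ^+ M'.+1| by near: v.
rewrite opprK normrN (gtr0_norm v0) !normrC -rmorphM/= lecR.
rewrite h_side//.
have -> : \sum_(m < M'.+1) c m * (- v)%:C ^+ m =
    \sum_(m < M'.+1) ((-1) ^+ m * c m) * v%:C ^+ m.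
  by apply: eq_bigr => m _; rewrite rmorphN/= [in LHS]exprNn [LHS]mulrA [c m * _]mulrC.
rewrite -mulrBr nmM (nmM (cpow _ _)) nmX rmorphN nmN nmR gtr0_norm// mulrCA.
by rewrite ler_pM2l// nm_gt0 cpow_neq0.
Unshelve. all: end_near. Qed.

Let dd k : R[i] := (-1) ^+ k * c k.

(** The asymptotic expansion names the coefficients but says nothing of derivatives; the Taylor
    expansion controls the derivatives but has coefficients of its own. By [coef_unique] they
    coincide. *)
Lemma Hside_taylor N n L : 0 < L -> sym `]0, L[ (fun _ : unit => 1) N%:R n
  (fun _ v => Hside v - \sum_(k < N) dd k * v%:C ^+ k).
Proof.
move=> L0; have [d hd] := bsmooth_taylor L0 (Hside_bsmooth (n + N).+1).
have h0 := hd; apply: (sym_ext (@open_itvL R L) _ h0) => p v _; congr (_ - _) => {h0}.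
case: N d hd => [|N] d hd; first by rewrite !big_ord0.
have [B B0 hB] := sym_bound hd; have [K HK] := Hside_expansion N.
have dE : forall k, (k < N.+1)%N -> d k - dd k = 0.
  apply: (@coef_unique _ _ _ (B + K)); near=> x.
  have x0 : 0 < x by near: x; exact: nbhs_right_gt.
  have xL : x < L by near: x; exact: nbhs_right_lt.
  have h2 : nm (Hside x - \sum_(k < N.+1) dd k * x%:C ^+ k) <= K * x ^+ N.+1 by near: x.
  have := hB tt x; rewrite itvL x0 xL mulr1 powR_mulrn ?(ltW x0)// => /(_ isT) h3.
  have -> : \sum_(k < N.+1) (d k - dd k) * x%:C ^+ k =
      (Hside x - \sum_(k < N.+1) dd k * x%:C ^+ k) -
      (Hside x - \sum_(k < N.+1) d k * x%:C ^+ k).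
    under eq_bigr do rewrite mulrBl.
    by rewrite sumrB; ring.
  by rewrite (le_trans (nmB _ _))// mulrDl addrC lerD.
by apply: eq_bigr => k _; congr (_ * _); apply/eqP; rewrite -subr_eq0 dE.
Unshelve. all: end_near. Qed.
End OneSide.

(** Passes from sums by total order m, as in the theorem, to sums by the Taylor degree k of H, as in
    the remainder estimate. *)
Lemma triangle_sum {V : zmodType} (M : nat) (E : nat -> nat -> V) :
  \sum_(m < M.+1) \sum_(j < m.+1) E (m - j)%N j =
  \sum_(k < M.+1) \sum_(j < (M - k).+1) E k j.
Proof.
elim: M => [|M IH]; first by rewrite !big_ord1.
rewrite big_ord_recr /= IH [RHS]big_ord_recr /= subnn big_ord1.
have -> : \sum_(j < M.+2) E (M.+1 - j)%N j = \sum_(k < M.+2) E k (M.+1 - k)%N.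
  rewrite (reindex_inj rev_ord_inj) /=; apply: eq_bigr => j _.
  by rewrite subSS subKn// -ltnS.
rewrite [X in _ + X = _]big_ord_recr /= subnn addrA; congr (_ + _).
rewrite -big_split /=; apply: eq_bigr => k _.
have kM : (k <= M)%N by rewrite -ltnS.
by rewrite subSn// [RHS]big_ord_recr /= -(subSn kM).
Qed.

(** * The contribution of one half-line *)

Lemma sym_pullback {R : realType} {P Q : Type} (h : P -> Q) (U : set R) (w : Q -> R) b n f :
  sym U w b n f -> sym U (fun p => w (h p)) b n (fun p => f (h p)).
Proof.
elim: n b f => [|n IH] b f [[B B0 hB] H]; (split; first by exists B => // p v; exact: hB) => //.
have [f' [df sf]] := H; exists (fun p => f' (h p)); split; last exact: IH.
by move=> p v; exact: df.
Qed.

Lemma sym_cast {R : realType} {P : Type} (U : set R) (w w' : P -> R) (b b' : R) n f :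
  (forall p, w p = w' p) -> b = b' -> sym U w b n f -> sym U w' b' n f.
Proof. by move=> /funext-> ->. Qed.

Section OneSideEstimate.
Context {R : realType} {P : Type}.
Implicit Types (v w x y tau : R) (z : R[i]).
Variables (H : R -> R[i]) (dd : nat -> R[i]) (Phi : R -> R[i]) (lam : P -> R) (kap : R).
Variables (r : R[i]) (M : nat).
Hypothesis HT : forall N n L, 0 < L -> sym `]0, L[ (fun _ : unit => 1) N%:R n
  (fun _ v => H v - \sum_(k < N) dd k * v%:C ^+ k).
Hypothesis HS : exists2 L, 0 < L & forall v, L <= v -> H v = 0.
Hypothesis GPhi : schwartz_pos Phi.
Hypothesis lam0 : forall p, 0 < lam p.
Hypothesis kap0 : kap <= 0.
Hypothesis r1 : -1 < re r.

Let W p : R := lam p `^ kap.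
Let b : R := - (kap / 2).
Let W0 p : 0 <= W p. Proof. exact: powR_ge0. Qed.
Let one0 (p : P) : 0 <= 1 :> R. Proof. exact: ler01. Qed.
Let dG := @gd_cder R P Phi lam GPhi lam0.
Let bG := gd_bound GPhi lam0 kap0.
Let pos_sub : `]0, +oo[ `<=` (`]0, +oo[ : set R). Proof. by []. Qed.

(** The k-th Taylor term of H times the j-th Taylor term of Phi (lam / sqrt w) at w = 2 v. It has
    order b + k + j, as v^(k + 2 j) meets a derivative of order b - j. *)
Let E k j (p : P) v : R[i] :=
  dd k * v%:C ^+ k * (gd Phi lam j p (2 * v) * ((v ^+ 2) ^+ j / j`!%:R)%:C).

Let symX n k : sym `]0, +oo[ (fun _ : P => 1) k%:R n (fun _ v => v%:C ^+ k).
Proof.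
have S := @sym_cpow R P n k%:R; rewrite cRe_nat in S.
apply: (sym_ext open_pos _ S) => p v; rewrite posI => v0.
by rewrite cpow_nat// -nm_gt0 nmR gtr0_norm.
Qed.

Let symE n k j : sym `]0, +oo[ W (b + (k + j)%:R) n (E k j).
Proof.
have S := symM pos_sub one0 W0 (symX n (k + 2 * j)) (sym_G2 dG bG n j).
have S1 := symZ (dd k / j`!%:R) S.
apply: (sym_ext open_pos (f := fun p v => dd k / j`!%:R * (v%:C ^+ (k + 2 * j) * gd Phi lam j p (2 * v)))).
  move=> p v _; rewrite /E exprD exprM rmorphM/= fmorphV/= !rmorphXn/= rmorph_nat.
  by ring.
apply: sym_cast S1 => [p|]; first by rewrite mul1r.
by rewrite (natrD _ k (2 * j)) natrM (natrD _ k j) /b; ring.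
Qed.

Let symG0 n L : 0 < L ->
  sym `]0, L[ W b n (fun p v => gd Phi lam 0 p (2 * v + v ^+ 2)).
Proof.
move=> L0; have Sq := quad_rem_sym dG bG W0 L0 n 0 0.
have Sg := sym_sub (@itvL_pos R L) (sym_G2 dG bG n 0).
have Sq1 : sym `]0, L[ W b n (quad_rem (gd Phi lam) 0 0).
  apply: (sym_exponent (@itvL_pos R L) (ltW L0) W0 _ Sq) => v; rewrite itvL => /andP[v0 vL].
  rewrite subr0 powRD; last by rewrite (gt_eqF v0) implybT.
  by rewrite powRr1 ?(ltW v0)// mulrC ler_wpM2r ?powR_ge0// ltW.
have Sg1 : sym `]0, L[ W b n (fun p v => gd Phi lam 0 p (2 * v)).
  by apply: sym_cast Sg => //; rewrite subr0.
apply: (sym_ext (@open_itvL R L) _ (symD Sq1 Sg1)) => p v _.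
by rewrite /quad_rem big_ord1 fact0 expr0 divr1 mulr1 subrK.
Qed.

Definition Fmain p v : R[i] := H v * gd Phi lam 0 p (2 * v + v ^+ 2) -
  \sum_(m < M.+1) \sum_(j < m.+1) E (m - j) j p v.

(** With the sum reordered by k, [Fmain] is H minus its Taylor polynomial, times g(2 v + v^2) where
    g = [gd Phi lam 0 p], plus the sum over k of d_k v^k times the remainder of g of degree M - k.
    Every piece has order b + M + 1. *)
Let Fmain_left n L : 0 < L -> sym `]0, L[ W (b + M.+1%:R) n Fmain.
Proof.
move=> L0.
have S1 : sym `]0, L[ W (b + M.+1%:R) n
    (fun p v => (H v - \sum_(k < M.+1) dd k * v%:C ^+ k) * gd Phi lam 0 p (2 * v + v ^+ 2)).
  have T := sym_pullback (fun _ : P => tt) (HT M.+1 n L0).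
  have := symM (@itvL_pos R L) one0 W0 T (symG0 n L0).
  by apply: sym_cast => [p|]; rewrite ?mul1r// addrC.
have S2 k : (k <= M)%N -> sym `]0, L[ W (b + M.+1%:R) n
    (fun p v => dd k * (v%:C ^+ k * quad_rem (gd Phi lam) (M - k) 0 p v)).
  move=> kM; have := symZ (dd k) (symM (@itvL_pos R L) one0 W0 (sym_sub (@itvL_pos R L) (symX n k))
    (quad_rem_sym dG bG W0 L0 n (M - k) 0)).
  apply: sym_cast => [p|]; first by rewrite mul1r.
  by rewrite -subSn// natrB ?leqW// subr0 /b; ring.
have S3 := @sym_sum R P n `]0, L[ W (b + M.+1%:R) _ (index_enum 'I_M.+1)
  (fun (k : 'I_M.+1) p v => dd k * (v%:C ^+ k * quad_rem (gd Phi lam) (M - k) 0 p v)) W0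
  (fun k => S2 k (ltn_ord k)) (@open_itvL R L).
apply: (sym_ext (@open_itvL R L) _ (symD S1 S3)) => p v _.
rewrite /Fmain (triangle_sum M (fun k j => E k j p v)).
rewrite mulrBl -addrA; congr (_ + _).
rewrite mulr_suml addrC -sumrB -sumrN; apply: eq_bigr => k _.
rewrite /quad_rem /E -mulr_sumr.
set G0 := gd _ _ 0 _ _; set S := \sum_(_ < _) _.
by ring.
Qed.

(** Beyond the support of H only the subtracted terms remain. Their orders b + m are smaller than b
    + M + 1, which is harmless away from 0, where v^(m - M - 1) <= L^(m - M - 1). *)
Let Fmain_right n L : 0 < L -> (forall v, L <= v -> H v = 0) ->
  sym `]L, +oo[ W (b + M.+1%:R) n Fmain.
Proof.
move=> L0 HL; have oL : open (`]L, +oo[%classic : set R) by exact: interval_open.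
have sL : `]L, +oo[ `<=` (`]0, +oo[ : set R).
  by move=> v /=; rewrite !in_itv/= !andbT => /(lt_trans L0).
have SE m j : (j <= m)%N -> (m <= M)%N -> sym `]L, +oo[ W (b + M.+1%:R) n (E (m - j) j).
  move=> jm mM; have S := sym_sub sL (symE n (m - j) j); rewrite subnK// in S.
  apply: (sym_exponent (C := L `^ (m%:R - M.+1%:R)) sL _ W0 _ S); first exact: powR_ge0.
  move=> v /=; rewrite in_itv/= andbT => vL; have v0 := lt_trans L0 vL.
  have -> : b + m%:R = (m%:R - M.+1%:R) + (b + M.+1%:R) by ring.
  rewrite [leLHS]powRD ?(gt_eqF v0) ?implybT// ler_wpM2r ?powR_ge0//.
  have mM0 : 0 <= M.+1%:R - m%:R :> R by rewrite subr_ge0 ler_nat leqW.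
  have -> : m%:R - M.+1%:R = - (M.+1%:R - m%:R) :> R by rewrite opprB.
  rewrite !powRN lef_pV2 ?posrE ?powR_gt0//.
  by apply: ge0_ler_powR; rewrite ?nnegrE// ltW.
have S1 (m : 'I_M.+1) : sym `]L, +oo[ W (b + M.+1%:R) n
    (fun p v => \sum_(j < m.+1) E (m - j) j p v).
  apply: (@sym_sum R P n `]L, +oo[ W (b + M.+1%:R) _ (index_enum 'I_m.+1)
    (fun (j : 'I_m.+1) p v => E (m - j) j p v)) => // j.
  by apply: SE; rewrite -ltnS.
have S2 := @sym_sum R P n `]L, +oo[ W (b + M.+1%:R) _ (index_enum 'I_M.+1)
  (fun (m : 'I_M.+1) p v => \sum_(j < m.+1) E (m - j) j p v) W0 S1 oL.
apply: (sym_ext oL _ (symZ (-1) S2)) => p v /=; rewrite in_itv/= andbT => vL.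
by rewrite /Fmain HL ?(ltW vL)// mul0r sub0r mulN1r.
Qed.

Lemma Fmain_sym n : sym `]0, +oo[ W (b + M.+1%:R) n Fmain.
Proof.
have [L L0 HL] := HS; have L1 : 0 < L + 1 by rewrite addr_gt0.
apply: (@sym_sub _ _ _ (`]0, L + 1[ `|` `]L, +oo[)).
  move=> v; rewrite posI => v0; case: (ltP v (L + 1)) => h; [left|right].
    by rewrite itvL v0.
  by rewrite /= in_itv/= andbT (lt_le_trans _ h)// ltrDl.
by apply: sym_union => //; [exact: Fmain_left|exact: Fmain_right].
Qed.

Lemma H_meas : cmeas `]0, +oo[ H.
Proof.
apply: cmeas_pos => x x0; have L0 : 0 < x + 1 by rewrite addr_gt0.
have [_ [f' [df _]]] := HT 0 1 L0.
have : cder (fun v => H v - \sum_(k < 0) dd k * v%:C ^+ k) x (f' tt x).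
  by apply: df; rewrite itvL x0 ltrDl ltr01.
have -> : (fun v => H v - \sum_(k < 0) dd k * v%:C ^+ k) = H.
  by apply/funext => v; rewrite big_ord0 subr0.
exact: cder_cont.
Qed.

Let f0 p v : R[i] := cpow v%:C r * H v * gd Phi lam 0 p (2 * v + v ^+ 2).

Let f0_meas p : cmeas `]0, +oo[ (f0 p).
Proof.
apply: cmeasM; first by apply: cmeasM; [exact: cmeas_cpow|exact: H_meas].
apply: cmeas_pos => v v0.
have d1 : is_derive v 1 (fun v : R => v ^+ 2) (2 * v).
  by have := isd_subX 1 0 v; rewrite subr0 expr1; under eq_fun do rewrite subr0.
have d2 := isdD (isdZ 2 (isdid v)) d1.
have w0 : 0 < 2 * v + v ^+ 2 by rewrite addr_gt0 ?mulr_gt0// exprn_gt0.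
exact: cder_cont (cder_comp (v := fun v => 2 * v + v ^+ 2) (dG 0 p w0) d2).
Qed.

(** With exponent 0 in [gd_bound] and H compactly supported the integrand is absolutely integrable,
    so the half-line integral makes sense on re z = 0 itself and is the limit of its
    regularisations. *)
Lemma side_cint p : cint `]0, +oo[ (f0 p).
Proof.
have [L L0 HL] := HS; have [B B0 hB] := sym_bound (HT 0 0 L0).
have [B1 B10 hB1] := gd_bound GPhi lam0 (lexx 0) 0.
have hf v : 0 < v -> v < L -> nm (f0 p v) <= B * B1 * v `^ re r.
  move=> v0 vL; have w0 : 0 < 2 * v + v ^+ 2 by rewrite addr_gt0 ?mulr_gt0// exprn_gt0.
  have h1 := hB tt v; rewrite itvL v0 vL big_ord0 subr0 powRr0 !mulr1 in h1.
  have h2 : nm (gd Phi lam 0 p (2 * v + v ^+ 2)) <= B1.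
    apply: (le_trans (hB1 p _ _)); first by rewrite posI.
    by rewrite mul0r !oppr0 addr0 !powRr0 !mulr1.
  rewrite /f0 nmM (nmM (cpow _ _)) nm_cpowR// -mulrA mulrC ler_wpM2r ?powR_ge0//.
  by rewrite ler_pM ?nm_ge0 ?h1 ?h2.
have f00 v : L <= v -> f0 p v = 0 by move=> vL; rewrite /f0 HL// mulr0 mul0r.
have K0 : 0 <= B * B1 by rewrite mulr_ge0.
have r2 : 0 <= re r + 2 by have := r1; lra.
have K1 : 0 <= L `^ (re r + 2) by rewrite powR_ge0.
apply: (@cint_pow2 _ _ (B * B1 * (1 + L `^ (re r + 2))) (re r) (-2)) => //.
- by lra.
- move=> v v0; case: (ltP v L) => vL; last by rewrite f00// nm0 !mulr_ge0 ?powR_ge0// addr_ge0.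
  rewrite (le_trans (hf v v0 vL))// ler_wpM2r ?powR_ge0// -[leLHS]mulr1 ler_wpM2l//.
  by rewrite lerDl.
- move=> v v0; case: (ltP v L) => vL; last by rewrite f00// nm0 !mulr_ge0 ?powR_ge0// addr_ge0.
  rewrite (le_trans (hf v v0 vL))// -[leRHS]mulrA ler_wpM2l//.
  have -> : v `^ re r = v `^ (re r + 2) * v `^ (-2).
    by rewrite -powRD ?(gt_eqF v0) ?implybT// addrK.
  rewrite ler_wpM2r ?powR_ge0// (@le_trans _ _ (L `^ (re r + 2)))// ?lerDr//.
  by apply: ge0_ler_powR; rewrite ?nnegrE ?(ltW v0) ?(ltW vL) ?(ltW L0).

Qed.

Definition Iside p z : R[i] := Cintegral `]0, +oo[ (fun v => f0 p v * Cexp (- z * v%:C)).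

Lemma side_cint_exp p z : 0 <= re z -> cint `]0, +oo[ (fun v => f0 p v * Cexp (- z * v%:C)).
Proof.
move=> z0; apply: (cint_le _ _ _ (cint_nm _ (side_cint p))) => //.
  by apply: cmeasM; [exact: f0_meas|exact: cmeas_Cexp_lin].
move=> v; rewrite posI => v0; rewrite nmM nm_Cexp_lin ler_piMr ?nm_ge0//.
by rewrite -expR0 ler_expR oppr_le0 mulr_ge0// ltW.
Qed.

Lemma Iside_limit p y :
  ccvg \oo (fun n => Iside p (n.+1%:R^-1 +i* y)) (Iside p (0 +i* y)).
Proof.
have zl : ccvg \oo (fun n => (n.+1%:R^-1 : R) +i* y) (0 +i* y).
  by split => /=; [exact: cvg_invS|exact: cvg_cst].
apply: (@dominated_Cintegral _ `]0, +oo[ (fun n v => f0 p v * Cexp (- (n.+1%:R^-1 +i* y) * v%:C))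
   _ (fun v => nm (f0 p v))) => //.
- by move=> n; apply: cint_meas; apply: side_cint_exp; rewrite /= invr_ge0.
- move=> v _; apply: ccvgMl; apply: ccvg_Cexp; apply: ccvgM; last exact: ccvg_cst.
  exact: ccvgN zl.
- exact: cint_nm (side_cint p).
- move=> n v; rewrite posI => v0; rewrite nmM nm_Cexp_lin ler_piMr ?nm_ge0//.
  by rewrite -expR0 ler_expR oppr_le0 mulr_ge0 ?invr_ge0// ltW.
Qed.

(** The product of (v^2)^j / j! and j! (2 v)^(-j) is v^j / 2^j; with v^(m - j) this gives v^m and
    the factor 2^(-j). *)
Let term_eq m j p v : 0 < v -> (j <= m)%N ->
  cpow v%:C r * E (m - j) j p v = dd (m - j) / 2 ^+ j *
    (cpow v%:C (m%:R + 1 + r - 1) * Phi_ Phi j (lam p * (2 * v) `^ (- (1 / 2)))).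
Proof.
move=> v0 jm; have v2 : 0 < 2 * v by rewrite mulr_gt0.
have vn : v%:C != 0 :> R[i] by rewrite -nm_gt0 nmR gtr0_norm.
have -> : m%:R + 1 + r - 1 = r + m%:R :> R[i] by ring.
rewrite [cpow v%:C (r + _)]cpowDr cpow_nat//.
have hm : v%:C ^+ m = v%:C ^+ (m - j) * v%:C ^+ j :> R[i] by rewrite -exprD subnK.
rewrite hm /E /gd powRN powR_mulrn ?(ltW v2)//.
rewrite !rmorphM/= !fmorphV/= !rmorphXn/= !rmorphM/= !rmorph_nat.
have j0 : j`!%:R != 0 :> R[i] by rewrite pnatr_eq0 -lt0n fact_gt0.
have vj : v%:C ^+ j != 0 :> R[i] by rewrite expf_neq0.
set c1 := cpow _ r; set ph := Phi_ _ _ _; set q := v%:C ^+ (m - j).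
rewrite [(2 * _) ^+ j]exprMn (exprAC _ 2 j).
have t0 : 2 ^+ j != 0 :> R[i] by rewrite expf_neq0// pnatr_eq0.
by set X := v%:C ^+ j in vj *; set T := 2 ^+ j in t0 *; field; rewrite j0 vj t0.
Qed.

Let alpha m : R[i] := m%:R + 1 + r.

Let alpha0 m : 0 < re (alpha m).
Proof.
have -> : re (alpha m) = m%:R + 1 + re r by rewrite /alpha 2!cReD cRe_nat.
by have := ler0n R m; move: r1; lra.
Qed.

Let J m j p z := Jint (Phi_ Phi j) (alpha m) (lam p) z.

Let cintJ m j p z : 0 < re z -> cint `]0, +oo[ (fun v =>
  cpow v%:C (alpha m - 1) * Phi_ Phi j (lam p * (2 * v) `^ (- (1 / 2))) * Cexp (- z * v%:C)).
Proof.
by move=> z0; exact: (cint_Jint (Phi_cder GPhi j) (Phi_rapid GPhi j) (lam0 p) (alpha0 m) z0).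
Qed.

Lemma Fmain_integral p z : 0 < re z ->
  Cintegral `]0, +oo[ (fun v => cpow v%:C r * Fmain p v * Cexp (- z * v%:C)) =
  Iside p z - \sum_(m < M.+1) \sum_(j < m.+1) dd (m - j) / 2 ^+ j * J m j p z.
Proof.
move=> z0; have mI := mitv (`]0, +oo[ : interval R).
pose g m j v := dd (m - j) / 2 ^+ j *
  (cpow v%:C (alpha m - 1) * Phi_ Phi j (lam p * (2 * v) `^ (- (1 / 2))) * Cexp (- z * v%:C)).
have ig m j : cint `]0, +oo[ (g m j) by exact/cintZ/cintJ.
have ig1 (m : nat) : cint `]0, +oo[ (fun v => \sum_(j < m.+1) g m j v).
  by apply: cint_sum => // j _; exact: ig.
have -> : \sum_(m < M.+1) \sum_(j < m.+1) dd (m - j) / 2 ^+ j * J m j p z =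
    Cintegral `]0, +oo[ (fun v => \sum_(m < M.+1) \sum_(j < m.+1) g m j v).
  rewrite Cintegral_sum//; apply: eq_bigr => m _.
  rewrite Cintegral_sum//; apply: eq_bigr => j _.
  by rewrite CintegralZ//; exact: cintJ.
rewrite /Iside -CintegralB//; [|exact: side_cint_exp (ltW z0)|exact: cint_sum].
apply: eq_Cintegral => v; rewrite posI => v0.
have D (x1 x2 x3 x4 x5 : R[i]) : x1 * (x2 * x3 - x4) * x5 = x1 * x2 * x3 * x5 - x1 * x4 * x5.
  by ring.
rewrite /Fmain /f0 D; congr (_ - _).
rewrite mulr_sumr mulr_suml; apply: eq_bigr => m _.
rewrite mulr_sumr mulr_suml; apply: eq_bigr => j _.
have jm : (j <= m)%N by rewrite -ltnS.
by rewrite term_eq// /g [RHS]mulrA.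
Qed.

(** The Mellin-Barnes form of 2 pi times [Jint] in the limit z -> i y, with Gamma(s) (i y)^(-s) in
    place of [Kz z s]. *)
Definition Tmain tau m j p y : R[i] := Cintegral setT (fun t =>
  mellin (Phi_ Phi j) (tau +i* t) *
  (cpow 2%:C ((tau +i* t) / 2) * cpow (lam p)%:C (- (tau +i* t)) *
   (cpow (0 +i* y) (- (m%:R + 1 + r + (tau +i* t) / 2)) *
    CGamma (m%:R + 1 + r + (tau +i* t) / 2)))).

Let Tint tau m j p y t : R[i] :=
  mellin (Phi_ Phi j) (tau +i* t) *
  (cpow 2%:C ((tau +i* t) / 2) * cpow (lam p)%:C (- (tau +i* t)) *
   (cpow (0 +i* y) (- (m%:R + 1 + r + (tau +i* t) / 2)) *
    CGamma (m%:R + 1 + r + (tau +i* t) / 2))).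

Lemma J_limit tau m j p y : 0 < tau -> y != 0 -> cint setT (Tint tau m j p y) /\
  ccvg \oo (fun n => J m j p (n.+1%:R^-1 +i* y)) ((2 * pi)%:C^-1 * Tmain tau m j p y).
Proof.
move=> tau0 y0.
have [iT ml] := main_term_limit (Phi_cder GPhi j) (Phi_rapid GPhi j) (Phi_theta_rapid GPhi j)
  (mellin_Phi_fast GPhi j tau0) (lam0 p) tau0 (alpha0 m) y0.
split; first exact: iT.
have p0 : (2 * pi)%:C != 0 :> R[i] by rewrite -nm_gt0 nmR gtr0_norm ?mulr_gt0 ?pi_gt0.
apply: (ccvg_near _ (ccvgMl (2 * pi)%:C^-1 ml)); apply: nearW => n.
by rewrite mulrA mulVf// mul1r.
Qed.

Lemma one_side_estimate : exists2 K, 0 <= K & forall p y tau, y != 0 -> 0 < tau ->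
  nm (Iside p (0 +i* y) - \sum_(m < M.+1) \sum_(j < m.+1)
        dd (m - j) / 2 ^+ j * ((2 * pi)%:C^-1 * Tmain tau m j p y))
  <= K * W p * `|y| `^ (- (re r + (b + M.+1%:R) + 1)).
Proof.
pose be := re r + (b + M.+1%:R).
have b0 : 0 <= b by rewrite /b oppr_ge0 pmulr_lle0.
have be1 : -1 < be by rewrite /be; have := ler0n R M.+1; move: r1 b0; lra.
(* Enough integrations by parts to bring the order [be] of v^r times [Fmain] below -1. *)
pose n := Num.Def.archi_bound (be + 1).
have bn : be - n%:R < -1.
  by have := archi_boundP (_ : 0 <= be + 1); rewrite -/n; move: be1; lra.
have S := symM pos_sub one0 W0 (@sym_cpow R P n.+1 r) (Fmain_sym n.+1).
have w0 p : 0 <= 1 * W p by rewrite mul1r.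
have [K K0 hK] := sym_osc w0 be1 bn S.
exists K => // p y tau y0 tau0.
pose z n : R[i] := n.+1%:R^-1 +i* y.
have z0 k : 0 < re (z k) by rewrite /= invr_gt0.
have lim : ccvg \oo (fun k => Iside p (z k) - \sum_(m < M.+1) \sum_(j < m.+1)
      dd (m - j) / 2 ^+ j * J m j p (z k))
    (Iside p (0 +i* y) - \sum_(m < M.+1) \sum_(j < m.+1)
      dd (m - j) / 2 ^+ j * ((2 * pi)%:C^-1 * Tmain tau m j p y)).
  apply: ccvgB; first exact: Iside_limit.
  by do 2!(apply: ccvg_sum => ? _); apply: ccvgMl; exact: (J_limit _ _ _ tau0 y0).2.
set A := Iside p (0 +i* y) - _ in lim *; set B := K * _ * _.
set F := (fun k : nat => _) in lim.
have nl : nm (F k) @[k --> \oo] --> nm A by exact: ccvg_nm lim.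
have Bl : (B : R) @[_ --> \oo] --> B by exact: cvg_cst.
apply: (@ler_cvg_to nat \oo _ R _ _ _ _ nl Bl); near=> k; rewrite /F /B.
rewrite -Fmain_integral// (le_trans (hK p (z k) (z0 k)))// mul1r ler_wpM2l ?mulr_ge0//.
(* Since |z_k| >= |y| and the exponent is negative, the bound at z_k is at most the one at i y, for
   every k. *)
rewrite !powRN lef_pV2 ?posrE ?powR_gt0 ?normr_gt0 ?nm_gt0//; last first.
  by apply/eqP => zE; have := z0 k; rewrite zE ltxx.
have be0 : 0 <= be + 1 by move: be1; lra.
by apply: ge0_ler_powR; rewrite ?nnegrE ?nm_ge0//; exact: (cIm_le_nm (z k)).
Unshelve. all: end_near. Qed.
End OneSideEstimate.

(** * Assembly: both half-lines, powers of real numbers, and the theorem *)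

Section Outside.
Context {R : realType}.
Notation mu := (@lebesgue_measure R).
Implicit Types (v x y C D tau : R) (s : bool).

Let hs s : measurableTypeR R -> measurableTypeR R := fun x => -1 + (-1) ^+ s * x.

Let mhs s : measurable_fun setT (hs s).
Proof. by apply: measurable_funD => //; exact: measurable_funM. Qed.

Let hsp s (A : set (measurableTypeR R)) : measurable A -> pushforward mu (hs s) A = mu A.
Proof.
move=> mA; rewrite -(lebesgue_measure_shift (-1) mA).
have mB : measurable ((fun x : measurableTypeR R => (-1 + x : measurableTypeR R)) @^-1` A).
  by rewrite -[_ @^-1` _]setTI; apply: measurable_funD.
case: s; rewrite /hs.
  rewrite -[RHS](lebesgue_measureN mB); congr (mu _).
  by apply/seteqP; split => x /=; rewrite expr1 mulN1r.
by congr (mu _); apply/seteqP; split => x /=; rewrite expr0 mul1r.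
Qed.

Lemma sgnK s x : (-1) ^+ s * ((-1) ^+ s * x) = x.
Proof. by rewrite mulrA -expr2 sqrr_sign mul1r. Qed.

(** The substitution x = s (1 + v) is inverted by x |-> -1 + s x, which preserves Lebesgue measure
    and pulls ]0, +oo[ back to the half-line of sign s. Integrability of the two pieces is what
    allows the integral over the union to be split. *)
Lemma Cintegral_outside (F : R -> R[i]) (g : bool -> R -> R[i]) :
  (forall s, cint `]0, +oo[ (g s)) ->
  (forall s v, 0 < v -> F ((-1) ^+ s * (1 + v)) = g s v) ->
  Cintegral [set x : R | 1 < `|x|] F = \sum_(s : bool) Cintegral `]0, +oo[ (g s).
Proof.
move=> ig Fg; have mI := mitv (`]0, +oo[ : interval R).
pose D s := hs s @^-1` `]0, +oo[.
have mD s : measurable (D s) by rewrite -[D s]setTI; apply: mhs.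
have DE s x : D s x = (1 < (-1) ^+ s * x) :> Prop.
  by rewrite /D /= /hs in_itv/= andbT addrC subr_gt0.
have FE s x : D s x -> g s (hs s x) = F x.
  rewrite DE => x1; have h0 : 0 < hs s x by rewrite /hs addrC subr_gt0.
  by rewrite -Fg//; congr F; rewrite /hs addrA subrr add0r sgnK.
have iF s : cint (D s) F.
  exact: cint_eq (mD s) (FE s) (cint_pres (mhs s) (@hsp s) mI (ig s)).
have DD : D true `&` D false = set0.
  by apply/seteqP; split => // x []; rewrite !DE expr1 expr0; lra.
have U : [set x : R | 1 < `|x|] = D true `|` D false.
  apply/seteqP; split => x; rewrite /= !DE expr1 expr0 mul1r mulN1r ltr_normr.
    by case/orP; [right|left].
  by case=> ->; rewrite ?orbT.
have iU : cint (D true `|` D false) F.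
  have iG := cint_sub measurableT (measurableU _ _ (mD true) (mD false)) (@subsetT _ _)
    (cintD measurableT (cint_mkcond (mD true) (iF true)) (cint_mkcond (mD false) (iF false))).
  apply: cint_eq iG; first exact: measurableU.
  move=> x; rewrite !indicE => -[] Dx.
    rewrite mem_set// memNset ?mul0r ?addr0 ?mul1r// => Dx'.
    by have : (D true `&` D false) x by []; rewrite DD.
  rewrite addrC mem_set// memNset ?mul0r ?addr0 ?mul1r// => Dx'.
  by have : (D true `&` D false) x by []; rewrite DD.
rewrite U Cintegral_setU//; last exact/disj_set2P.
rewrite big_bool /=; congr (_ + _).
  by rewrite -(eq_Cintegral (FE true)) (Cintegral_pres (mhs true) (@hsp true) mI (cint_meas (ig true))).
by rewrite -(eq_Cintegral (FE false)) (Cintegral_pres (mhs false) (@hsp false) mI (cint_meas (ig false))).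
Qed.

(** A negative C samples Phi on the negative axis, invisible to the Mellin transform over ]0, +oo[;
    evenness moves the argument back to |C|. *)
Lemma Phi_side {P : Type} (lam : P -> R) p (Phi : R -> R[i]) C s v : 0 < v -> lam p = `|C| ->
  (C < 0 -> forall x : R, Phi (- x) = Phi x) ->
  Phi (C / Num.sqrt (((-1) ^+ s * (1 + v)) ^+ 2 - 1)) = gd Phi lam 0 p (2 * v + v ^+ 2).
Proof.
move=> v0 lp even.
have -> : ((-1) ^+ s * (1 + v)) ^+ 2 - 1 = 2 * v + v ^+ 2.
  by rewrite exprMn sqrr_sign mul1r; ring.
have w0 : 0 <= 2 * v + v ^+ 2 by rewrite addr_ge0 ?mulr_ge0 ?sqr_ge0 ?(ltW v0).
rewrite /gd fact0 oppr0 powRr0 mulr1 div1r mul1r /= lp powRN powR12_sqrt//.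
case: (ltP C 0) => C0; last by rewrite ger0_norm.
by rewrite -(even C0) ltr0_norm// mulNr.
Qed.

Lemma imagE y : 0 +i* y = y%:C * 'i%C :> R[i].
Proof. by apply: eqC; rewrite ?cReMl ?cImMl /= ?mulr0 ?mulr1. Qed.

Lemma e_side D s v : e_ ((-1) ^+ s * (1 + v) * D) =
  e_ ((-1) ^+ s * D) * Cexp (- (0 +i* (- (2 * pi * ((-1) ^+ s * D)))) * v%:C) :> R[i].
Proof.
rewrite /e_ -CexpD (imagE (- _)); congr Cexp.
rewrite !(rmorphM, rmorphN, rmorphD, rmorph1, rmorph_nat) /=.
by ring.
Qed.
End Outside.

Section PowersOfReals.
Context {R : realType}.
Implicit Types (x y C D : R) (w : R[i]).

Lemma ClogI y : y != 0 -> Clog (0 +i* y) = ln `|y| +i* (if 0 <= y then pi / 2 else - (pi / 2)).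
Proof.
move=> y0; have nE : nm (0 +i* y) = `|y| by rewrite nmE /= expr0n add0r sqrtr_sqr.
by rewrite /Clog /Carg nE /= mul0r acos0.
Qed.

(** No branch is crossed: the argument pi / 2 of i / (2 pi), minus the argument 0 or pi of D, is the
    opposite of the principal argument of - 2 pi i D in either case. *)
Lemma cpow_imag D w : D != 0 ->
  cpow ('i%C / (2 * pi%:C)) w * cpow D%:C (- w) = cpow (0 +i* (- (2 * pi * D))) (- w).
Proof.
move=> D0; have p2 : 0 < 2 * pi :> R by rewrite mulr_gt0 ?pi_gt0.
have -> : 'i%C / (2 * pi%:C) = 0 +i* (2 * pi)^-1 :> R[i].
  by rewrite (imagE _^-1) fmorphV/= rmorphM rmorph_nat mulrC.
have y0 : - (2 * pi * D) != 0 by rewrite oppr_eq0 mulf_neq0// gt_eqF.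
rewrite /cpow -CexpD; congr Cexp.
rewrite !ClogI ?invr_neq0 ?(gt_eqF p2)//.
rewrite invr_ge0 (ltW p2) normrN normrM normfV (gtr0_norm p2) oppr_ge0 pmulr_rle0//.
have lm : ln (2 * pi * `|D|) = ln (2 * pi) + ln `|D| by rewrite [LHS]lnM ?posrE ?normr_gt0.
rewrite lnV ?posrE// lm.
rewrite mulNr mulNr -mulrBr -mulrN; congr (_ * _).
case: (ltgtP D 0) D0 => // D0 _.
  by rewrite ClogRN// ltr0_norm//; apply: eqC => /=; field.
by rewrite ClogR// gtr0_norm//; apply: eqC => /=; field.
Qed.

(** As C^2 > 0, the principal argument of D is unchanged and the logarithms add. *)
Lemma cpow_sqr_mul C D w : C != 0 -> D != 0 ->
  cpow (D * C ^+ 2)%:C w = cpow `|C|%:C (2 * w) * cpow D%:C w.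
Proof.
move=> C0 D0; have c0 : 0 < `|C| by rewrite normr_gt0.
rewrite -(real_normK (num_real C)) (cpowR _ c0) /cpow -CexpD; congr Cexp.
suff -> : Clog (D * `|C| ^+ 2)%:C = (ln `|C| *+ 2)%:C + Clog D%:C.
  by rewrite rmorphMn/= -mulr_natl; ring.
have l2 : ln (`|C| ^+ 2) = ln `|C| *+ 2 by rewrite lnXn.
case: (ltgtP D 0) D0 => // D0 _.
  rewrite !ClogRN// ?pmulr_llt0 ?exprn_gt0// -mulNr lnM ?posrE ?oppr_gt0 ?exprn_gt0// l2.
  by apply: eqC => /=; ring.
rewrite !ClogR// ?mulr_gt0 ?exprn_gt0// lnM ?posrE ?exprn_gt0// l2.
by rewrite rmorphD/= addrC.
Qed.

(** For D < 0 the argument is pi and |D^w| = |D|^(re w) e^(- pi im w). The bound covers both signs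
    and, for complex [a], costs the error term only a constant factor. *)
Lemma nm_cpow_real_ge D w : D != 0 ->
  expR (- (`|im w| * pi)) * `|D| `^ re w <= nm (cpow D%:C w).
Proof.
move=> D0; have P0 := @pi_ge0 R.
case: (ltgtP D 0) D0 => // D0 _; last first.
  rewrite nm_cpowR// (gtr0_norm D0) ler_piMl ?powR_ge0//.
  by rewrite -expR0 ler_expR oppr_le0 mulr_ge0.
rewrite /cpow ClogRN// nm_Cexp (ltr0_norm D0) /powR oppr_eq0 lt_eqF// -expRD ler_expR.
by rewrite cReM /= addrC lerD2l lerN2 ler_wpM2r// ler_norm.
Qed.
End PowersOfReals.

Section MainTermIdentity.
Context {R : realType} {P : Type}.
Implicit Types (x y C D tau : R).
Variables (Phi : R -> R[i]) (lam : P -> R) (a : R[i]) (c : nat -> R[i]).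
Hypothesis GPhi : schwartz_pos Phi.
Hypothesis lam0 : forall p, 0 < lam p.
Hypothesis a2 : -2 < complex.Re a.

(** Three identities match the j-summands: (i / (2 pi))^s D^(-s) = (- 2 pi i D)^(-s) with s = m + 1
    + (a + u) / 2, then (D C^2)^(- u / 2) = |C|^(- u) D^(- u / 2), and (-1)^m (-2)^(-j) = (-1)^(m -
    j) 2^(-j). The binomial coefficient is absorbed by [mellin_Phi_binom]. *)
Lemma calA_Tmain tau C D p m : 0 < tau -> C != 0 -> D != 0 -> lam p = `|C| ->
  (-1) ^+ m * calA tau a c m Phi (D * C ^+ 2) / cpow D%:C (m%:R + 1 + a / 2) =
  \sum_(j < m.+1) (-1) ^+ (m - j) * c (m - j)%N / 2 ^+ j *
    ((2 * pi)%:C^-1 * Tmain Phi lam (a / 2) tau m j p (- (2 * pi * D))).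
Proof.
move=> tau0 C0 D0 lp.
have r1 : -1 < re (a / 2) by rewrite cRe_half; move: a2; lra.
have p2 : 0 < 2 * pi :> R by rewrite mulr_gt0 ?pi_gt0.
set y := - (2 * pi * D).
have y0 : y != 0 by rewrite oppr_eq0 mulf_neq0// gt_eqF.
pose u t : R[i] := tau +i* t.
pose T j t := mellin (Phi_ Phi j) (u t) *
  (cpow 2%:C (u t / 2) * cpow (lam p)%:C (- u t) *
   (cpow (0 +i* y) (- (m%:R + 1 + a / 2 + u t / 2)) * CGamma (m%:R + 1 + a / 2 + u t / 2))).
have iT j : cint setT (T j) by exact: (J_limit GPhi lam0 r1 m j p tau0 y0).1.
pose k j : R[i] := c (m - j)%N / (- 2) ^+ j.
have ikT j : cint setT (fun t => k j * T j t) by exact: cintZ.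
(* The part D^(m + 1 + a / 2) of the power is constant along the line; outside the integral it
   cancels the denominator of the main term. *)
have I : Cintegral setT (fun t => mellin Phi (u t) * coef a c m (u t / 2) *
      CGamma (m%:R + 1 + (a + u t) / 2) * cpow (D * C ^+ 2)%:C (- u t / 2)) =
    cpow D%:C (m%:R + 1 + a / 2) * \sum_(j < m.+1) k j * Cintegral setT (T j).
  have -> : \sum_(j < m.+1) k j * Cintegral setT (T j) =
      Cintegral setT (fun t => \sum_(j < m.+1) k j * T j t).
    by rewrite Cintegral_sum//; apply: eq_bigr => j _; rewrite CintegralZ.
  rewrite -CintegralZ//; last exact: cint_sum.
  apply: eq_Cintegral => t _.
  have ut : 0 < re (u t) by [].
  have sE : m%:R + 1 + (a + u t) / 2 = m%:R + 1 + a / 2 + u t / 2 by ring.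
  rewrite sE cpow_sqr_mul//.
  have -> : 2 * (- u t / 2) = - u t by field.
  rewrite -lp /coef.
  have -> : 1 + m%:R + u t / 2 + a / 2 = m%:R + 1 + a / 2 + u t / 2 by ring.
  rewrite /T.
  rewrite -(cpow_imag (m%:R + 1 + a / 2 + u t / 2) D0).
  have -> : cpow D%:C (- (m%:R + 1 + a / 2 + u t / 2)) =
      (cpow D%:C (m%:R + 1 + a / 2))^-1 * cpow D%:C (- u t / 2).
    by rewrite -cpowN -cpowDr mulNr -opprD.
  rewrite rmorph_nat; have := cpow_neq0 D%:C (m%:R + 1 + a / 2).
  set d := cpow D%:C (m%:R + 1 + a / 2); set d2 := cpow D%:C _.
  set q := cpow _ (_ + _); set q2 := cpow 2 _; set l := cpow (lam p)%:C _.
  set G := CGamma _; set Me := mellin _ _; move=> dn.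
  rewrite [RHS]mulr_sumr.
  rewrite [LHS](_ : _ = \sum_(j < m.+1) (c (m - j)%N / (- 2) ^+ j * cbinom (u t / 2) j) *
     (Me * q * q2 * G * l * d2)); last first.
    by rewrite -mulr_suml; set Sg := \sum_(_ < _) _; ring.
  apply: eq_bigr => j _; rewrite /k mellin_Phi_binom// -/Me; set B := cbinom _ _.
  by set kk := c _ / _; field.
rewrite /calA /vline_integral I.
set S := \sum_(j < m.+1) k j * _.
have -> : \sum_(j < m.+1) (-1) ^+ (m - j) * c (m - j)%N / 2 ^+ j *
    ((2 * pi)%:C^-1 * Tmain Phi lam (a / 2) tau m j p y) = (-1) ^+ m * (2 * pi)%:C^-1 * S.
  rewrite /S mulr_sumr; apply: eq_bigr => j _.
  have jm : (j <= m)%N by rewrite -ltnS.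
  have -> : (-1) ^+ m = (-1) ^+ (m - j) * (-1) ^+ j :> R[i] by rewrite -exprD subnK.
  have -> : k j = (-1) ^+ j * (c (m - j)%N / 2 ^+ j).
    by rewrite /k [(- 2) ^+ j]exprNn invfM invr_sign; ring.
  have e2 : (-1) ^+ j * (-1) ^+ j = 1 :> R[i] by rewrite -expr2 sqrr_sign.
  have -> : Tmain Phi lam (a / 2) tau m j p y = Cintegral setT (T j) by [].
  set Z := Cintegral _ _; set s1 := (-1) ^+ (m - j); set s2 := (-1) ^+ j in e2 *.
  set cc := c _; set w := 2 ^+ j; set pp := (2 * pi)%:C^-1.
  rewrite [RHS](_ : _ = s2 * s2 * (s1 * cc / w * (pp * Z))); last by ring.
  by rewrite e2 mul1r.
have := cpow_neq0 D%:C (m%:R + 1 + a / 2); set d := cpow _ _ => dn.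
have -> : (2 * pi)%:C = 2 * pi%:C :> R[i] by rewrite rmorphM rmorph_nat.
have pn : pi%:C != 0 :> R[i] by rewrite -nm_gt0 nmR gtr0_norm ?pi_gt0.
have iN : 'i%C != 0 :> R[i] by apply/eqP => -[/eqP]; rewrite oner_eq0.
move: pn iN; set pc := pi%:C; set ii := 'i%C => pn iN; set s1 := (-1) ^+ m.
by clearbody pc ii s1; field; rewrite dn pn iN.
Qed.
End MainTermIdentity.

Lemma nm_e_ {R : realType} (x : R) : nm (e_ x) = 1.
Proof.
rewrite /e_ nm_Cexp.
have -> : 2 * pi%:C * 'i%C * x%:C = 0 +i* (2 * pi * x) :> R[i].
  by rewrite (imagE (2 * pi * x)) !rmorphM/= rmorph_nat; ring.
exact: expR0.
Qed.

Unset Implicit Arguments.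

Theorem theoremA15 (R : realType) (a : R[i]) (Phi h1 : R -> R[i])
    (c : bool -> nat -> R[i]) (M : nat) (tau1 : R) :
  -2 < complex.Re a ->
  schwartz Phi ->
  compactly_supported h1 ->
  smooth_up_to_bd h1 ->
  (forall s : bool, has_asymp_expansion a (h_ a h1) ((-1) ^+ s) (c s)) ->
  (0 < M)%N ->
  0 < tau1 \/ (tau1 = 0 /\ at_most_simple_pole_at0 (mellin Phi)) ->
  exists K : R, forall C D tau : R,
    C != 0 -> D != 0 -> 0 < tau ->
    (C < 0 -> forall x : R, Phi (- x) = Phi x) ->
    `|Cintegral [set x : R | 1 < `|x|]
        (fun x => h_ a h1 x * Phi (C / Num.sqrt (x ^+ 2 - 1)) * e_ (x * D))
      - \sum_(m < M.+1) \sum_(s : bool)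
          e_ ((-1) ^+ s * D) * (-1) ^+ m
          * calA tau a (c s) m Phi ((-1) ^+ s * (C ^+ 2 * D))
          / cpow ((-1) ^+ s * D)%:C (m%:R + 1 + a / 2)|
    <= K%:C * `|cpow (C ^+ 2 * D)%:C (- tau1%:C)
                * cpow D%:C (- (M%:R + 2 + a / 2))|.
Proof.
move=> a2 sP ch1 sh1 ash _ t1.
have tau10 : 0 <= tau1 by case: t1 => [/ltW//|[-> _]].
have GP := schwartz_schwartz_pos sP.
(* The modulus |C| becomes a parameter ranging over all positive reals, so the constants obtained
   below are uniform in C. *)
pose lam (p : {l : R | 0 < l}) : R := sval p.
have lam0 p : 0 < lam p by case: p.
(* This choice turns lam^kap w^(- kap / 2) into (C^2)^(- tau1) w^tau1. *)
pose kap : R := - 2 * tau1; have kap0 : kap <= 0 by rewrite /kap; lra.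
have r1 : -1 < re (a / 2) by rewrite cRe_half; move: a2; lra.
have hK s := one_side_estimate M (Hside_taylor sh1 (ash s)) (h1_support a s ch1) GP lam0 kap0 r1.
have [K1 K10 hK1] := hK true; have [K2 K20 hK2] := hK false.
(* One more than the order of the remainder: tau1 + M + 2 + re a / 2, the total exponent of 1 / |D|
   in the claim. *)
pose be := re (a / 2) + (- (kap / 2) + M.+1%:R) + 1.
pose y (D : R) (s : bool) : R := - (2 * pi * ((-1) ^+ s * D)).
pose S (D tau : R) (p : {l : R | 0 < l}) (s : bool) : R[i] := \sum_(m < M.+1) \sum_(j < m.+1)
  (-1) ^+ (m - j) * c s (m - j)%N / 2 ^+ j *
    ((2 * pi)%:C^-1 * Tmain Phi lam (a / 2) tau m j p (y D s)).
have p2 : 0 < 2 * pi :> R by rewrite mulr_gt0 ?pi_gt0.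
have est (D tau : R) p (s : bool) : D != 0 -> 0 < tau ->
    nm (Iside (Hside a h1 s) Phi lam (a / 2) p (0 +i* y D s) - S D tau p s) <=
    (K1 + K2) * lam p `^ kap * `|2 * pi * D| `^ (- be).
  move=> D0 tau0; have y0 : y D s != 0.
    by rewrite oppr_eq0 mulf_neq0 ?(gt_eqF p2)// mulf_neq0// signr_eq0.
  have -> : `|2 * pi * D| = `|y D s|.
    by rewrite /y normrN !normrM normr_sign mul1r.
  case: s y0 => y0; [apply: (le_trans (hK1 p _ tau y0 tau0))|apply: (le_trans (hK2 p _ tau y0 tau0))].
    by rewrite !ler_wpM2r ?powR_ge0// lerDl.
  by rewrite !ler_wpM2r ?powR_ge0// lerDr.
(* The factor 2 counts the half-lines, (2 pi)^(- be) comes from |y| = 2 pi |D|, and the exponential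
   pays for the complex power of a negative D. *)
exists (2 * (K1 + K2) * ((2 * pi) `^ (- be) * expR (`|im (a / 2)| * pi))).
move=> C D tau C0 D0 tau0 even.
have C1 : 0 < `|C| by rewrite normr_gt0.
pose p : {l : R | 0 < l} := exist _ `|C| C1; have lp : lam p = `|C| by [].
pose Ds (s : bool) : R := (-1) ^+ s * D.
have Ds0 s : Ds s != 0 by rewrite mulf_neq0// signr_eq0.
pose f (s : bool) (v : R) : R[i] := cpow v%:C (a / 2) * Hside a h1 s v * gd Phi lam 0 p (2 * v + v ^+ 2) *
  Cexp (- (0 +i* y D s) * v%:C).
have if_ s : cint `]0, +oo[ (f s).
  have z0 : 0 <= re (0 +i* y D s) by [].
  exact: (side_cint_exp (Hside_taylor sh1 (ash s)) (h1_support a s ch1) GP lam0 r1 p z0).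
have mI := mitv (`]0, +oo[ : interval R).
have LE : Cintegral [set x : R | 1 < `|x|]
     (fun x => h_ a h1 x * Phi (C / Num.sqrt (x ^+ 2 - 1)) * e_ (x * D)) =
   \sum_(s : bool) e_ (Ds s) * Iside (Hside a h1 s) Phi lam (a / 2) p (0 +i* y D s).
  rewrite (@Cintegral_outside _ _ (fun s v => e_ (Ds s) * f s v)).
  - by apply: eq_bigr => s _; rewrite CintegralZ.
  - by move=> s; exact: cintZ.
  - move=> s v v0; rewrite h_side// (Phi_side s v0 lp even) e_side /f /Ds.
    set t1' := cpow _ _; set t2 := Hside _ _ _ _; set t3 := gd _ _ _ _ _.
    by set t4 := e_ _; set t5 := Cexp _; ring.
have RE : \sum_(m < M.+1) \sum_(s : bool)
     e_ ((-1) ^+ s * D) * (-1) ^+ m * calA tau a (c s) m Phi ((-1) ^+ s * (C ^+ 2 * D))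
      / cpow ((-1) ^+ s * D)%:C (m%:R + 1 + a / 2) =
   \sum_(s : bool) e_ (Ds s) * S D tau p s.
  rewrite exchange_big; apply: eq_bigr => s _; rewrite mulr_sumr; apply: eq_bigr => m _.
  have := calA_Tmain (c s) GP lam0 a2 m tau0 C0 (Ds0 s) lp.
  have -> : (-1) ^+ s * (C ^+ 2 * D) = Ds s * C ^+ 2 by rewrite /Ds; ring.
  by move=> <-; rewrite /Ds !mulrA.
rewrite LE RE -sumrB [leLHS]normrC [X in _ <= _ * X]normrC -rmorphM lecR.
apply: (@le_trans _ _ (2 * ((K1 + K2) * `|C| `^ kap * `|2 * pi * D| `^ (- be)))).
  have hs s : nm (e_ (Ds s) * Iside (Hside a h1 s) Phi lam (a / 2) p (0 +i* y D s) -
      e_ (Ds s) * S D tau p s) <= (K1 + K2) * `|C| `^ kap * `|2 * pi * D| `^ (- be).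
    by rewrite -mulrBr nmM nm_e_ mul1r; exact: est.
  rewrite big_bool; apply: (le_trans (nmD _ _)).
  by rewrite mulr_natl mulr2n; apply: lerD; exact: hs.
have CD0 : C ^+ 2 * D != 0 by rewrite mulf_neq0// expf_neq0.
have N1 := nm_cpow_real_ge (- tau1%:C) CD0.
have N2 := nm_cpow_real_ge (- (M%:R + 2 + a / 2)) D0.
have i1 : im (- tau1%:C) = 0 :> R by rewrite cImN /= oppr0.
have i2 : im (- (M%:R + 2 + a / 2)) = - im (a / 2) :> R.
  by rewrite cImN 2!cImD !cIm_nat !add0r.
have e1 : re (- tau1%:C) = - tau1 :> R by rewrite cReN.
have e2 : re (- (M%:R + 2 + a / 2)) = - (M%:R + 2 + re (a / 2)) :> R.
  by rewrite cReN 2!cReD !cRe_nat.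
rewrite i1 e1 normr0 mul0r oppr0 expR0 mul1r in N1.
rewrite i2 e2 normrN in N2.
have D1 : 0 < `|D| by rewrite normr_gt0.
set I := `|im (a / 2)| * pi in N2 *.
have Cb : `|C ^+ 2 * D| `^ (- tau1) = `|C| `^ kap * `|D| `^ (- tau1).
  rewrite normrM normrX powRM ?exprn_ge0// -powR_mulrn// -powRrM.
  by congr (_ `^ _ * _); rewrite /kap; ring.
rewrite nmM; apply: le_trans (ler_wpM2l _ (ler_pM _ _ N1 N2)); last first.
- by rewrite mulr_ge0 ?powR_ge0// expR_ge0.
- exact: powR_ge0.
- by rewrite !mulr_ge0 ?powR_ge0 ?expR_ge0// addr_ge0.
rewrite Cb normrM (gtr0_norm p2) [(2 * pi * _) `^ _]powRM ?(ltW p2)//.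
have -> : `|D| `^ (- be) = `|D| `^ (- tau1) * `|D| `^ (- (M%:R + 2 + re (a / 2))).
  rewrite -powRD ?(gt_eqF D1) ?implybT//; congr (_ `^ _).
  by rewrite /be /kap -natr1; field.
rewrite expRN; have := expR_gt0 I; set X := expR I => X0.
set q1 := `|C| `^ _; set q2 := `|D| `^ _; set q3 := `|D| `^ _; set q4 := _ `^ (- be).
rewrite le_eqVlt; apply/orP; left; apply/eqP; field.
by rewrite gt_eqF.
Qed.
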